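(* Let $R$ be a short standard graded $k$-algebra (i.e. $R_i=0$ for $i\ge3$), and set $e=\operatorname{rank}_kR_1$. (a) Suppose $R$ is Gorenstein and $e\ge2$. Then for all pairs of integers $(p,q)$ with $p\ge1$, $q\ge0$ the set $\boldsymbol L_{p,q}(R)$ is open in $\operatorname{M}_{ep\times q}(k)$; it is not empty when $q\le(e-1)p$ and there exists a non-zero element $x\in R_1$ with $x^2=0$ (in particular, such an $x$ exists when $k$ is algebraically closed). (b) Suppose $R$ is quadratic with $H_R(s)=1+es+(e-1)s^2$ and $e\le3$. Then for all $p\ge1$ the set $\boldsymbol L_{p,(e-1)p}(R)$ is open in $\operatorname{M}_{ep\times(e-1)p}(k)$, and it is not empty if $k$ is infinite.
   Context: $k$ is a field. A standard graded $k$-algebra is a commutative graded algebra $R=\bigoplus_{j\ge0}R_j$ with $R_0=k$, generated over $k$ by finitely many elements of degree one. It is quadratic if $R\cong k[x_1,\dots,x_e]/I$ with $I$ generated by homogeneous quadratic forms. $H_R(s)=\sum_j(\operatorname{rank}_kR_j)s^j$. Modules are finitely generated and $\mathbb Z$-graded; $\beta^R_{i,j}(M)=\operatorname{rank}_k\operatorname{Tor}^R_i(M,k)_j$. A non-zero graded module $M$ is Koszul if $\beta^R_{i,j}(M)=0$ for all $j\ne i$. Multiplication tables. Fix a $k$-basis $x_1,\dots,x_e$ of $R_1$. Let $k^{p,q}$ be the graded vector space with basis $u_1,\dots,u_p$ in degree $0$ and $v_1,\dots,v_q$ in degree $1$. $\operatorname{M}_{ep\times q}(k)$ denotes the set of $ep\times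 q$ matrices over $k$ with rows indexed by pairs $(l,n)\in\{1,\dots,e\}\times\{1,\dots,p\}$ and columns by $\{1,\dots,q\}$; it is identified with the affine space $\mathbb A^{epq}_k$ with the Zariski topology (closed sets are the zero sets of polynomials in the entries; for $q=0$ it is a single point). Each matrix $C=(c_{(l,n),h})$ defines a graded $R$-module $R^C$ with underlying vector space $k^{p,q}$ by $x_lu_n=\sum_{h=1}^qc_{(l,n),h}v_h$ and $R_1v_h=0$. The linear locus is $\boldsymbol L_{p,q}(R)=\{C\in\operatorname{M}_{ep\times q}(k)\mid R^C\text{ is a Koszul }R\text{-module}\}$. *)

(* Defs.v *)
From HB Require Import structures.
From mathcomp Require Import all_boot all_order all_algebra.
From mathcomp Require Import mpoly.

Set Implicit Arguments.
Unset Strict Implicit.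
Unset Printing Implicit Defensive.

Import GRing.Theory.
Local Open Scope ring_scope.

(* A decomposition V = \bigoplus_i V_i, given by the projections
   hcomp i : V -> V onto the summands; V_i is the set [in_deg G i]. *)
Record grading (I : eqType) (V : zmodType) := Grading {
  hcomp :> I -> {additive V -> V};
  hcomp_orth : forall i j v,
    hcomp i (hcomp j v) = if i == j then hcomp j v else 0;
  hcomp_sum : forall v, exists2 s : seq I, uniq s & v = \sum_(i <- s) hcomp i v
}.

Definition in_deg (I : eqType) (V : zmodType) (G : grading I V) (i : I) (v : V)
  : Prop := G i v = v.

Definition kbasis (k : fieldType) (V : lmodType k) (S : V -> Prop) (n : nat)
    (b : 'I_n -> V) : Prop :=
  [/\ forall i, S (b i),
      forall c : 'rV[k]_n, \sum_i c 0 i *: b i = 0 -> c = 0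
    & forall v, S v -> exists c : 'rV[k]_n, v = \sum_i c 0 i *: b i].

Definition has_rank (k : fieldType) (V : lmodType k) (S : V -> Prop) (n : nat)
  : Prop := exists b : 'I_n -> V, kbasis S b.

(* [stdgr_gen]: every element is a polynomial expression in finitely many
   elements of degree one.  No rank condition on R_1 is needed. *)
Record std_graded (k : fieldType) (R : comAlgType k) := StdGraded {
  stdgr :> grading nat R;
  stdgr_mul : forall i j a b,
    in_deg stdgr i a -> in_deg stdgr j b -> in_deg stdgr (i + j)%N (a * b);
  stdgr_zero : forall a, in_deg stdgr 0%N a <-> exists c : k, a = c%:A;
  stdgr_gen : exists (n : nat) (y : 'I_n -> R),
    (forall i, in_deg stdgr 1%N (y i)) /\
    (forall a, exists f : {mpoly k[n]}, a = mmap (in_alg R) y f)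
}.

Definition short (k : fieldType) (R : comAlgType k) (gr : std_graded R) : Prop :=
  forall i a, (3 <= i)%N -> in_deg gr i a -> a = 0.

Definition ideal_gen (A : comNzRingType) (Q : A -> Prop) (f : A) : Prop :=
  exists (m : nat) (g h : 'I_m -> A),
    (forall i, Q (g i)) /\ f = \sum_i h i * g i.

(* A presentation by a graded surjection k[X_1,...,X_n] -> R whose kernel is
   generated by a set Q of quadratic forms. *)
Definition quadratic (k : fieldType) (R : comAlgType k) (gr : std_graded R)
  : Prop :=
  exists (n : nat) (y : 'I_n -> R) (Q : {mpoly k[n]} -> Prop),
    [/\ forall i, in_deg gr 1%N (y i),
        forall a, exists f : {mpoly k[n]}, a = mmap (in_alg R) y f,
        forall g, Q g -> g \is 2.-homog
      & forall f : {mpoly k[n]}, mmap (in_alg R) y f = 0 <-> ideal_gen Q f].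

(* H_R(s) equals the given polynomial, coefficient by coefficient. *)
Definition has_hilbert_series (k : fieldType) (R : comAlgType k)
    (gr : std_graded R) (H : {poly int}) : Prop :=
  forall j, exists2 d : nat, has_rank (in_deg gr j) d & H`_j = d%:Z.

Definition injective_module (A : comNzRingType) (J : lmodType A) : Prop :=
  forall (M N : lmodType A) (f : {linear M -> N}) (g : {linear M -> J}),
    injective f -> exists h : {linear N -> J}, forall m, h (f m) = g m.

(* Existence of an injective resolution 0 -> M -> J_0 -> ... -> J_n -> 0. *)
Definition finite_injdim (A : comNzRingType) (M : lmodType A) : Prop :=
  exists (n : nat) (J : nat -> lmodType A)
         (eta : {linear M -> J 0%N}) (d : forall i, {linear J i -> J i.+1}),
    [/\ forall i, injective_module (J i),
        forall i (y : J i), (n < i)%N -> y = 0,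
        injective eta,
        forall y, d 0%N y = 0 <-> exists m, y = eta m
      & forall i y, d i.+1 y = 0 <-> exists z, y = d i z].

Definition noetherian (A : comNzRingType) : Prop :=
  forall P : A -> Prop,
    P 0 -> (forall a b, P a -> P b -> P (a + b)) ->
    (forall a b, P b -> P (a * b)) ->
    exists (n : nat) (g : 'I_n -> A), forall a,
      P a <-> exists c : 'I_n -> A, a = \sum_i c i * g i.

(* The definition for local rings: a Noetherian local ring is Gorenstein when
   its injective dimension over itself is finite.  A short standard graded
   k-algebra is local, with maximal ideal R_1 + R_2, so no localization is
   needed. *)
Definition gorenstein (A : comNzRingType) : Prop :=
  noetherian A /\ finite_injdim (A^o : lmodType A).

Record graded_module (k : fieldType) (R : comAlgType k) (gr : std_graded R)
    (M : lmodType R) := GradedModule {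
  mgr :> grading int M;
  mgr_scale : forall (i : nat) (j : int) (a : R) (m : M),
    in_deg gr i a -> in_deg mgr j m -> in_deg mgr (i%:Z + j) (a *: m)
}.

(* The homogeneous component R_z for z in Z, with R_z = 0 for z < 0. *)
Definition in_degz (k : fieldType) (R : comAlgType k) (gr : std_graded R)
    (z : int) (a : R) : Prop :=
  match z with Posz d => in_deg gr d a | Negz _ => a = 0 end.

(* A graded resolution ... -> F_1 -> F_0 -> M -> 0 by free modules of finite
   rank.  F_i = R^(fr i) consists of row vectors, its s-th standard basis
   element has degree [fdeg i s], F_(i+1) -> F_i is u |-> u *m fdiff i, and
   F_0 -> M sends the s-th basis element to [faug s]. *)
Record free_resolution (k : fieldType) (R : comAlgType k) (gr : std_graded R)
    (M : lmodType R) (mg : graded_module gr M) := FreeResolution {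
  fr : nat -> nat;
  fdeg : forall i, 'I_(fr i) -> int;
  fdiff : forall i, 'M[R]_(fr i.+1, fr i);
  faug : 'I_(fr 0) -> M;
  fdiff_deg : forall i s t,
    in_degz gr (fdeg s - fdeg t) (fdiff i s t);
  faug_deg : forall s, in_deg mg (fdeg s) (faug s);
  faug_surj : forall m, exists u : 'rV[R]_(fr 0), m = \sum_s u 0 s *: faug s;
  faug_exact : forall u : 'rV[R]_(fr 0),
    \sum_s u 0 s *: faug s = 0 <-> exists v, u = v *m fdiff 0;
  fdiff_exact : forall i (u : 'rV[R]_(fr i.+1)),
    u *m fdiff i = 0 <-> exists v, u = v *m fdiff i.+1
}.

Section Betti.
Variables (k : fieldType) (R : comAlgType k) (gr : std_graded R).

Fact aug_subproof (a : R) : exists c : k, c%:A == gr 0%N a.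
Proof.
have /(stdgr_zero gr) [c Ec] : in_deg gr 0%N (gr 0%N a).
  by rewrite /in_deg hcomp_orth eqxx.
by exists c; rewrite -Ec.
Qed.

(* The augmentation R -> R / R_{>=1} = k: the scalar c with c%:A = a_0. *)
Definition aug (a : R) : k := xchoose (aug_subproof a).

Variables (M : lmodType R) (mg : graded_module gr M) (F : free_resolution mg).

(* The degree j component of F_i \otimes_R k = k^(fr i), as a row space. *)
Definition tens_deg (i : nat) (j : int) : 'M[k]_(fr F i) :=
  diag_mx (\row_s (fdeg (f := F) s == j)%:R).

Definition tens_diff (i : nat) : 'M[k]_(fr F i.+1, fr F i) :=
  map_mx aug (fdiff F i).

Definition tens_cycles (i : nat) (j : int) : 'M[k]_(fr F i) :=
  match i with
  | 0%N => tens_deg 0 j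
  | i'.+1 => (tens_deg i'.+1 j :&: kermx (tens_diff i'))%MS
  end.

Definition tens_boundaries (i : nat) (j : int) : 'M[k]_(fr F i.+1, fr F i) :=
  tens_deg i.+1 j *m tens_diff i.

(* rank_k H_i(F \otimes_R k)_j *)
Definition tor_rank (i : nat) (j : int) : nat :=
  (\rank (tens_cycles i j) - \rank (tens_boundaries i j))%N.

End Betti.

(* beta^R_{i,j}(M) = b, where Tor^R(M, k) is computed from a graded free
   resolution of M. *)
Definition betti_number (k : fieldType) (R : comAlgType k) (gr : std_graded R)
    (M : lmodType R) (mg : graded_module gr M) (i : nat) (j : int) (b : nat)
  : Prop := exists F : free_resolution mg, tor_rank F i j = b.

Definition koszul (k : fieldType) (R : comAlgType k) (gr : std_graded R)
    (M : lmodType R) (mg : graded_module gr M) : Prop :=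
  (exists m : M, m != 0) /\
  (forall (i : nat) (j : int), j != i%:Z -> betti_number mg i j 0).

Section Components.
Variables (k : fieldType) (R : comAlgType k) (gr : std_graded R).

Lemma hcomp_in (i : nat) (a : R) : in_deg gr i (gr i a).
Proof. by rewrite /in_deg hcomp_orth eqxx. Qed.

Lemma aug_algE a : (aug gr a)%:A = gr 0%N a.
Proof. exact/eqP/(xchooseP (aug_subproof gr a)). Qed.

Lemma in_deg_orth i j (a : R) :
  in_deg gr i a -> gr j a = if j == i then a else 0.
Proof. by move=> h; rewrite -h hcomp_orth. Qed.

Lemma hcomp_mulr n j a b : in_deg gr j b ->
  gr n (a * b) = if (j <= n)%N then gr (n - j)%N a * b else 0.
Proof.
move=> hb; have [s _ Ea] := hcomp_sum gr a.
have E i : gr n (gr i a * b) = if n == (i + j)%N then gr i a * b else 0.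
  by apply: in_deg_orth; apply: stdgr_mul hb; apply: hcomp_in.
rewrite {1}Ea mulr_suml raddf_sum /=.
under eq_bigr => i _ do rewrite E.
case: ifP => hj; last first.
  by apply: big1 => i _; case: eqP => // En; rewrite En leq_addl in hj.
rewrite [in RHS]Ea raddf_sum mulr_suml; apply: eq_bigr => i _ /=.
rewrite hcomp_orth -{1}(subnK hj) eqn_add2r.
by case: ifP => _; rewrite ?mul0r.
Qed.

Lemma hcomp_mul0 a b : gr 0%N (a * b) = gr 0%N a * gr 0%N b.
Proof.
have [s _ Eb] := hcomp_sum gr b.
rewrite [in LHS]Eb [in RHS]Eb mulr_sumr !raddf_sum mulr_sumr.
apply: eq_bigr => j _ /=.
rewrite (hcomp_mulr _ _ (hcomp_in j b)) hcomp_orth.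
by case: j => [|j] //=; rewrite mulr0.
Qed.

Lemma hcomp_mul1 a b :
  gr 1%N (a * b) = gr 0%N a * gr 1%N b + gr 1%N a * gr 0%N b.
Proof.
have [s _ Eb] := hcomp_sum gr b.
have E n : gr n b = \sum_(j <- s) gr n (gr j b) by rewrite {1}Eb raddf_sum.
rewrite [in LHS]Eb mulr_sumr raddf_sum (E 1%N) (E 0%N) !mulr_sumr -big_split.
apply: eq_bigr => j _ /=.
rewrite (hcomp_mulr _ _ (hcomp_in j b)) !hcomp_orth.
by case: j => [|[|j]] /=; rewrite ?mulr0 ?add0r ?addr0.
Qed.

Lemma in_deg1 : in_deg gr 0%N 1.
Proof. by apply/(stdgr_zero gr 1); exists 1; rewrite scale1r. Qed.

Lemma alg_inj (c d : k) : c%:A = d%:A :> R -> c = d.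
Proof.
move/eqP; rewrite -subr_eq0 -scalerBl scaler_eq0 oner_eq0 orbF subr_eq0.
by move/eqP.
Qed.

Lemma aug1 : aug gr 1 = 1.
Proof. by apply: alg_inj; rewrite aug_algE in_deg1 scale1r. Qed.

Lemma augD a b : aug gr (a + b) = aug gr a + aug gr b.
Proof. by apply: alg_inj; rewrite scalerDl !aug_algE raddfD. Qed.

Lemma augM a b : aug gr (a * b) = aug gr a * aug gr b.
Proof.
by apply: alg_inj; rewrite aug_algE hcomp_mul0 -!aug_algE mulr_algl scalerA.
Qed.

Variables (e : nat) (x : 'I_e -> R) (hx : kbasis (in_deg gr 1%N) x).

Fact coord1_subproof a : exists c : 'rV[k]_e, \sum_l c 0 l *: x l == gr 1%N a.
Proof. by case: hx => _ _ /(_ _ (hcomp_in 1 a)) [c Ec]; exists c; rewrite -Ec. Qed.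

Definition coord1 (a : R) : 'rV[k]_e := xchoose (coord1_subproof a).

Lemma coord1E a : \sum_l coord1 a 0 l *: x l = gr 1%N a.
Proof. exact/eqP/(xchooseP (coord1_subproof a)). Qed.

Lemma coord1_uniq a (c : 'rV[k]_e) :
  \sum_l c 0 l *: x l = gr 1%N a -> coord1 a = c.
Proof.
move=> Ec; apply/eqP; rewrite -subr_eq0; apply/eqP.
case: hx => _ free _; apply: free.
under eq_bigr => l _ do rewrite !mxE scalerBl.
by rewrite sumrB coord1E Ec subrr.
Qed.

Lemma coord1_1 : coord1 1 = 0.
Proof.
apply: coord1_uniq; rewrite (in_deg_orth _ in_deg1) /=.
by apply: big1 => l _; rewrite mxE scale0r.
Qed.

Lemma coord1D a b : coord1 (a + b) = coord1 a + coord1 b.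
Proof.
apply: coord1_uniq; rewrite raddfD -!coord1E -big_split /=.
by apply: eq_bigr => l _; rewrite mxE scalerDl.
Qed.

Lemma coord1M a b :
  coord1 (a * b) = aug gr a *: coord1 b + aug gr b *: coord1 a.
Proof.
apply: coord1_uniq; rewrite hcomp_mul1 -!coord1E -!aug_algE.
rewrite mulr_algl mulr_algr !scaler_sumr -big_split /=.
by apply: eq_bigr => l _; rewrite !mxE scalerDl !scalerA.
Qed.

End Components.

(* The carrier k^{p,q}: pairs (u, v), with u the coordinates in degree 0 and v
   those in degree 1.  The module structure is characterized by [table_modE]
   and [table_modE0]. *)
Definition table_mod (k : fieldType) (R : comAlgType k) (gr : std_graded R)
    (e : nat) (x : 'I_e -> R) (hx : kbasis (in_deg gr 1%N) x) (p q : nat)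
    (C : 'M[k]_(e * p, q)) : Type := ('rV[k]_p * 'rV[k]_q)%type.

Section TableModule.
Variables (k : fieldType) (R : comAlgType k) (gr : std_graded R).
Variables (e : nat) (x : 'I_e -> R) (hx : kbasis (in_deg gr 1%N) x).
Variables (p q : nat) (C : 'M[k]_(e * p, q)).

Local Notation RC := (table_mod hx C).

HB.instance Definition _ := GRing.Zmodule.on RC.

(* The p x q matrix of multiplication by x_l; [mxvec_index l n : 'I_(e * p)]
   is the row of C indexed by the pair (l, n). *)
Definition table_slice (l : 'I_e) : 'M[k]_(p, q) :=
  \matrix_(n, h) C (mxvec_index l n) h.

Definition table_scale (a : R) (w : RC) : RC :=
  (aug gr a *: w.1,
   aug gr a *: w.2 + w.1 *m \sum_l coord1 hx a 0 l *: table_slice l).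

Fact table_scaleA a b w :
  table_scale a (table_scale b w) = table_scale (a * b) w.
Proof.
rewrite /table_scale /= !augM !scalerA; congr pair.
rewrite scalerDr scalerA -addrA; congr (_ + _).
rewrite -scalemxAl !scalemxAr -mulmxDr; congr (_ *m _).
rewrite !scaler_sumr -big_split /=; apply: eq_bigr => l _.
by rewrite coord1M !mxE scalerDl !scalerA.
Qed.

Fact table_scale1 : left_id 1 table_scale.
Proof.
move=> [u v]; rewrite /table_scale /= aug1 coord1_1 !scale1r.
by rewrite big1 ?mulmx0 ?addr0 // => l _; rewrite mxE scale0r.
Qed.

Fact table_scaleDr : right_distributive table_scale +%R.
Proof.
move=> a [u v] [u' v']; rewrite /table_scale /=.
by congr pair; rewrite !scalerDr // mulmxDl addrACA.
Qed.

Fact table_scaleDl w : {morph table_scale^~ w : a b / a + b}.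
Proof.
move=> a b; rewrite /table_scale /= augD coord1D.
congr pair; rewrite /= !scalerDl // addrACA; congr (_ + _).
rewrite -mulmxDr -big_split /=; congr (_ *m _).
by apply: eq_bigr => l _; rewrite mxE scalerDl.
Qed.

HB.instance Definition _ := GRing.Zmodule_isLmodule.Build R RC
  table_scaleA table_scale1 table_scaleDr table_scaleDl.

Lemma table_modZ (a : R) (w : RC) : a *: w = table_scale a w.
Proof. by []. Qed.

Lemma table_modE (l : 'I_e) (n : 'I_p) :
  x l *: ((delta_mx 0 n, 0) : RC) =
  (0, \sum_h C (mxvec_index l n) h *: delta_mx 0 h) :> RC.
Proof.
have xl : in_deg gr 1%N (x l) by case: hx.
rewrite table_modZ /table_scale /=.
have -> : aug gr (x l) = 0.
  by apply: (@alg_inj k R); rewrite aug_algE (in_deg_orth _ xl) scale0r.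
have -> : coord1 hx (x l) = delta_mx 0 l.
  apply: coord1_uniq; rewrite xl (bigD1 l) //= mxE !eqxx scale1r.
  rewrite big1 ?addr0 // => m hm.
  by rewrite mxE eqxx (negbTE hm) scale0r.
rewrite !scale0r add0r; congr pair.
rewrite (bigD1 l) //= mxE !eqxx scale1r big1 ?addr0; last first.
  by move=> m hm; rewrite mxE eqxx (negbTE hm) scale0r.
rewrite -rowE; apply/rowP => h; rewrite !mxE summxE (bigD1 h) //=.
rewrite !mxE !eqxx mulr1 big1 ?addr0 // => h' hh'.
by rewrite !mxE eqxx eq_sym (negbTE hh') mulr0.
Qed.

Lemma table_modE0 (a : R) (v : 'rV[k]_q) :
  in_deg gr 1%N a -> a *: ((0, v) : RC) = 0.
Proof.
move=> ha; rewrite table_modZ /table_scale /= mul0mx scaler0.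
have -> : aug gr a = 0.
  by apply: (@alg_inj k R); rewrite aug_algE (in_deg_orth _ ha) scale0r.
by rewrite scale0r addr0.
Qed.

Definition table_hcomp (j : int) (w : RC) : RC :=
  (if j == 0 then w.1 else 0, if j == 1 then w.2 else 0).

Fact table_hcomp_additive j : zmod_morphism (table_hcomp j).
Proof.
move=> [u v] [u' v']; rewrite /table_hcomp /=.
by congr pair; case: ifP => _; rewrite //= subr0.
Qed.

HB.instance Definition _ j :=
  GRing.isZmodMorphism.Build RC RC (table_hcomp j) (table_hcomp_additive j).

Fact table_hcomp_orth (i j : int) w :
  table_hcomp i (table_hcomp j w) = if i == j then table_hcomp j w else 0.
Proof.
case: w => u v; rewrite /table_hcomp /=; case: (eqVneq i j) => [->|hij].
  by congr pair; case: eqP.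
have E d (z : int) : (i == z) && (j == z) -> d by
  case/andP => /eqP Ei /eqP Ej; rewrite Ei Ej eqxx in hij.
congr pair; case: ifP => // Ei; case: ifP => // Ej.
  by apply: (E _ 0); rewrite Ei Ej.
by apply: (E _ 1); rewrite Ei Ej.
Qed.

Fact table_hcomp_sum w :
  exists2 s : seq int, uniq s & w = \sum_(i <- s) table_hcomp i w.
Proof.
exists [:: 0; 1] => //; case: w => u v.
rewrite big_cons big_seq1 /table_hcomp /=.
by congr pair; rewrite /= ?addr0 ?add0r.
Qed.

Definition table_grading : grading int RC :=
  Grading (hcomp := table_hcomp) table_hcomp_orth table_hcomp_sum.

Fact table_grading_scale (i : nat) (j : int) (a : R) (m : RC) :
  in_deg gr i a -> in_deg table_grading j m ->
  in_deg table_grading (i%:Z + j) (a *: m).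
Proof.
case: m => u v; move=> ha hm.
have Eaug : i != 0%N -> aug gr a = 0.
  move=> hi; apply: (@alg_inj k R); rewrite aug_algE (in_deg_orth _ ha) scale0r.
  by rewrite eq_sym (negbTE hi).
have Ecoord : i != 1%N -> coord1 hx a = 0.
  move=> hi; apply: coord1_uniq; rewrite (in_deg_orth _ ha) eq_sym (negbTE hi).
  by apply: big1 => l _; rewrite mxE scale0r.
have S0 : \sum_l (0 : 'rV[k]_e) 0 l *: table_slice l = 0.
  by apply: big1 => l _; rewrite mxE scale0r.
move: hm; rewrite /in_deg /table_grading /= /table_hcomp /= => -[Eu Ev].
rewrite table_modZ /table_scale /=.
case: i ha Eaug Ecoord => [|[|i]] ha Eaug Ecoord.
- rewrite Ecoord // S0 mulmx0 addr0 add0r; congr pair.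
    by rewrite -[in RHS]Eu; case: ifP; rewrite ?scaler0.
  by rewrite -[in RHS]Ev; case: ifP; rewrite ?scaler0.
- rewrite Eaug // !scale0r add0r. congr pair; first by case: ifP.
  rewrite -Eu; have -> : (1%:Z + j == 1) = (j == 0).
    by rewrite -[X in _ == X]addr0 (inj_eq (addrI _)).
  by case: (j == 0); rewrite ?mul0mx.
rewrite Eaug // Ecoord // !scale0r S0 mulmx0 add0r.
by congr pair; case: ifP.
Qed.

Definition table_graded : graded_module gr RC :=
  GradedModule table_grading_scale.

End TableModule.

Definition linear_locus (k : fieldType) (R : comAlgType k) (gr : std_graded R)
    (e : nat) (x : 'I_e -> R) (hx : kbasis (in_deg gr 1%N) x) (p q : nat)
    (C : 'M[k]_(e * p, q)) : Prop := koszul (table_graded hx C).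

(* [mxvec C 0] enumerates the m * n entries of C. *)
Definition zariski_closed (k : fieldType) (m n : nat) (Z : 'M[k]_(m, n) -> Prop)
  : Prop :=
  exists S : {mpoly k[m * n]} -> Prop,
    forall C, Z C <-> (forall f, S f -> f.@[mxvec C 0] = 0).

Definition zariski_open (k : fieldType) (m n : nat) (U : 'M[k]_(m, n) -> Prop)
  : Prop := zariski_closed (fun C => ~ U C).

Definition infinite_field (k : fieldType) : Prop :=
  forall s : seq k, exists c : k, c \notin s.

(* Main.v *)
Require Import Defs.
From Stdlib Require Import Classical ClassicalEpsilon.
From HB Require Import structures.
From mathcomp Require Import all_boot all_order all_algebra.
From mathcomp Require Import mpoly.
From mathcomp Require Import ring zify.

Set Implicit Arguments.
Unset Strict Implicit.
Unset Printing Implicit Defensive.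

Import GRing.Theory.
Local Open Scope ring_scope.

(** A module [M] given by a table [C] has a minimal linear strand: the differentials
are matrices of linear forms whose rows are the linear syzygies of the preceding
ones. As [R] vanishes in degrees three and more, the strand resolves [M] exactly
when at each step the linear forms reach everything in degree two, a condition of
full rank on a matrix of scalars; then [M] is Koszul ([strand_koszul]).

These matrices do not vary algebraically with [C]. They are therefore replaced by
Tor: in the cases at hand the residue field [k], or a power of it, has a linear
resolution [P], and Tor of [M] is the homology of [M ** P], so that [M] is Koszul if
and only if all maps [phi i] from [M_0 ** P_(i+1)] to [M_1 ** P_i] are surjective
([koszul_phi_surj], [phi_surj_full]); both directions are zigzags in a double
complex. The entries of the matrix of [phi i] are linear in the entries of [C], so
each of these conditions is open. The locus is open as soon as finitely many
[phi i] suffice ([linear_locus_open]). It is not empty as soon as one cyclic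
module is Koszul, since surjectivity passes to direct sums and to quotients that
only lose part of degree one ([linear_locus_nonempty]).

If [R] is Gorenstein, its socle is the line [R_2] and the product is a perfect
pairing on [R_1] ([gorenstein_pairing]). Duality turns a failure of the strand of
[M] at step [n + 1] into injections of the terms of the dual strand of [k] into
the preceding terms, which ends with an injection of a space of dimension greater
than [n] into [M_0]. So the maps [phi i] with [i <= p] decide ([pairing_open]), and
for cyclic modules the first two, whence Koszul modules exist
([pairing_nonempty]). The same bound applied to [k] gives the resolution [P].

In the quadratic case with [e = 3], a quadratic algebra that is zero in degree
three has no point, and no linear form is killed by all others; over an infinite
field it follows that there is an exact pair [l], [l'] of linear forms:
multiplication by either one maps onto [R_2], with kernel spanned by the other
([quadratic_exact_pair]). The module [R / (l)] is Koszul, and iterated mapping cones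
resolve [k] ([exact_pair_linres]). Division of products by [l] identifies [R_1] with a cubic
algebra [T] and [R_2] with a quotient of [T] by a line ([cubic_model]). As long as
the ranks are full the differentials of the strand are square matrices of size [p]
over [T]. If the first one is invertible, so are all others. If it is not, the
dimensions of the kernels double at each step until they exceed [p]
([cubic_strand_full]), so the maps [phi i] with [i <= p + 1] decide.
If [e = 2] the pairing is perfect ([quadratic_nosocle2]), if [e <= 1] there are no
columns, and over a finite field every set of matrices is closed. *)

(** * Homogeneous components of a short graded algebra *)

Section Graded.
Variables (k : fieldType) (R : comAlgType k) (gr : std_graded R).
Hypothesis hshort : short gr.

Lemma in_deg_add i a b :
  in_deg gr i a -> in_deg gr i b -> in_deg gr i (a + b).
Proof. by rewrite /in_deg raddfD => -> ->. Qed.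

Lemma in_deg_zero i : in_deg gr i 0.
Proof. by rewrite /in_deg raddf0. Qed.

Lemma in_deg_opp i a : in_deg gr i a -> in_deg gr i (- a).
Proof. by rewrite /in_deg raddfN => ->. Qed.

Lemma in_deg_sum i (I : Type) (s : seq I) (P : pred I) (F : I -> R) :
  (forall j, P j -> in_deg gr i (F j)) -> in_deg gr i (\sum_(j <- s | P j) F j).
Proof.
move=> h; apply: (big_ind (in_deg gr i)) => //; first exact: in_deg_zero.
by move=> a b; apply: in_deg_add.
Qed.

Lemma in_deg_alg c : in_deg gr 0 (c%:A : R).
Proof. by apply/(stdgr_zero gr); exists c. Qed.

Lemma hcompZ i (c : k) a : gr i (c *: a) = c *: gr i a.
Proof.
by rewrite -[c *: a]mulr_algr (hcomp_mulr _ _ (in_deg_alg c)) subn0 mulr_algr.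
Qed.

Lemma in_deg_scale i (c : k) a : in_deg gr i a -> in_deg gr i (c *: a).
Proof. by rewrite /in_deg hcompZ => ->. Qed.

Lemma in_deg_mul i j a b :
  in_deg gr i a -> in_deg gr j b -> in_deg gr (i + j) (a * b).
Proof. exact: stdgr_mul. Qed.

Lemma mul_deg12 a b : in_deg gr 1 a -> in_deg gr 2 b -> a * b = 0.
Proof. by move=> ha hb; apply: (hshort _ (in_deg_mul ha hb)). Qed.

Lemma mul_deg22 a b : in_deg gr 2 a -> in_deg gr 2 b -> a * b = 0.
Proof. by move=> ha hb; apply: (hshort _ (in_deg_mul ha hb)). Qed.

Lemma short_decomp a : a = gr 0 a + gr 1 a + gr 2 a.
Proof.
have [s us Ea] := hcomp_sum gr a.
have Z i : (3 <= i)%N -> gr i a = 0 by move=> h; apply: (hshort h); apply: hcomp_in.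
have E i b : gr i (gr b a) = if i == b then gr b a else 0 by exact: hcomp_orth.
rewrite {1}Ea.
have S i : gr i a = \sum_(j <- s) (if i == j then gr i a else 0).
  rewrite {1}Ea raddf_sum; apply: eq_bigr => j _ /=; rewrite E.
  by case: eqP => // ->.
rewrite (S 0%N) (S 1%N) (S 2%N) -!big_split /=; apply: eq_bigr => j _.
by case: j => [|[|[|j]]] /=; rewrite ?addr0 ?add0r // Z.
Qed.

Lemma aug_deg i a : in_deg gr i.+1 a -> aug gr a = 0.
Proof.
by move=> h; apply: (@alg_inj k R); rewrite aug_algE (in_deg_orth _ h) scale0r.
Qed.

Lemma aug0 : aug gr 0 = 0.
Proof. by apply: (@alg_inj k R); rewrite aug_algE raddf0 scale0r. Qed.

Lemma aug_alg c : aug gr (c%:A : R) = c.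
Proof. by apply: (@alg_inj k R); rewrite aug_algE in_deg_alg. Qed.

Lemma augZ c a : aug gr (c *: a) = c * aug gr a.
Proof. by rewrite -mulr_algl augM aug_alg. Qed.

Lemma augN a : aug gr (- a) = - aug gr a.
Proof. by rewrite -scaleN1r augZ mulN1r. Qed.

Lemma aug_decomp a : a = (aug gr a)%:A + gr 1 a + gr 2 a.
Proof. by rewrite aug_algE -short_decomp. Qed.

Lemma aug_sum (I : Type) (s : seq I) (P : pred I) (F : I -> R) :
  aug gr (\sum_(j <- s | P j) F j) = \sum_(j <- s | P j) aug gr (F j).
Proof. by apply: big_morph; [exact: augD|exact: aug0]. Qed.

Lemma hcomp_mul2 a b :
  gr 2 (a * b) = gr 0 a * gr 2 b + gr 1 a * gr 1 b + gr 2 a * gr 0 b.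
Proof.
have L i : in_deg gr i (gr i b) by apply: hcomp_in.
rewrite {1}(short_decomp b) !mulrDr !raddfD /=.
rewrite (hcomp_mulr _ _ (L 0%N)) (hcomp_mulr _ _ (L 1%N)).
by rewrite (hcomp_mulr _ _ (L 2%N)) /= addrC [X in _ + X]addrC addrA.
Qed.

(** Components in degrees at most two determine an element, so all
multiplications reduce to [aug], [gr 1] and [gr 2]. *)
Lemma deg1_mul a b : in_deg gr 1 b ->
  a * b = aug gr a *: b + gr 1 a * b.
Proof.
move=> hb; rewrite {1}(aug_decomp a) !mulrDl mulr_algl.
by rewrite [gr 2 a * b]mulrC (mul_deg12 hb (hcomp_in _ _ _)) addr0.
Qed.

Lemma deg2_mul a b : in_deg gr 2 b -> a * b = aug gr a *: b.
Proof.
move=> hb; rewrite {1}(aug_decomp a) !mulrDl mulr_algl.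
by rewrite (mul_deg12 (hcomp_in _ _ _) hb) (mul_deg22 (hcomp_in _ _ _) hb) !addr0.
Qed.

Variables (e : nat) (x : 'I_e -> R) (hx : kbasis (in_deg gr 1%N) x).

Lemma basis_deg1 l : in_deg gr 1 (x l).
Proof. by case: hx. Qed.

Lemma coord1Z c a : coord1 hx (c *: a) = c *: coord1 hx a.
Proof.
apply: coord1_uniq; rewrite hcompZ -(coord1E hx) scaler_sumr.
by apply: eq_bigr => l _; rewrite mxE scalerA.
Qed.

Lemma coord1_0 : coord1 hx 0 = 0.
Proof. by rewrite -(scale0r 1) coord1Z scale0r. Qed.

Lemma coord1_sum (I : Type) (s : seq I) (P : pred I) (F : I -> R) :
  coord1 hx (\sum_(j <- s | P j) F j) = \sum_(j <- s | P j) coord1 hx (F j).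
Proof. by apply: big_morph; [exact: coord1D|exact: coord1_0]. Qed.

Lemma coord1_deg1 a : in_deg gr 1 a -> a = \sum_l coord1 hx a 0 l *: x l.
Proof. by rewrite coord1E. Qed.

Lemma coord1_basis (c : 'rV[k]_e) : coord1 hx (\sum_l c 0 l *: x l) = c.
Proof.
apply: coord1_uniq; rewrite raddf_sum; apply: eq_bigr => l _ /=.
by rewrite hcompZ basis_deg1.
Qed.

Lemma coord1_x l : coord1 hx (x l) = delta_mx 0 l.
Proof.
rewrite -[RHS]coord1_basis; congr (coord1 _ _).
rewrite (bigD1 l) //= mxE !eqxx scale1r big1 ?addr0 // => m hm.
by rewrite mxE eqxx (negbTE hm) scale0r.
Qed.

Lemma coord1_deg2 a : in_deg gr 2 a -> coord1 hx a = 0.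
Proof.
move=> h; apply: coord1_uniq; rewrite (in_deg_orth _ h) /=.
by apply: big1 => l _; rewrite mxE scale0r.
Qed.

Lemma coord1_eq0 a : in_deg gr 1 a -> coord1 hx a = 0 -> a = 0.
Proof.
move=> ha h0; rewrite (coord1_deg1 ha) h0.
by apply: big1 => l _; rewrite mxE scale0r.
Qed.

(** Every element is a polynomial expression in forms of degree one. *)
Lemma std_graded_ind (P : R -> Prop) :
  (forall c : k, P c%:A) -> (forall a, in_deg gr 1 a -> P a) ->
  (forall a b, P a -> P b -> P (a + b)) ->
  (forall a b, P a -> P b -> P (a * b)) -> forall a, P a.
Proof.
move=> Pc P1 PD PM a; have [n [z [hz hgen]]] := stdgr_gen gr; have [f ->] := hgen a.
have P_1 : P 1 by rewrite -(scale1r 1); apply: Pc.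
rewrite /mmap; apply: (big_ind P) => [|b c|].
- by rewrite -(scale0r 1); apply: Pc.
- exact: PD.
move=> m _; apply: (PM); first exact: Pc.
rewrite /mmap1; apply: (big_ind P) => [//|b c|i _]; first exact: PM.
elim: (m i) => [|d IH]; rewrite ?expr0 // exprS.
by apply: PM => //; apply: P1.
Qed.

Lemma deg2_span a : in_deg gr 2 a ->
  exists c : 'M[k]_e, a = \sum_i \sum_j c i j *: (x i * x j).
Proof.
pose S a := exists c : 'M[k]_e, a = \sum_i \sum_j c i j *: (x i * x j).
have S0 : S 0.
  by exists 0; rewrite big1 // => i _; rewrite big1 // => j _; rewrite mxE scale0r.
have SZ c b : S b -> S (c *: b).
  move=> [d ->]; exists (c *: d); rewrite scaler_sumr; apply: eq_bigr => i _.
  by rewrite scaler_sumr; apply: eq_bigr => j _; rewrite mxE scalerA.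
have SD b d : S b -> S d -> S (b + d).
  move=> [f ->] [g ->]; exists (f + g); rewrite -big_split; apply: eq_bigr => i _.
  by rewrite -big_split; apply: eq_bigr => j _; rewrite mxE scalerDl.
have S11 b d : in_deg gr 1 b -> in_deg gr 1 d -> S (b * d).
  move=> /coord1_deg1 -> /coord1_deg1 ->.
  exists (\matrix_(i, j) (coord1 hx b 0 i * coord1 hx d 0 j)).
  rewrite mulr_suml; apply: eq_bigr => i _; rewrite mulr_sumr.
  by apply: eq_bigr => j _; rewrite mxE -scalerAl -scalerAr scalerA.
move=> ha; suff : S (gr 2 a) by rewrite ha.
move: {ha}a; apply: std_graded_ind => [c|a ha|a b ha hb|a b ha hb].
- by rewrite (in_deg_orth _ (in_deg_alg c)).
- by rewrite (in_deg_orth _ ha).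
- by rewrite raddfD; apply: SD.
rewrite hcomp_mul2 -!aug_algE mulr_algl mulr_algr.
by do 2?[apply: (SD)]; [exact: SZ|exact: S11 (hcomp_in _ _ _) (hcomp_in _ _ _)|exact: SZ].
Qed.

End Graded.

(** * Coordinates of homogeneous matrices *)

Section Coordinates.
Variables (k : fieldType) (R : comAlgType k) (gr : std_graded R).

Definition emb m n (A : 'M[k]_(m, n)) : 'M[R]_(m, n) := map_mx (in_alg R) A.

Lemma embM m n p (A : 'M[k]_(m, n)) (B : 'M_(n, p)) :
  emb (A *m B) = emb A *m emb B.
Proof. exact: map_mxM. Qed.

Lemma emb0 m n : emb (0 : 'M[k]_(m, n)) = 0.
Proof. exact: map_mx0. Qed.

Lemma emb1 n : emb (1%:M : 'M[k]_n) = 1%:M.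
Proof. exact: map_mx1. Qed.

Lemma emb_tr m n (A : 'M[k]_(m, n)) : (emb A)^T = emb A^T.
Proof. by rewrite /emb map_trmx. Qed.

Definition mxdeg d m n (X : 'M[R]_(m, n)) := forall i j, in_deg gr d (X i j).

Lemma mxdeg_sub d m n (X Y : 'M[R]_(m, n)) :
  mxdeg d X -> mxdeg d Y -> mxdeg d (X - Y).
Proof. by move=> hX hY i j; rewrite !mxE; apply/in_deg_add/in_deg_opp. Qed.

Lemma mxdeg_mul d d' m n p (X : 'M[R]_(m, n)) (Y : 'M[R]_(n, p)) :
  mxdeg d X -> mxdeg d' Y -> mxdeg (d + d') (X *m Y).
Proof.
by move=> hX hY i j; rewrite mxE; apply: in_deg_sum => l _; apply: in_deg_mul.
Qed.

Lemma mxdeg_emb m n (A : 'M[k]_(m, n)) : mxdeg 0 (emb A).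
Proof. by move=> i j; rewrite mxE; apply: in_deg_alg. Qed.

Lemma mxdeg_embl d m n p (A : 'M[k]_(m, n)) (Y : 'M[R]_(n, p)) :
  mxdeg d Y -> mxdeg d (emb A *m Y).
Proof. by move=> h; apply: (mxdeg_mul (mxdeg_emb A) h). Qed.

Lemma mxdeg_embr d m n p (Y : 'M[R]_(m, n)) (A : 'M[k]_(n, p)) :
  mxdeg d Y -> mxdeg d (Y *m emb A).
Proof. by move=> h; rewrite -(addn0 d); apply: (mxdeg_mul h (mxdeg_emb A)). Qed.

Lemma mxdeg_tr d m n (X : 'M[R]_(m, n)) : mxdeg d X -> mxdeg d X^T.
Proof. by move=> h i j; rewrite mxE. Qed.

Section Basis.
Variables (d n : nat) (b : 'I_n -> R) (hb : kbasis (in_deg gr d) b).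

Fact gcoord_subproof a : exists c : 'rV[k]_n, \sum_l c 0 l *: b l == gr d a.
Proof.
by case: hb => _ _ /(_ _ (hcomp_in gr d a)) [c Ec]; exists c; rewrite -Ec.
Qed.

(** Coordinates of the degree [d] component of [a]. *)
Definition gcoord (a : R) : 'rV[k]_n := xchoose (gcoord_subproof a).

Lemma gcoordE a : \sum_l gcoord a 0 l *: b l = gr d a.
Proof. exact/eqP/(xchooseP (gcoord_subproof a)). Qed.

Lemma gcoord_uniq a (c : 'rV[k]_n) :
  \sum_l c 0 l *: b l = gr d a -> gcoord a = c.
Proof.
move=> Ec; apply/eqP; rewrite -subr_eq0; apply/eqP.
case: hb => _ free _; apply: free.
under eq_bigr => l _ do rewrite !mxE scalerBl.
by rewrite sumrB gcoordE Ec subrr.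
Qed.

Lemma gcoordD a a' : gcoord (a + a') = gcoord a + gcoord a'.
Proof.
apply: gcoord_uniq; rewrite raddfD -!gcoordE -big_split /=.
by apply: eq_bigr => l _; rewrite mxE scalerDl.
Qed.

Lemma gcoordZ c a : gcoord (c *: a) = c *: gcoord a.
Proof.
apply: gcoord_uniq; rewrite hcompZ -gcoordE scaler_sumr.
by apply: eq_bigr => l _; rewrite mxE scalerA.
Qed.

Lemma gcoord0 : gcoord 0 = 0.
Proof. by rewrite -(scale0r 1) gcoordZ scale0r. Qed.

Lemma gcoordN a : gcoord (- a) = - gcoord a.
Proof. by rewrite -scaleN1r gcoordZ scaleN1r. Qed.

Lemma gcoord_sum (I : Type) (s : seq I) (P : pred I) (F : I -> R) :
  gcoord (\sum_(j <- s | P j) F j) = \sum_(j <- s | P j) gcoord (F j).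
Proof. by apply: big_morph; [exact: gcoordD|exact: gcoord0]. Qed.

Lemma gcoord_basis (c : 'rV[k]_n) : gcoord (\sum_l c 0 l *: b l) = c.
Proof.
case: hb => bd _ _; apply: gcoord_uniq; rewrite raddf_sum.
by apply: eq_bigr => l _ /=; rewrite hcompZ bd.
Qed.

Lemma gcoordK a : in_deg gr d a -> \sum_l gcoord a 0 l *: b l = a.
Proof. by rewrite gcoordE. Qed.

Lemma gcoord_eq0 a : in_deg gr d a -> gcoord a = 0 -> a = 0.
Proof.
move=> ha h0; rewrite -(gcoordK ha) h0.
by apply: big1 => l _; rewrite mxE scale0r.
Qed.

Lemma gcoord_other d' a : d != d' -> in_deg gr d' a -> gcoord a = 0.
Proof.
move=> hd h; apply: gcoord_uniq; rewrite (in_deg_orth _ h) (negbTE hd).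
by apply: big1 => l _; rewrite mxE scale0r.
Qed.

(** A matrix of degree [d] is stored as a matrix of scalars with [n] times as
many columns; [gvc] is the inverse operation. *)
Definition gcv p q (X : 'M[R]_(p, q)) : 'M[k]_(p, n * q) :=
  \matrix_(i < p) mxvec (\matrix_(l < n, j < q) gcoord (X i j) 0 l).

Definition gvc p q (c : 'M[k]_(p, n * q)) : 'M[R]_(p, q) :=
  \matrix_(i, j) \sum_l c i (mxvec_index l j) *: b l.

Lemma gcvE p q (X : 'M[R]_(p, q)) i l j :
  gcv X i (mxvec_index l j) = gcoord (X i j) 0 l.
Proof. by rewrite mxE mxvecE mxE. Qed.

Lemma mx_indexP (T : Type) p q (A B : 'M[T]_(p, n * q)) :
  (forall i l j, A i (mxvec_index l j) = B i (mxvec_index l j)) -> A = B.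
Proof.
by move=> h; apply/matrixP => i w; case/mxvec_indexP: w => l j; apply: h.
Qed.

Lemma gvcK p q (c : 'M[k]_(p, n * q)) : gcv (gvc c) = c.
Proof.
apply: mx_indexP => i l j; rewrite gcvE mxE.
transitivity (gcoord (\sum_l (\row_l c i (mxvec_index l j)) 0 l *: b l) 0 l).
  by congr (gcoord _ 0 l); apply: eq_bigr => h _; rewrite mxE.
by rewrite gcoord_basis mxE.
Qed.

Lemma gvc_deg p q (c : 'M[k]_(p, n * q)) : mxdeg d (gvc c).
Proof.
move=> i j; rewrite mxE; apply: in_deg_sum => l _; apply: in_deg_scale.
by case: hb.
Qed.

Lemma gcvK p q (X : 'M[R]_(p, q)) : mxdeg d X -> gvc (gcv X) = X.
Proof.
move=> hX; apply/matrixP => i j; rewrite mxE -[RHS](gcoordK (hX i j)).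
by apply: eq_bigr => l _; rewrite gcvE.
Qed.

Lemma gcv_inj p q (X Y : 'M[R]_(p, q)) :
  mxdeg d X -> mxdeg d Y -> gcv X = gcv Y -> X = Y.
Proof. by move=> hX hY E; rewrite -(gcvK hX) E gcvK. Qed.

Lemma gcvD p q (X Y : 'M[R]_(p, q)) : gcv (X + Y) = gcv X + gcv Y.
Proof.
by apply: mx_indexP => i l j; rewrite [RHS]mxE !gcvE mxE gcoordD mxE.
Qed.

Lemma gcvN p q (X : 'M[R]_(p, q)) : gcv (- X) = - gcv X.
Proof.
by apply: mx_indexP => i l j; rewrite [RHS]mxE !gcvE mxE gcoordN mxE.
Qed.

Lemma gcv0 p q : gcv (0 : 'M[R]_(p, q)) = 0.
Proof. by apply: mx_indexP => i l j; rewrite gcvE !mxE gcoord0 mxE. Qed.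

Lemma gcv_other d' p q (X : 'M[R]_(p, q)) :
  d != d' -> mxdeg d' X -> gcv X = 0.
Proof.
by move=> hd hX; apply: mx_indexP => i l j; rewrite gcvE (gcoord_other hd) // !mxE.
Qed.

Lemma gcv_embM m p q (A : 'M[k]_(m, p)) (X : 'M[R]_(p, q)) :
  gcv (emb A *m X) = A *m gcv X.
Proof.
apply: mx_indexP => i l j; rewrite gcvE !mxE gcoord_sum summxE.
by apply: eq_bigr => h _; rewrite gcvE mxE mulr_algl gcoordZ mxE.
Qed.

Lemma gvc_embM m p q (A : 'M[k]_(m, p)) (c : 'M[k]_(p, n * q)) :
  gvc (A *m c) = emb A *m gvc c.
Proof.
apply: gcv_inj; [exact: gvc_deg|by apply/mxdeg_embl/gvc_deg|].
by rewrite gcv_embM !gvcK.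
Qed.

End Basis.

End Coordinates.

(** * The linear strand of a module *)

Section Strand.
Variables (k : fieldType) (R : comAlgType k) (gr : std_graded R).
Hypothesis hshort : short gr.
Variables (e : nat) (x : 'I_e -> R) (hx : kbasis (in_deg gr 1%N) x).
Variables (r : nat) (y : 'I_r -> R) (hy : kbasis (in_deg gr 2%N) y).

Local Notation emb := (@emb k R _ _).
Local Notation mxdeg := (mxdeg gr).
Local Notation cv := (gcv hx).
Local Notation vc := (@gvc k R e x _ _).
Local Notation cv2 := (gcv hy).

Lemma gcoord1 a : gcoord hx a = coord1 hx a.
Proof. by apply: gcoord_uniq; rewrite coord1E. Qed.

(** Row vectors of degree one over [R] are given by their coordinates, and in
these coordinates right multiplication by [X], with values in degree two, is
the scalar matrix [rmulmx X]. *)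
Definition rmulmx m n (X : 'M[R]_(m, n)) : 'M[k]_(e * m, r * n) :=
  cv2 (vc 1%:M *m X).

Lemma rmulmxE s m n (v : 'M[R]_(s, m)) (X : 'M[R]_(m, n)) :
  mxdeg 1 v -> cv2 (v *m X) = cv v *m rmulmx X.
Proof.
move=> hv; rewrite /rmulmx -gcv_embM mulmxA -(gvc_embM hx) mulmx1.
by rewrite gcvK.
Qed.

Lemma rmulmx_eq0 s m n (v : 'M[R]_(s, m)) (X : 'M[R]_(m, n)) :
  mxdeg 1 v -> mxdeg 1 X -> cv v *m rmulmx X = 0 -> v *m X = 0.
Proof.
move=> hv hX h; apply: (gcv_inj (hb := hy)) => [||].
- exact: (mxdeg_mul hv hX).
- by move=> i j; rewrite mxE; apply: in_deg_zero.
by rewrite rmulmxE // h gcv0.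
Qed.

Lemma rmulmx_full s m n (z : 'M[R]_(s, n)) (X : 'M[R]_(m, n)) :
  row_full (rmulmx X) -> mxdeg 1 X -> mxdeg 2 z ->
  exists2 v : 'M[R]_(s, m), mxdeg 1 v & z = v *m X.
Proof.
move=> hf hX hz; have /submxP[a Ea] := submx_full (cv2 z) hf.
exists (vc a); first exact: gvc_deg.
apply: (gcv_inj (hb := hy)) => //; first exact: (mxdeg_mul (gvc_deg hx a) hX).
by rewrite rmulmxE ?gvcK //; apply: gvc_deg.
Qed.

(** The rows of [lker A] form a basis of the degree-one row vectors whose
coordinates are killed by [A]. *)
Definition lker m N (A : 'M[k]_(e * m, N)) : 'M[R]_(\rank (kermx A), m) :=
  vc (row_base (kermx A)).

Lemma lker_deg m N (A : 'M[k]_(e * m, N)) : mxdeg 1 (lker A).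
Proof. exact: gvc_deg. Qed.

Lemma lker_ker m N (A : 'M[k]_(e * m, N)) : cv (lker A) *m A = 0.
Proof. by rewrite gvcK; apply/sub_kermxP; rewrite eq_row_base. Qed.

Lemma lker_complete s m N (A : 'M[k]_(e * m, N)) (u : 'M[R]_(s, m)) :
  mxdeg 1 u -> cv u *m A = 0 -> exists c, u = emb c *m lker A.
Proof.
move=> hu /sub_kermxP; rewrite -(eq_row_base (kermx A)) => /submxP[c Ec].
by exists c; rewrite -(gvc_embM hx) -Ec gcvK.
Qed.

Lemma lker_free s m N (A : 'M[k]_(e * m, N)) (c : 'M[k]_(s, _)) :
  emb c *m lker A = 0 -> c = 0.
Proof.
move=> h; apply: (row_free_inj (row_base_free (kermx A))).
by rewrite mul0mx -(gvcK hx (c *m _)) (gvc_embM hx) h gcv0.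
Qed.

(** One step of the minimal free resolution: [sA] is the map whose degree-one
kernel has to be resolved. *)
Record lstate := LState { sm : nat; sN : nat; sA : 'M[k]_(e * sm, sN) }.

Definition snext (s : lstate) : lstate := LState (rmulmx (lker (sA s))).

Definition sX (s : lstate) : 'M[R]_(sm (snext s), sm s) := lker (sA s).

Definition strand (s : lstate) (i : nat) : lstate := iter i snext s.

Lemma sX_deg s : mxdeg 1 (sX s).
Proof. exact: lker_deg. Qed.

Lemma sX_free s t (c : 'M[k]_(t, _)) : emb c *m sX s = 0 -> c = 0.
Proof. exact: lker_free. Qed.

Lemma sX_complete s t (u : 'M[R]_(t, sm (snext s))) :
  mxdeg 1 u -> u *m sX s = 0 -> exists c, u = emb c *m sX (snext s).
Proof.
by move=> hu h; apply: lker_complete => //; rewrite -rmulmxE // h gcv0.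
Qed.

Lemma sX_mul s : sX (snext s) *m sX s = 0.
Proof.
apply: rmulmx_eq0; [exact: sX_deg|exact: sX_deg|exact: lker_ker].
Qed.

Lemma sm_snext s : sm (snext s) = (e * sm s - \rank (sA s))%N.
Proof. by rewrite /= mxrank_ker. Qed.

Lemma mx_decomp m n (u : 'M[R]_(m, n)) :
  u = emb (map_mx (aug gr) u) + map_mx (gr 1) u + map_mx (gr 2) u.
Proof. by apply/matrixP => i j; rewrite !mxE /= aug_algE -(short_decomp hshort). Qed.

Lemma hcomp_mxdeg d m n (u : 'M[R]_(m, n)) : mxdeg d (map_mx (gr d) u).
Proof. by move=> i j; rewrite mxE; apply: hcomp_in. Qed.

Lemma mx_mul12 m n p (X : 'M[R]_(m, n)) (Y : 'M[R]_(n, p)) :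
  mxdeg 1 X -> mxdeg 2 Y -> X *m Y = 0.
Proof.
move=> hX hY; apply/matrixP => i j; rewrite !mxE big1 // => l _.
exact: (mul_deg12 hshort).
Qed.

Lemma mx_mul21 m n p (X : 'M[R]_(m, n)) (Y : 'M[R]_(n, p)) :
  mxdeg 2 X -> mxdeg 1 Y -> X *m Y = 0.
Proof.
move=> hX hY; apply/matrixP => i j; rewrite !mxE big1 // => l _.
by rewrite mulrC (mul_deg12 hshort).
Qed.

Lemma mxdeg_comp d m n (u : 'M[R]_(m, n)) : mxdeg d u -> map_mx (gr d) u = u.
Proof. by move=> h; apply/matrixP => i j; rewrite mxE h. Qed.

Lemma mxdeg_comp0 d d' m n (u : 'M[R]_(m, n)) :
  mxdeg d u -> d' != d -> map_mx (gr d') u = 0.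
Proof.
by move=> h hd; apply/matrixP => i j; rewrite !mxE (in_deg_orth _ (h i j)) (negbTE hd).
Qed.

Lemma sum_deg_eq0 m n (u v : 'M[R]_(m, n)) :
  mxdeg 1 u -> mxdeg 2 v -> u + v = 0 -> u = 0 /\ v = 0.
Proof.
move=> hu hv h.
have E1 : map_mx (gr 1) (u + v) = u.
  by rewrite map_mxD (mxdeg_comp hu) (mxdeg_comp0 hv) // addr0.
have u0 : u = 0 by rewrite -E1 h map_mx0.
by split => //; move: h; rewrite u0 add0r.
Qed.

(** Only the part of degree one of a syzygy of a linear matrix matters: in
degree zero there is nothing, and degree two consists of syzygies only, which
are generated in degree one exactly when [sA] has full row space. *)
Lemma sX_exact s t (u : 'M[R]_(t, sm (snext s))) :
  row_full (sA (snext (snext s))) -> u *m sX s = 0 -> exists v, u = v *m sX (snext s).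
Proof.
move=> hf h; set u0 := map_mx (aug gr) u.
have hu1 : mxdeg 1 (map_mx (gr 1) u) by exact: hcomp_mxdeg.
have hu2 : mxdeg 2 (map_mx (gr 2) u) by exact: hcomp_mxdeg.
move: h; rewrite {1}(mx_decomp u) !mulmxDl (mx_mul21 hu2 (@sX_deg s)) addr0.
case/sum_deg_eq0.
- exact/mxdeg_embl/sX_deg.
- exact: (mxdeg_mul hu1 (@sX_deg s)).
move=> /sX_free E0 /(sX_complete hu1)[c E1].
have [w _ E2] := rmulmx_full hf (@sX_deg (snext s)) hu2.
exists (emb c + w); rewrite mulmxDl -E1 -E2 {1}(mx_decomp u).
by rewrite E0 emb0 add0r.
Qed.

End Strand.

(** * Koszul modules from linear resolutions *)

Lemma sum_mxvec_index (V : nmodType) m n (F : 'I_(m * n) -> V) :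
  \sum_i F i = \sum_l \sum_j F (mxvec_index l j).
Proof.
rewrite (reindex _ (curry_mxvec_bij m n)) /= pair_bigA.
by apply: eq_bigr => -[l j].
Qed.

Section TableModules.
Variables (k : fieldType) (R : comAlgType k) (gr : std_graded R).
Hypothesis hshort : short gr.
Variables (e : nat) (x : 'I_e -> R) (hx : kbasis (in_deg gr 1%N) x).

Local Notation emb := (@emb k R _ _).
Local Notation mxdeg := (mxdeg gr).
Local Notation cv := (gcv hx).

Lemma mul_coordE t p q (X : 'M[R]_(t, p)) (C : 'M[k]_(e * p, q)) :
  cv X *m C = \sum_l map_mx (fun a => coord1 hx a 0 l) X *m table_slice C l.
Proof.
apply/matrixP => i h; rewrite mxE summxE.
rewrite sum_mxvec_index; apply: eq_bigr => l _; rewrite mxE; apply: eq_bigr => n _.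
by rewrite gcvE gcoord1 !mxE.
Qed.

Section Module.
Variables (p q : nat) (C : 'M[k]_(e * p, q)).
Local Notation RC := (table_mod hx C).

Lemma table_fst_sum (I : Type) (s : seq I) (P : pred I) (F : I -> RC) :
  (\sum_(i <- s | P i) F i).1 = \sum_(i <- s | P i) (F i).1.
Proof. exact: (big_morph (fun w : RC => w.1)). Qed.

Lemma table_snd_sum (I : Type) (s : seq I) (P : pred I) (F : I -> RC) :
  (\sum_(i <- s | P i) F i).2 = \sum_(i <- s | P i) (F i).2.
Proof. exact: (big_morph (fun w : RC => w.2)). Qed.

Definition table_gen (s : 'I_p) : RC := (delta_mx 0 s, 0).

Lemma table_gen_sum (u : 'rV[R]_p) :
  \sum_s u 0 s *: table_gen s = (map_mx (aug gr) u, cv u *m C) :> RC.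
Proof.
apply: injective_projections; rewrite /= ?table_fst_sum ?table_snd_sum.
  apply/rowP => j; rewrite summxE mxE (bigD1 j) //= !mxE !eqxx mulr1.
  by rewrite big1 ?addr0 // => i hi; rewrite !mxE eq_sym (negbTE hi) andbF mulr0.
rewrite mul_coordE.
transitivity (\sum_s \sum_l coord1 hx (u 0 s) 0 l *: row s (table_slice C l)).
  apply: eq_bigr => s _; rewrite /= scaler0 add0r -rowE linear_sum.
  by apply: eq_bigr => l _; rewrite /= linearZ.
rewrite exchange_big; apply: eq_bigr => l _; rewrite mulmx_sum_row.
by apply: eq_bigr => s _; rewrite mxE.
Qed.

End Module.

(** A module with a resolution by matrices of linear forms is Koszul: with
[fdeg i s = i] the complexes that compute Tor vanish in degrees [j != i]. *)
Lemma koszul_of_linear (fr : nat -> nat) q (C : 'M[k]_(e * fr 0, q))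
    (X : forall i, 'M[R]_(fr i.+1, fr i)) :
  (0 < fr 0)%N -> row_full C -> (forall i, mxdeg 1 (X i)) ->
  cv (X 0%N) *m C = 0 ->
  (forall u : 'rV[R]_(fr 0), map_mx (aug gr) u = 0 -> cv u *m C = 0 ->
     exists v, u = v *m X 0%N) ->
  (forall i, X i.+1 *m X i = 0) ->
  (forall i (u : 'rV[R]_(fr i.+1)), u *m X i = 0 -> exists v, u = v *m X i.+1) ->
  linear_locus hx C.
Proof.
move=> p0 Cfull Xdeg XC Xaug XX Xex.
have fdeg_ok i (s : 'I_(fr i.+1)) (t : 'I_(fr i)) :
    in_degz gr ((i.+1)%:Z - i%:Z) (X i s t).
  have -> : (i.+1)%:Z - i%:Z = 1%N by lia.
  exact: Xdeg.
have faug_ok (s : 'I_(fr 0)) : in_deg (table_graded hx C) 0%:Z (table_gen C s).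
  by [].
have surj (m : table_mod hx C) :
    exists u : 'rV[R]_(fr 0), m = \sum_s u 0 s *: table_gen C s.
  case: m => m0 m1; have /submxP[a Ea] := submx_full m1 Cfull.
  exists (emb m0 + gvc x a); rewrite table_gen_sum; congr pair.
    apply/rowP => j; rewrite !mxE augD /= aug_alg aug_sum big1 ?addr0 // => l _.
    by rewrite augZ (aug_deg (basis_deg1 hx l)) mulr0.
  rewrite gcvD gvcK mulmxDl Ea.
  by rewrite (gcv_other hx (d' := 0%N)) ?mul0mx ?add0r //; exact: mxdeg_emb.
have ex0 (u : 'rV[R]_(fr 0)) :
    \sum_s u 0 s *: table_gen C s = 0 <-> exists v, u = v *m X 0%N.
  rewrite table_gen_sum; split=> [[h1 h2]|[v ->]]; first exact: Xaug.
  congr pair.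
    apply/rowP => j; rewrite !mxE aug_sum big1 // => i _.
    by rewrite augM (aug_deg (Xdeg 0%N i j)) mulr0.
  rewrite (mx_decomp hshort v) !mulmxDl (mx_mul21 hshort (@hcomp_mxdeg _ _ gr 2 _ _ v) (@Xdeg 0%N)).
  rewrite addr0 gcvD gcv_embM mulmxDl -mulmxA XC mulmx0 add0r.
  rewrite (gcv_other hx (d' := 2%N)) ?mul0mx //.
  exact: (mxdeg_mul (@hcomp_mxdeg _ _ gr 1 _ _ v) (@Xdeg 0%N)).
have exS i (u : 'rV[R]_(fr i.+1)) :
    u *m X i = 0 <-> exists v, u = v *m X i.+1.
  by split; [exact: Xex|case=> v ->; rewrite -mulmxA XX mulmx0].
pose F := @FreeResolution k R gr _ (table_graded hx C) fr (fun i _ => i%:Z) X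
  (table_gen C) fdeg_ok faug_ok surj ex0 exS.
split.
  exists (table_gen C (Ordinal p0)); apply/eqP => -[/rowP/(_ (Ordinal p0))].
  by rewrite !mxE !eqxx => /eqP; rewrite oner_eq0.
move=> i j hij; exists F.
have D0 : tens_deg F i j = 0.
  apply/matrixP => a b; rewrite !mxE /=.
  by rewrite eq_sym (negbTE hij) mul0rn.
rewrite /tor_rank; suff -> : tens_cycles F i j = 0 by rewrite mxrank0.
case: i {hij} D0 => [|i] //= ->.
by apply/eqP; rewrite -submx0 capmxSl.
Qed.

End TableModules.

Section StrandKoszul.
Variables (k : fieldType) (R : comAlgType k) (gr : std_graded R).
Hypothesis hshort : short gr.
Variables (e : nat) (x : 'I_e -> R) (hx : kbasis (in_deg gr 1%N) x).
Variables (r : nat) (y : 'I_r -> R) (hy : kbasis (in_deg gr 2%N) y).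

Local Notation emb := (@emb k R _ _).
Local Notation cv := (gcv hx).
Local Notation strand := (strand x hy).

Lemma strand_aug p q (C : 'M[k]_(e * p, q)) (u : 'rV[R]_p) :
  row_full (sA (strand (LState C) 1)) ->
  map_mx (aug gr) u = 0 -> cv u *m C = 0 ->
  exists v, u = v *m sX x hy (strand (LState C) 0).
Proof.
move=> full1 u0 uC; have hu : u = map_mx (gr 1) u + map_mx (gr 2) u.
  by rewrite {1}(mx_decomp hshort u) u0 emb0 add0r.
have h1 : cv (map_mx (gr 1) u) *m C = 0.
  move: uC; rewrite {1}hu gcvD [cv (map_mx (gr 2) u)](gcv_other hx (d' := 2%N)) ?addr0 //.
  exact: hcomp_mxdeg.
have [c E1] := lker_complete (@hcomp_mxdeg _ _ gr 1 _ _ u) h1.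
have [w _ E2] := rmulmx_full hx full1 (@lker_deg _ _ _ _ _ hx _ _ C) (@hcomp_mxdeg _ _ gr 2 _ _ u).
by exists (emb c + w); rewrite mulmxDl /sX /= -E1 -E2.
Qed.

(** When all ranks are full the strand is a resolution, and its differentials are
linear. *)
Lemma strand_koszul p q (C : 'M[k]_(e * p, q)) : (0 < p)%N ->
  (forall i, row_full (sA (strand (LState C) i))) -> linear_locus hx C.
Proof.
move=> p0 full.
have K := (@koszul_of_linear _ _ _ hshort _ _ hx (fun i => sm (strand (LState C) i)) q C
  (fun i => sX x hy (strand (LState C) i))); apply: K => //.
- by move=> i; apply: sX_deg.
- exact: lker_ker.
- by move=> u; apply: strand_aug; apply: (full 1%N).
- by move=> i; apply: sX_mul.
- by move=> i u; apply: sX_exact => //; apply: (full i.+2).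
Qed.

End StrandKoszul.

(** * Tor computed with a linear resolution of the residue field *)

Lemma mul_rowwise (A : pzRingType) t n m
    (U : 'M[A]_(t, n)) (B : 'M[A]_(m, n)) :
  (forall i, exists v, row i U = v *m B) -> exists V, U = V *m B.
Proof.
move=> /fin_all_exists[f Ef]; exists (\matrix_i f i).
by apply/row_matrixP => i; rewrite row_mul rowK.
Qed.

Section LinRes.
Variables (k : fieldType) (R : comAlgType k) (gr : std_graded R).
Hypothesis hshort : short gr.

Local Notation emb := (@emb k R _ _).
Local Notation mxdeg := (mxdeg gr).

(** A resolution of a power of the residue field by matrices of linear forms. *)
Record linres := LinRes {
  lb : nat -> nat;
  lD : forall j, 'M[R]_(lb j.+1, lb j);
  lb_gt0 : (0 < lb 0)%N;
  lD_deg : forall j, mxdeg 1 (lD j);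
  lD_mul : forall j, lD j.+1 *m lD j = 0;
  lD_aug : forall u : 'rV[R]_(lb 0), map_mx (aug gr) u = 0 ->
    exists v, u = v *m lD 0;
  lD_exact : forall j (u : 'rV[R]_(lb j.+1)), u *m lD j = 0 ->
    exists v, u = v *m lD j.+1
}.

Variable P : linres.
Local Notation D := (lD P).

Lemma lD_mulT j : (D j)^T *m (D j.+1)^T = 0.
Proof. by rewrite -trmx_mul lD_mul trmx0. Qed.

Lemma lDT_deg j : mxdeg 1 (D j)^T.
Proof. exact/mxdeg_tr/lD_deg. Qed.

Lemma lD_augT t (u : 'M[R]_(lb P 0, t)) :
  map_mx (aug gr) u = 0 -> exists v, u = (D 0)^T *m v.
Proof.
move=> hu; have [|V EV] := @mul_rowwise _ _ _ _ u^T (D 0).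
  move=> i; apply: lD_aug; rewrite map_row -map_trmx hu trmx0.
  by apply/rowP => j; rewrite !mxE.
by exists V^T; rewrite -trmx_mul -EV trmxK.
Qed.

Lemma lD_exactT j t (u : 'M[R]_(lb P j.+1, t)) :
  (D j)^T *m u = 0 -> exists v, u = (D j.+1)^T *m v.
Proof.
move=> hu; have [|V EV] := @mul_rowwise _ _ _ _ u^T (D j.+1).
  move=> i; apply: lD_exact; rewrite -row_mul -(trmxK (D j)) -trmx_mul hu.
  by apply/rowP => l; rewrite !mxE.
by exists V^T; rewrite -trmx_mul -EV trmxK.
Qed.

Lemma lD_deg2 j t (z : 'M[R]_(lb P j, t)) : mxdeg 2 z ->
  exists2 u, mxdeg 1 u & z = (D j)^T *m u.
Proof.
move=> hz; suff [v Ev] : exists v, z = (D j)^T *m v.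
  exists (map_mx (gr 1) v); first exact: hcomp_mxdeg.
  rewrite -(mxdeg_comp hz) Ev {1}(mx_decomp hshort v) !mulmxDr.
  rewrite (mx_mul12 hshort (@lDT_deg j) (@hcomp_mxdeg _ _ gr 2 _ _ v)) addr0 map_mxD.
  have -> : map_mx (gr 2) ((D j)^T *m emb (map_mx (aug gr) v)) = 0.
    by apply: (@mxdeg_comp0 _ _ _ 1) => //; apply/mxdeg_embr/lDT_deg.
  rewrite add0r; apply: mxdeg_comp.
  exact: (mxdeg_mul (@lDT_deg j) (@hcomp_mxdeg _ _ gr 1 _ _ v)).
case: j z hz => [|j] z hz.
  by apply: lD_augT; apply/matrixP => a b; rewrite !mxE (aug_deg (hz a b)).
by apply: lD_exactT; apply: (mx_mul12 hshort) => //; apply: lDT_deg.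
Qed.

Section Strand.
Variables (e : nat) (x : 'I_e -> R) (hx : kbasis (in_deg gr 1%N) x).
Variables (r : nat) (y : 'I_r -> R) (hy : kbasis (in_deg gr 2%N) y).
Local Notation strand := (strand x hy).
Local Notation sX := (sX x hy).
Local Notation cv := (gcv hx).

(** The differential [M_0 ** P_(i+1) -> M_1 ** P_i] of the complex [M ** P] that
computes Tor; its cokernel is the part of degree [i + 1] of [Tor_i(M, k)]. *)
Definition phi p q i (C : 'M[k]_(e * p, q)) (v : 'M[k]_(lb P i.+1, p)) :
  'M[k]_(lb P i, q) := cv ((D i)^T *m emb v) *m C.

Definition phi_surj p q i (C : 'M[k]_(e * p, q)) :=
  forall m, exists v, phi C v = m :> 'M[k]_(lb P i, q).

Variables (p q : nat) (C : 'M[k]_(e * p, q)).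
Local Notation S i := (strand (LState C) i).

Lemma phi_surj_split i j (u : 'M[R]_(lb P j, sm (S i))) :
  phi_surj (i + j) C -> mxdeg 1 u ->
  exists v w, u = (D j)^T *m emb v + emb w *m sX (S i).
Proof.
elim: i j u => [|i IH] j u hs hu.
  have [v Ev] := hs (cv u *m C); exists v.
  have [] := @lker_complete _ _ _ _ _ hx (lb P j) _ _ C (u - (D j)^T *m emb v).
  - by apply: mxdeg_sub => //; apply/mxdeg_embr/lDT_deg.
  - by rewrite gcvD gcvN mulmxDl mulNmx -/(phi C v) Ev subrr.
  by move=> w Ew; exists w; rewrite /(sX _) /= -Ew addrC subrK.
have [u' hu' Eu'] : exists2 u', mxdeg 1 u' & u *m sX (S i) = (D j)^T *m u'.
  by apply: lD_deg2; apply: (mxdeg_mul hu (@sX_deg _ _ _ _ _ hx _ _ hy _)).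
have [|v' [w' E]] := IH j.+1 u' _ hu'; first by rewrite addnS -addSn.
exists w'; have [] := @sX_complete _ _ _ _ _ hx _ _ hy (S i) _ (u - (D j)^T *m emb w').
- by apply: mxdeg_sub => //; apply/mxdeg_embr/lDT_deg.
- rewrite mulmxBl Eu' E mulmxDr !mulmxA lD_mulT mul0mx add0r.
  by rewrite subrr.
by move=> w Ew; exists w; rewrite -Ew addrC subrK.
Qed.

Lemma row_fullP_row m n (A : 'M[k]_(m, n)) :
  (forall z : 'rV[k]_n, exists w, z = w *m A) -> row_full A.
Proof.
move=> h; rewrite -sub1mx; apply/row_subP => i.
by have [w ->] := h (row i 1%:M); apply: submxMl.
Qed.

(** The strand can be continued as soon as Tor of the module vanishes: push a
form of degree two down the double complex formed by the strand and by the
resolution of the residue field, and lift the result back. *)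
Lemma phi_surj_full n : phi_surj n.+1 C -> row_full (sA (S n.+1)).
Proof.
move=> hs; apply: row_fullP_row => z0.
pose z := gvc y (\matrix_(i < lb P 0) (z0 : 'rV_(r * sm (S n)))).
have hz : mxdeg 2 z by apply: (gvc_deg hy).
have [u hu Eu] := lD_deg2 hz.
have [|v [w E]] := @phi_surj_split n 1 u _ hu; first by rewrite addn1.
pose i0 := Ordinal (lb_gt0 P).
exists (row i0 (gcv hx ((D 0)^T *m emb w))).
have -> : z0 = row i0 (gcv hy z) by rewrite gvcK rowK.
rewrite -row_mul; congr row; rewrite /= -rmulmxE; last exact/mxdeg_embr/lDT_deg.
congr gcv; rewrite Eu E mulmxDr !mulmxA lD_mulT mul0mx add0r.
by [].
Qed.

Lemma phi_surj_full0 : phi_surj 0 C -> row_full C.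
Proof.
move=> hs; apply: row_fullP_row => z.
have [v Ev] := hs (\matrix_(i < lb P 0) z).
exists (row (Ordinal (lb_gt0 P)) (cv ((D 0)^T *m emb v))).
by rewrite -row_mul -/(phi C v) Ev rowK.
Qed.

End Strand.
End LinRes.

(** * Koszul modules have surjective differentials *)

Section Homogeneous.
Variables (k : fieldType) (R : comAlgType k) (gr : std_graded R).
Hypothesis hshort : short gr.

Definition grz (z : int) (a : R) : R :=
  match z with Posz d => gr d a | Negz _ => 0 end.

Lemma grz_in z a : in_degz gr z (grz z a).
Proof. by case: z => [d|] //=; apply: hcomp_in. Qed.

Lemma grz_id z a : in_degz gr z a -> grz z a = a.
Proof. by case: z => [d|] //= ->. Qed.

Lemma grz_sum z (I : Type) (s : seq I) (P : pred I) (F : I -> R) :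
  grz z (\sum_(i <- s | P i) F i) = \sum_(i <- s | P i) grz z (F i).
Proof. by case: z => [d|n] /=; [rewrite raddf_sum|rewrite big1]. Qed.

Lemma grz_mul d z a b : in_degz gr z b -> grz d (a * b) = grz (d - z) a * b.
Proof.
case: z => [n|n] hb; last first.
  have -> : b = 0 by exact: hb.
  by rewrite !mulr0; case: d => [d|] //=; rewrite raddf0.
case: d => [d|d] /=; last first.
  have -> : Negz d - Posz n = Negz (d + n) by lia.
  by rewrite /= mul0r.
rewrite (hcomp_mulr _ _ hb); case: leqP => h.
  by have -> : Posz d - Posz n = Posz (d - n) by lia.
have -> : Posz d - Posz n = Negz (n - d).-1 by lia.
by rewrite /= mul0r.
Qed.

Lemma in_degz_add z a b : in_degz gr z a -> in_degz gr z b -> in_degz gr z (a + b).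
Proof.
case: z => [d|d] /=; first exact: in_deg_add.
by move=> -> ->; rewrite addr0.
Qed.

Lemma in_degz0 z : in_degz gr z 0.
Proof. by case: z => [d|d] //=; apply: in_deg_zero. Qed.

Lemma in_degz_mul1 z a b :
  in_deg gr 1 a -> in_degz gr z b -> in_degz gr (z + 1) (a * b).
Proof.
move=> ha; case: z => [d|d] hb.
  have -> : Posz d + 1 = Posz (1 + d) by lia.
  exact: (in_deg_mul ha (hb : in_deg gr d b)).
by have -> : b = 0 by []; rewrite mulr0; apply: in_degz0.
Qed.

Lemma in_degz_aug z a : in_degz gr z a -> aug gr a != 0 -> z = 0.
Proof.
case: z => [[|d]|d] //= ha; first by rewrite (aug_deg ha) eqxx.
by rewrite ha aug0 eqxx.
Qed.

Lemma aug_mulmx m n p (A : 'M[R]_(m, n)) (B : 'M[R]_(n, p)) :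
  map_mx (aug gr) (A *m B) = map_mx (aug gr) A *m map_mx (aug gr) B.
Proof.
apply/matrixP => i j; rewrite !mxE aug_sum.
by apply: eq_bigr => l _; rewrite augM !mxE.
Qed.

Lemma aug_add m n (A B : 'M[R]_(m, n)) :
  map_mx (aug gr) (A + B) = map_mx (aug gr) A + map_mx (aug gr) B.
Proof. by apply/matrixP => i j; rewrite !mxE augD. Qed.

Lemma aug_opp m n (A : 'M[R]_(m, n)) :
  map_mx (aug gr) (- A) = - map_mx (aug gr) A.
Proof. by apply/matrixP => i j; rewrite !mxE augN. Qed.

Lemma aug_emb m n (A : 'M[k]_(m, n)) : map_mx (aug gr) (emb R A) = A.
Proof. by apply/matrixP => i j; rewrite !mxE /= aug_alg. Qed.

Lemma aug_mxdeg1 m n (A : 'M[R]_(m, n)) : mxdeg gr 1 A -> map_mx (aug gr) A = 0.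
Proof. by move=> h; apply/matrixP => i j; rewrite !mxE (aug_deg (h i j)). Qed.

Lemma mod_grz (M : lmodType R) (mg : graded_module gr M) j z (a : R) (m : M) :
  in_deg mg z m -> mg j (a *: m) = grz (j - z) a *: m.
Proof.
move=> hm.
have E d : mg j (gr d a *: m) = (if j == d%:Z + z then gr d a else 0) *: m.
  have h : in_deg mg (d%:Z + z) (gr d a *: m).
    by apply: mgr_scale => //; apply: hcomp_in.
  by rewrite -h hcomp_orth h; case: eqP; rewrite ?scale0r.
rewrite {1}(short_decomp hshort a) !scalerDl !raddfD !E -!scalerDl; congr (_ *: _).
rewrite -!subr_eq; case: (j - z) => [[|[|[|d]]]|d] /=; rewrite ?eqz_nat /= ?addr0 ?add0r //.
by rewrite (hshort _ (hcomp_in gr d.+3 a)).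
Qed.

(** For a graded free module with basis degrees [dg], the rows of [u] are
homogeneous of degree [d]. *)
Definition rowdeg n (dg : 'I_n -> int) d m (u : 'M[R]_(m, n)) :=
  forall i s, in_degz gr (d - dg s) (u i s).

Definition rowproj n (dg : 'I_n -> int) d m (u : 'M[R]_(m, n)) : 'M[R]_(m, n) :=
  \matrix_(i, s) grz (d - dg s) (u i s).

Lemma rowproj_deg n (dg : 'I_n -> int) d m (u : 'M[R]_(m, n)) :
  rowdeg dg d (rowproj dg d u).
Proof. by move=> i s; rewrite mxE; apply: grz_in. Qed.

Lemma rowproj_id n (dg : 'I_n -> int) d m (u : 'M[R]_(m, n)) :
  rowdeg dg d u -> rowproj dg d u = u.
Proof. by move=> h; apply/matrixP => i s; rewrite mxE grz_id. Qed.

Lemma rowproj_mul n (dg : 'I_n -> int) n' (dg' : 'I_n' -> int) d m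
    (u : 'M[R]_(m, n)) (B : 'M[R]_(n, n')) :
  (forall s t, in_degz gr (dg s - dg' t) (B s t)) ->
  rowproj dg' d (u *m B) = rowproj dg d u *m B.
Proof.
move=> hB; apply/matrixP => i t; rewrite !mxE grz_sum; apply: eq_bigr => s _.
rewrite (grz_mul _ _ (hB s t)) mxE; congr (grz _ _ * _).
by rewrite opprB addrA addrNK.
Qed.

Lemma rowdeg_mul1 n (dg : 'I_n -> int) d m m' (A : 'M[R]_(m', m)) (u : 'M[R]_(m, n)) :
  mxdeg gr 1 A -> rowdeg dg d u -> rowdeg dg (d + 1) (A *m u).
Proof.
move=> hA hu i s; rewrite mxE; apply: (big_ind (in_degz gr _)).
- exact: in_degz0.
- by move=> a b; apply: in_degz_add.
move=> l _; rewrite addrAC; exact: in_degz_mul1.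
Qed.

End Homogeneous.

Section Balance.
Variables (k : fieldType) (R : comAlgType k) (gr : std_graded R).
Hypothesis hshort : short gr.
Variable P : linres gr.
Variables (e : nat) (x : 'I_e -> R) (hx : kbasis (in_deg gr 1%N) x).
Variables (p q : nat) (C : 'M[k]_(e * p, q)).

Local Notation emb := (@emb k R _ _).
Local Notation D := (lD P).
Local Notation RC := (table_mod hx C).

Section Resolution.
Variable F : free_resolution (table_graded hx C).
Local Notation dg i := (@fdeg _ _ _ _ _ F i).
Local Notation dF := (fdiff F).

Lemma tens_boundaries_sub i j : (tens_boundaries F i j <= tens_cycles F i j)%MS.
Proof.
have h l : tens_deg F l.+1 j *m tens_diff F l = tens_diff F l *m tens_deg F l j.
  apply/matrixP => s t; rewrite mul_diag_mx mul_mx_diag !mxE.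
  case: (eqVneq (aug gr (dF l s t)) 0) => [->|ne]; first by rewrite mulr0 mul0r.
  have /eqP := in_degz_aug (@fdiff_deg _ _ _ _ _ F l s t) ne.
  by rewrite subr_eq0 => /eqP ->; rewrite mulrC.
rewrite /tens_boundaries h; case: i => [|i] /=; first exact: submxMl.
rewrite sub_capmx submxMl /=; apply/sub_kermxP; rewrite -h -mulmxA -aug_mulmx.
have -> : dF i.+1 *m dF i = 0.
  apply/row_matrixP => s; rewrite row_mul row0.
  by apply/fdiff_exact; exists (delta_mx 0 s); rewrite rowE.
by rewrite (_ : map_mx _ 0 = 0) ?mulmx0 //; apply/matrixP => s t; rewrite !mxE aug0.
Qed.

Lemma tor0_boundary i j t (u : 'M[k]_(t, fr F i)) : tor_rank F i j = 0%N ->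
  (u <= tens_cycles F i j)%MS -> exists c, u = c *m tens_diff F i.
Proof.
move=> h0 hu; have hs := tens_boundaries_sub i j.
have : (tens_cycles F i j <= tens_boundaries F i j)%MS.
  rewrite -(geq_leqif (mxrank_leqif_sup hs)).
  by move/eqP: h0; rewrite /tor_rank subn_eq0.
move/(submx_trans hu) => /submxP[c Ec]; exists (c *m tens_deg F i.+1 j).
by rewrite -mulmxA.
Qed.

Lemma faug_comb (u : 'rV[R]_(fr F 0)) : (forall s, in_degz gr (1 - dg 0 s) (u 0 s)) ->
  in_deg (table_graded hx C) 1 (\sum_s u 0 s *: @faug _ _ _ _ _ F s).
Proof.
move=> hu; rewrite /in_deg raddf_sum; apply: eq_bigr => s _ /=.
rewrite (mod_grz hshort 1 (u 0 s) (@faug_deg _ _ _ _ _ F s)).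
by rewrite grz_id.
Qed.

Lemma deg1_kills (a : R) (w : RC) :
  in_deg gr 1 a -> in_deg (table_graded hx C) 1 w -> a *: w = 0.
Proof.
case: w => w0 w1 ha; rewrite /in_deg /= /table_hcomp /= => -[Ew0].
by rewrite -Ew0; apply: table_modE0.
Qed.

(** The zigzag in the double complex [F ** P]: along it the degree of the rows
goes up with the homological degree in [F], so that at its end only the part
of [F_i ** k] of degree [i + 1] matters, which has no homology. *)
Lemma zigzag j l (u : 'M[R]_(lb P j, fr F l)) :
  tor_rank F (l + j) (l + j).+1%:Z = 0%N ->
  rowdeg gr (dg l) l.+1%:Z u ->
  (match l return 'M[R]_(lb P j, fr F l) -> Prop with
   | 0%N => fun _ => True
   | l'.+1 => fun u => exists t, u *m dF l' = (D j)^T *m t end) u ->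
  exists c v, u = c *m dF l + (D j)^T *m v.
Proof.
elim: j l u => [|j IH] l u htor hu hc.
  rewrite addn0 in htor.
  have hcyc : (map_mx (aug gr) u <= tens_cycles F l l.+1%:Z)%MS.
    have hd : (map_mx (aug gr) u <= tens_deg F l l.+1%:Z)%MS.
      suff -> : map_mx (aug gr) u = map_mx (aug gr) u *m tens_deg F l l.+1%:Z.
        exact: submxMl.
      apply/matrixP => i s; rewrite mul_mx_diag !mxE.
      case: (eqVneq (aug gr (u i s)) 0) => [->|ne]; first by rewrite mul0r.
      have /eqP := in_degz_aug (hu i s) ne.
      by rewrite subr_eq0 => /eqP <-; rewrite eqxx mulr1.
    case: l u hu hc hd {htor} => [|l] u hu hc hd //=.
    rewrite sub_capmx hd; apply/sub_kermxP; rewrite -aug_mulmx.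
    case: hc => t ->; rewrite aug_mulmx (aug_mxdeg1 (@lDT_deg _ _ _ P 0)).
    by rewrite mul0mx.
  have [c Ec] := tor0_boundary htor hcyc.
  have [|v Ev] := @lD_augT _ _ _ P _ (u - emb c *m dF l).
    by rewrite aug_add aug_opp aug_mulmx aug_emb Ec subrr.
  by exists (emb c), v; rewrite -Ev addrC subrK.
have [u' Eu' hu'] : exists2 u', (D j)^T *m u = u' *m dF l &
    rowdeg gr (dg l.+1) l.+2%:Z u'.
  have hDu : rowdeg gr (dg l) l.+2%:Z ((D j)^T *m u).
    have -> : l.+2%:Z = l.+1%:Z + 1 by lia.
    by apply: rowdeg_mul1 => //; apply: lDT_deg.
  suff [w Ew] : exists w, (D j)^T *m u = w *m dF l.
    exists (rowproj gr (dg l.+1) l.+2%:Z w); last exact: rowproj_deg.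
    rewrite -(rowproj_mul (dg' := dg l)); last exact: fdiff_deg.
    by rewrite -Ew rowproj_id.
  apply: mul_rowwise => i.
  case: l u {IH htor} hu hc hDu => [|l] u hu hc hDu.
    apply/faug_exact.
    under eq_bigr => s _ do rewrite !mxE scaler_suml.
    rewrite exchange_big /= big1 // => s' _.
    under eq_bigr => s _ do rewrite -scalerA.
    rewrite -scaler_sumr; apply: deg1_kills; first exact: lDT_deg.
    have := @faug_comb (row s' u); rewrite /=.
    under eq_bigr => s _ do rewrite mxE.
    apply => s; rewrite mxE; exact: hu.
  apply/fdiff_exact; rewrite -row_mul; case: hc => t Et.
  by rewrite -mulmxA Et mulmxA lD_mulT mul0mx row0.
have [| |c [v E]] := IH l.+1 u' _ hu'.
- by rewrite addSnnS.
- by exists u; rewrite -Eu'.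
have [|v' Ev'] := @lD_exactT _ _ _ P j _ (u - v *m dF l).
  have F0 : dF l.+1 *m dF l = 0.
    apply/row_matrixP => s; rewrite row_mul row0.
    by apply/fdiff_exact; exists (delta_mx 0 s); rewrite rowE.
  rewrite mulmxBr Eu' E mulmxDl -mulmxA F0 mulmx0 add0r.
  by rewrite -mulmxA subrr.
by exists v, v'; rewrite -Ev' addrC subrK.
Qed.

End Resolution.

(** An element of degree one in [M ** P_i] lifts to [F_0 ** P_i], and [zigzag] splits
the lift into a part that dies in [M] and a part that comes from [P_(i+1)]. *)
Lemma koszul_phi_surj : linear_locus hx C -> forall i, phi_surj P hx i C.
Proof.
case=> _ hK i m.
have [|F hF] := hK i i.+1%:Z; first by lia.
pose w s : RC := (0, row s m).
have [u0 Eu0] : exists u : 'M[R]_(lb P i, fr F 0), forall s,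
    w s = \sum_t u s t *: @faug _ _ _ _ _ F t.
  have /fin_all_exists[f Ef] := fun s => faug_surj F (w s).
  exists (\matrix_(s, t) f s 0 t) => s; rewrite {1}Ef.
  by apply: eq_bigr => t _; rewrite mxE.
pose u := rowproj gr (@fdeg _ _ _ _ _ F 0%N) 1 u0.
have hu : rowdeg gr (@fdeg _ _ _ _ _ F 0%N) 1 u by exact: rowproj_deg.
have Eu s : w s = \sum_t u s t *: @faug _ _ _ _ _ F t.
  have hw : in_deg (table_graded hx C) 1 (w s).
    by rewrite /in_deg /= /table_hcomp.
  rewrite -hw Eu0 raddf_sum; apply: eq_bigr => t _.
  by rewrite (mod_grz hshort 1 _ (@faug_deg _ _ _ _ _ F t)) mxE.
have [c [v E]] := @zigzag F i 0%N u hF hu I.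
pose n s' : RC := \sum_t v s' t *: @faug _ _ _ _ _ F t.
exists (\matrix_(s' < lb P i.+1) (n s').1).
set v0 := \matrix_s' _.
apply/row_matrixP => s.
have Es : w s = \sum_s' (D i)^T s s' *: n s'.
  rewrite Eu E.
  under eq_bigr => t _ do rewrite mxE scalerDl.
  rewrite big_split /=.
  have -> : \sum_t (c *m fdiff F 0) s t *: @faug _ _ _ _ _ F t = 0.
    have := @faug_exact _ _ _ _ _ F (row s (c *m fdiff F 0)).
    under eq_bigr => t _ do rewrite mxE.
    by move=> ->; exists (row s c); rewrite row_mul.
  rewrite add0r /n.
  under eq_bigr => t _ do rewrite mxE scaler_suml.
  rewrite exchange_big; apply: eq_bigr => s' _; rewrite scaler_sumr.
  by apply: eq_bigr => t _; rewrite scalerA.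
have := table_gen_sum hx C (row s ((D i)^T *m emb v0)).
under eq_bigr => t _ do rewrite !mxE scaler_suml.
rewrite exchange_big /=.
have En s' : n s' = \sum_t (emb v0 s' t) *: table_gen hx C t + ((0, (n s').2) : RC).
  have := table_gen_sum hx C (row s' (emb v0)).
  under eq_bigr => t _ do rewrite mxE.
  move=> ->; rewrite [LHS](surjective_pairing (n s')).
  congr pair; rewrite /= ?addr0.
    by rewrite map_row aug_emb rowK.
  rewrite (gcv_other hx (d' := 0%N)) ?mul0mx ?add0r //.
  by move=> a b; rewrite mxE; apply: mxdeg_emb.
have -> : \sum_j \sum_i0 ((D i)^T s j * emb v0 j i0) *: table_gen hx C i0 = w s.
  rewrite Es; apply: eq_bigr => s' _; rewrite [in RHS]En scalerDr.
  rewrite table_modE0 ?addr0; last exact: lDT_deg.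
  by rewrite scaler_sumr; apply: eq_bigr => t _; rewrite scalerA.
move/(congr1 (fun z : RC => z.2)) => /= E2.
rewrite [RHS]E2 [LHS]row_mul; congr mulmx.
by apply: mx_indexP => a l b; rewrite [LHS]mxE !gcvE [in RHS]mxE.
Qed.

End Balance.

(** * Zariski closed sets of matrices *)

Section Zariski.
Variable k : fieldType.

Lemma zariski_closed_iff m n (Z Z' : 'M[k]_(m, n) -> Prop) :
  (forall C, Z C <-> Z' C) -> zariski_closed Z -> zariski_closed Z'.
Proof.
by move=> h [S hS]; exists S => C; rewrite -hS; split=> /h.
Qed.

Lemma zariski_closed_or m n (Z Z' : 'M[k]_(m, n) -> Prop) :
  zariski_closed Z -> zariski_closed Z' -> zariski_closed (fun C => Z C \/ Z' C).
Proof.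
move=> [S hS] [S' hS'].
exists (fun f => exists g g', [/\ S g, S' g' & f = g * g']) => C; split.
  move=> hC f [g [g' [hg hg' ->]]]; rewrite mevalM.
  by case: hC => [/hS/(_ g hg)|/hS'/(_ g' hg')] ->; rewrite ?mul0r ?mulr0.
move=> h; case: (classic (Z C)) => hZ; [by left|right].
apply/hS' => g' hg'; case: (classic (g'.@[mxvec C 0] = 0)) => // ne.
case: hZ; apply/hS => g hg; have /eqP := h _ (ex_intro _ g (ex_intro _ g' (And3 hg hg' erefl))).
by rewrite mevalM mulf_eq0 => /orP[/eqP|/eqP].
Qed.

Lemma zariski_closed_empty m n : zariski_closed (fun _ : 'M[k]_(m, n) => False).
Proof.
exists (fun f => f = 1) => C; split=> // /(_ 1 erefl)/eqP.
by rewrite meval1 oner_eq0.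
Qed.

Lemma zariski_closed_bounded m n (Z : nat -> 'M[k]_(m, n) -> Prop) N :
  (forall i, zariski_closed (Z i)) ->
  zariski_closed (fun C => exists2 i, (i < N)%N & Z i C).
Proof.
move=> h; elim: N => [|N IH].
  by apply: zariski_closed_iff (zariski_closed_empty m n) => C; split=> // -[].
apply: zariski_closed_iff (zariski_closed_or IH (h N)) => C; split.
  by case=> [[i hi hZ]|hZ]; [exists i => //; apply: ltnW|exists N].
move=> [i]; rewrite ltnS leq_eqVlt => /orP[/eqP ->|hi] hZ; [by right|left].
by exists i.
Qed.

Lemma row_full_minor m n (A : 'M[k]_(m, n)) :
  row_full A <-> exists f : {ffun 'I_n -> 'I_m}, \det (rowsub f A) != 0.
Proof.
split=> [fA|[f hf]].
  exists (fullrankfun fA); rewrite -unitfE -/(rowsub _ _ \in unitmx).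
  by apply: fullrowsub_unit.
have uf : rowsub f A \in unitmx by rewrite unitmxE unitfE.
rewrite -sub1mx -(mulVmx uf); apply: submx_trans (submxMl _ _) _.
exact: rowsub_sub.
Qed.

(** The equations are the maximal minors. *)
Lemma zariski_closed_rank m n a b (A : 'M[{mpoly k[m * n]}]_(a, b)) :
  zariski_closed (fun C : 'M[k]_(m, n) =>
    ~ row_full (map_mx (meval (mxvec C 0)) A)).
Proof.
exists (fun f => exists g : {ffun 'I_b -> 'I_a}, f = \det (rowsub g A)) => C.
have E (g : {ffun 'I_b -> 'I_a}) :
    (\det (rowsub g A)).@[mxvec C 0] =
    \det (rowsub g (map_mx (meval (mxvec C 0)) A)).
  rewrite -det_map_mx; congr (\det _); by apply/matrixP => i j; rewrite !mxE.
split=> [h f [g ->]|h /row_full_minor[g]].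
  rewrite E; apply/eqP/negPn/negP => hd; apply: h.
  by apply/row_full_minor; exists g.
by rewrite -E (h _ (ex_intro _ g erefl)) eqxx.
Qed.

(** Over a finite field points are isolated: the polynomials below vanish at
all points but one. *)
Lemma zariski_closed_finite m n (Z : 'M[k]_(m, n) -> Prop) :
  ~ infinite_field k -> zariski_closed Z.
Proof.
move=> /not_all_ex_not[s /not_ex_all_not hs].
have {}hs c : c \in s by apply/negPn/negP => h; exact: (hs c h).
pose f C : {mpoly k[m * n]} :=
  \prod_i \prod_(c <- s | c != mxvec C 0 i) ('X_i - c%:MP).
exists (fun g => exists2 C, ~ Z C & g = f C) => C.
have E C' : (f C').@[mxvec C 0] =
    \prod_i \prod_(c <- s | c != mxvec C' 0 i) (mxvec C 0 i - c).
  rewrite rmorph_prod; apply: eq_bigr => i _; rewrite rmorph_prod.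
  by apply: eq_bigr => c _; rewrite /= mevalB mevalXU mevalC.
split=> [hC g [C' hC' ->]|h].
  have [i hi] : exists i, mxvec C 0 i != mxvec C' 0 i.
    apply/existsP; rewrite -negb_forall; apply/negP => /forallP hall.
    apply: hC'; suff <- : C = C' by [].
    by apply: (can_inj mxvecK); apply/rowP => i; apply/eqP.
  apply/eqP; rewrite E (bigD1 i) //= mulf_eq0; apply/orP; left.
  apply/eqP; rewrite big_mkcond; apply/eqP; rewrite prodf_seq_eq0.
  by apply/hasP; exists (mxvec C 0 i); rewrite ?hs //= hi subrr.
case: (classic (Z C)) => // hZ; have /eqP := h _ (ex_intro2 _ _ C hZ erefl).
rewrite E prodf_seq_eq0 => /hasP[i _ /=].
rewrite prodf_seq_eq0 => /hasP[c _ /andP[ne]].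
by rewrite subr_eq0 eq_sym (negbTE ne).
Qed.

End Zariski.

Section OpenLocus.
Variables (k : fieldType) (R : comAlgType k) (gr : std_graded R).
Variable P : linres gr.
Variables (e : nat) (x : 'I_e -> R) (hx : kbasis (in_deg gr 1%N) x).

(** The matrix of [phi]; over a general ring, so that the entries of [C] can be
indeterminates. *)
Definition phimx (A : comNzRingType) b b' p q (Dl : 'I_e -> 'M[A]_(b', b))
    (C : 'M[A]_(e * p, q)) : 'M[A]_(b' * p, b * q) :=
  \sum_l lin_mulmx (Dl l)^T *m
    lin_mulmxr (\matrix_(n, h) C (mxvec_index l n) h : 'M_(p, q)).

Lemma map_phimx (A B : comNzRingType) (f : {rmorphism A -> B}) b b' p q
    (Dl : 'I_e -> 'M[A]_(b', b)) (C : 'M[A]_(e * p, q)) :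
  map_mx f (phimx Dl C) = phimx (fun l => map_mx f (Dl l)) (map_mx f C).
Proof.
rewrite /phimx map_mx_sum; apply: eq_bigr => l _; rewrite map_mxM.
congr (_ *m _); rewrite /lin_mulmx /lin_mulmxr.
  by apply: map_lin_mx => M; rewrite map_mxM -map_trmx.
apply: map_lin_mx => M; rewrite /= map_mxM; congr (_ *m _).
by apply/matrixP => i j; rewrite !mxE.
Qed.

Lemma phi_surj_row_full p q i (C : 'M[k]_(e * p, q)) :
  phi_surj P hx i C <->
  row_full (phimx (fun l => map_mx (fun a => coord1 hx a 0 l) (lD P i)) C).
Proof.
set Dl := fun l => _; have E v : mxvec (phi hx C v) = mxvec v *m phimx Dl C.
  rewrite /phi mul_coordE mulmx_sumr linear_sum; apply: eq_bigr => l _ /=.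
  rewrite mulmxA !mul_vec_lin /= /table_slice; congr (mxvec (_ *m _)).
  apply/matrixP => a b; rewrite !mxE coord1_sum summxE; apply: eq_bigr => j _.
  by rewrite !mxE /= mulr_algr coord1Z mxE mulrC.
split=> h.
  apply: row_fullP_row => z; have [v Ev] := h (vec_mx z).
  by exists (mxvec v); rewrite -E Ev vec_mxK.
move=> m; have /submxP[w Ew] := submx_full (mxvec m) h.
by exists (vec_mx w); apply: (can_inj mxvecK); rewrite E vec_mxK.
Qed.

Lemma phi_surj_open p q i :
  zariski_closed (fun C : 'M[k]_(e * p, q) => ~ phi_surj P hx i C).
Proof.
pose X : 'M[{mpoly k[e * p * q]}]_(e * p, q) :=
  \matrix_(a, b) 'X_(mxvec_index a b).
pose Dl l := map_mx (fun a => coord1 hx a 0 l) (lD P i).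
pose A := phimx (fun l => map_mx (@mpolyC _ k) (Dl l)) X.
apply: zariski_closed_iff (zariski_closed_rank A) => C.
suff -> : map_mx (meval (mxvec C 0)) A = phimx Dl C.
  by split=> h /phi_surj_row_full.
rewrite map_phimx; have -> : map_mx (meval (mxvec C 0)) X = C.
  by apply/matrixP => a b; rewrite !mxE mevalXU mxvecE.
rewrite /phimx; apply: eq_bigr => l _; congr (lin_mulmx _^T *m _).
by apply/matrixP => a b; rewrite !mxE /=; apply: mevalC.
Qed.

(** Each surjectivity is an open condition by [phi_surj_open], and finitely many of
them define an open set. *)
Lemma linear_locus_open p q N :
  (forall C : 'M[k]_(e * p, q), linear_locus hx C ->
     forall i, phi_surj P hx i C) ->
  (forall C : 'M[k]_(e * p, q), (forall i, (i < N)%N -> phi_surj P hx i C) ->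
     linear_locus hx C) ->
  zariski_open (@linear_locus k R gr e x hx p q).
Proof.
move=> h1 h2.
apply: zariski_closed_iff (zariski_closed_bounded N (@phi_surj_open p q)) => C.
split=> [[i _ hi] /h1|hC]; first by move/(_ i).
case: (classic (exists2 i, (i < N)%N & ~ phi_surj P hx i C)) => // hn.
case: hC; apply: h2 => i hi; case: (classic (phi_surj P hx i C)) => // hp.
by case: hn; exists i.
Qed.

End OpenLocus.

(** * From one cyclic module to all ranks *)

Section Blocks.
Variables (k : fieldType) (R : comAlgType k) (gr : std_graded R).
Hypothesis hshort : short gr.
Variable P : linres gr.
Variables (e : nat) (x : 'I_e -> R) (hx : kbasis (in_deg gr 1%N) x).
Variables (r : nat) (y : 'I_r -> R) (hy : kbasis (in_deg gr 2%N) y).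
Local Notation cv := (gcv hx).

Lemma koszul_of_phi_surj p q (C : 'M[k]_(e * p, q)) : (0 < p)%N ->
  (forall i, phi_surj P hx i C) -> linear_locus hx C.
Proof.
move=> p0 hs; apply: (strand_koszul hshort hx (hy := hy)) => // -[|i].
  exact: phi_surj_full0 (hs 0%N).
exact: (phi_surj_full hshort hy (hs i.+1)).
Qed.

(** The multiplication table of the direct sum of [p] copies of the cyclic
module whose table is [N]. *)
Definition block_table f (N : 'M[k]_(e, f)) p : 'M[k]_(e * p, f * p) :=
  lin_mulmx N^T.

Lemma block_tableE t f (N : 'M[k]_(e, f)) p (u : 'M[R]_(t, p)) i h n :
  (cv u *m block_table N p) i (mxvec_index h n) =
  \sum_l N l h * coord1 hx (u i n) 0 l.
Proof.
pose U := \matrix_(l < e, j < p) coord1 hx (u i j) 0 l.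
transitivity ((row i (cv u) *m block_table N p) 0 (mxvec_index h n)).
  by rewrite -row_mul [RHS]mxE.
have -> : row i (cv u) = mxvec U.
  by apply: mx_indexP => i' l j; rewrite ord1 mxE gcvE mxvecE mxE gcoord1.
rewrite mul_vec_lin /= mxvecE mxE; apply: eq_bigr => l _.
by rewrite !mxE.
Qed.

Lemma block_table_full f (N : 'M[k]_(e, f)) p :
  row_full N -> row_full (block_table N p).
Proof.
move=> /row_fullP[B BN]; apply: row_fullP_row => z.
exists (mxvec (B^T *m vec_mx z)).
by rewrite mul_vec_lin /= mulmxA -trmx_mul BN trmx1 mul1mx vec_mxK.
Qed.

(** [phi] of the block table is computed copy by copy, and it remains surjective when
part of its target is factored out. *)
Lemma block_phi_surj f (N : 'M[k]_(e, f)) p q : (q <= f * p)%N ->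
  linear_locus hx (block_table N 1) ->
  forall i, phi_surj P hx i (block_table N p *m pid_mx q : 'M_(e * p, q)).
Proof.
move=> hq hN i m.
pose m' : 'M[k]_(lb P i, f * p) := m *m pid_mx q.
have hs := koszul_phi_surj hshort (P := P) hN (i := i).
pose mn n : 'M[k]_(lb P i, f * 1) :=
  \matrix_a mxvec (\matrix_(h < f, j < 1) m' a (mxvec_index h n)).
have /fin_all_exists[v Ev] := fun n => hs (mn n).
pose v0 := \matrix_(a, n) v n a 0.
have E0 : phi hx (block_table N p) v0 = m'.
  apply: mx_indexP => a h n; rewrite block_tableE.
  have := congr1 (fun M : 'M_(lb P i, f * 1) => M a (mxvec_index h 0)) (Ev n).
  rewrite block_tableE [mn n a _]mxE mxvecE [X in _ = X]mxE => <-.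
  apply: eq_bigr => l _; congr (_ * coord1 hx _ 0 l).
  by rewrite !mxE; apply: eq_bigr => j _; rewrite !mxE.
exists v0; rewrite /phi mulmxA -/(phi hx (block_table N p) v0) E0.
rewrite -mulmxA pid_mx_id //.
by rewrite pid_mx_1 mulmx1.
Qed.

Lemma linear_locus_nonempty f (N : 'M[k]_(e, f)) p q :
  (0 < p)%N -> (q <= f * p)%N -> linear_locus hx (block_table N 1) ->
  exists C : 'M[k]_(e * p, q), linear_locus hx C.
Proof.
move=> p0 hq hN; exists (block_table N p *m pid_mx q).
by apply: koszul_of_phi_surj => // i; apply: block_phi_surj.
Qed.

End Blocks.

(** * Algebras with a perfect pairing on forms of degree one *)

Section Pairing.
Variables (k : fieldType) (R : comAlgType k) (gr : std_graded R).
Hypothesis hshort : short gr.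
Variables (e : nat) (x : 'I_e -> R) (hx : kbasis (in_deg gr 1%N) x).
Variables (y : 'I_1 -> R) (hy : kbasis (in_deg gr 2%N) y).
Hypothesis nondeg : forall a, in_deg gr 1 a ->
  (forall b, in_deg gr 1 b -> a * b = 0) -> a = 0.
Hypothesis e_ge2 : (2 <= e)%N.

Local Notation emb := (@emb k R _ _).
Local Notation mxdeg := (mxdeg gr).
Local Notation strand := (strand x hy).
Local Notation sX := (sX x hy).
Local Notation rmulmx := (rmulmx x hy).

Lemma kermx_factor m n p (A : 'M[k]_(m, n)) (B : 'M[k]_(m, p)) :
  kermx A *m B = 0 -> exists c, B = A *m c.
Proof.
move=> h; have : (B^T <= A^T)%MS.
  rewrite submxE -trmx_eq0 trmx_mul trmxK; set K := cokermx _.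
  have /submxP[d Ed] : (K^T <= kermx A)%MS.
    by apply/sub_kermxP/trmx_inj; rewrite trmx_mul trmxK trmx0 mulmx_coker.
  by rewrite Ed -mulmxA h mulmx0.
by move=> /submxP[c Ec]; exists c^T; apply: trmx_inj; rewrite trmx_mul trmxK.
Qed.

Lemma rmulmx_eq0_pairing m n (X : 'M[R]_(m, n)) :
  mxdeg 1 X -> rmulmx X = 0 -> X = 0.
Proof.
move=> hX h0; apply/matrixP => i j; rewrite mxE; apply: nondeg => // b hb.
have hv : mxdeg 1 (\row_a (if a == i then b else 0) : 'rV[R]_m).
  by move=> s t; rewrite mxE; case: ifP => // _; apply: in_deg_zero.
have := rmulmx_eq0 (hx := hx) (hy := hy) hv hX; rewrite h0 mulmx0 => /(_ erefl).
move=> /matrixP/(_ 0 j); rewrite !mxE (bigD1 i) //= mxE eqxx mulrC => E.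
rewrite -[RHS]E big1 ?addr0 // => a ha.
by rewrite mxE (negbTE ha) mul0r.
Qed.

Lemma rmulmx_embr m n p (X : 'M[R]_(m, n)) (c : 'M[k]_(1 * n, 1 * p)) :
  mxdeg 1 X ->
  rmulmx (X *m emb (\matrix_(i, j) c (mxvec_index 0 i) (mxvec_index 0 j))) =
  rmulmx X *m c.
Proof.
move=> hX; apply: mx_indexP => i l j; rewrite ord1 /(rmulmx _) mulmxA gcvE !mxE.
rewrite sum_mxvec_index big_ord1 gcoord_sum summxE; apply: eq_bigr => a _.
by rewrite gcvE !mxE /= mulr_algr gcoordZ mxE mulrC.
Qed.

(** Duality turns left kernels into column spaces: since the rows of the next
differential span the kernel of [sX s], the columns they kill are spanned by
the columns of [sX s]. *)
Lemma sX_perp s t (z : 'M[R]_(sm (snext x hy s), t)) :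
  mxdeg 1 z -> sX (snext x hy s) *m z = 0 ->
  exists c : 'M[k]_(sm s, t), z = sX s *m emb c.
Proof.
move=> hz h0.
have hX := @sX_deg _ _ _ _ _ hx _ _ hy s.
have [|c Ec] := @kermx_factor _ _ _ (rmulmx (sX s)) (rmulmx z).
  apply/eqP; rewrite -submx0; apply/row_subP => i; rewrite row_mul submx0.
  set w := row i _; have hw : mxdeg 1 (gvc x w) by apply: (gvc_deg hx).
  have [|d Ed] := @sX_complete _ _ _ _ _ hx _ _ hy s _ (gvc x w) hw.
    apply: (rmulmx_eq0 (hx := hx) (hy := hy)) => //; rewrite gvcK /w -row_mul.
    by rewrite mulmx_ker row0.
  have : gvc x w *m z = 0 by rewrite Ed -mulmxA h0 mulmx0.
  move=> /(congr1 (fun Z => gcv hy Z)); rewrite (rmulmxE hx) // gvcK gcv0.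
  by move=> ->.
exists (\matrix_(i, j) c (mxvec_index 0 i) (mxvec_index 0 j)).
apply/eqP; rewrite -subr_eq0; apply/eqP; apply: rmulmx_eq0_pairing.
  by apply: mxdeg_sub => //; apply: mxdeg_embr.
by rewrite {1}/(rmulmx _) mulmxBr gcvD gcvN -!/(rmulmx _) rmulmx_embr // Ec subrr.
Qed.

Lemma row_full_col m n (A : 'M[k]_(m, n)) :
  (forall a : 'cV[k]_n, A *m a = 0 -> a = 0) -> row_full A.
Proof.
move=> h; have K0 : cokermx A = 0.
  apply/matrixP => i j; have := h (col j (cokermx A)).
  rewrite colE mulmxA mulmx_coker mul0mx => /(_ erefl); rewrite -colE.
  by move=> /colP/(_ i); rewrite !mxE.
rewrite /row_full eqn_leq rank_leq_col /=; have := mxrank_coker A.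
by rewrite K0 mxrank0 => /eqP; rewrite eq_sym subn_eq0.
Qed.

Lemma strand_kill s : ~~ row_full (sA (snext x hy s)) ->
  exists2 a : 'cV[k]_(sm s), a != 0 & sX s *m emb a = 0.
Proof.
move=> hn; have [a ha a0] : exists2 a : 'M[k]_(1 * sm s, 1 * 1), rmulmx (sX s) *m a = 0 & a != 0.
  apply: NNPP => hna; case/negP: hn; apply: row_full_col => a ha.
  by apply/eqP/negPn/negP => a0; apply: hna; exists a.
exists (\matrix_(i, j) a (mxvec_index 0 i) (mxvec_index 0 j)).
  apply: contraNneq a0 => a0; apply/eqP; apply: mx_indexP => i l j.
  case/mxvec_indexP: i => l' i; rewrite (ord1 l) (ord1 l').
  by have /matrixP/(_ i j) := a0; rewrite !mxE.
apply: rmulmx_eq0_pairing; first by apply/mxdeg_embr/(@sX_deg _ _ _ _ _ hx).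
by rewrite rmulmx_embr //; apply: (@sX_deg _ _ _ _ _ hx).
Qed.

Local Notation Sk := (strand (LState (0 : 'M[k]_(e * 1, 0)))).

(** A failure of the strand of [M] to be exact propagates backwards to an
injection of the terms of the dual of the strand of the residue field. *)
Lemma strand_dual_inj p q (C : 'M[k]_(e * p, q)) i j
    (c : 'M[k]_(sm (strand (LState C) i), sm (Sk j))) :
  row_full c -> sX (strand (LState C) i) *m emb c *m (sX (Sk j))^T = 0 ->
  exists c' : 'M[k]_(p, sm (Sk (i + j))), row_full c'.
Proof.
elim: i j c => [|i IH] j c hc h0; first by exists c.
have hd : mxdeg 1 (emb c *m (sX (Sk j))^T).
  by apply/mxdeg_embl/mxdeg_tr/(@sX_deg _ _ _ _ _ hx).
have [|c' Ec'] := @sX_perp _ _ (emb c *m (sX (Sk j))^T) hd.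
  by rewrite -[RHS]h0 -mulmxA.
rewrite addSnnS; apply: (IH j.+1 c').
  apply: row_full_col => a ha.
  have : emb c *m ((sX (Sk j))^T *m emb a) = 0.
    by rewrite mulmxA Ec' -mulmxA -embM ha emb0 mulmx0.
  case/row_fullP: hc => B Bc /(congr1 (mulmx (emb B))).
  rewrite mulmxA -embM Bc emb1 mul1mx mulmx0 => /(congr1 trmx).
  rewrite trmx_mul trmxK trmx0 emb_tr => /(sX_free hx) a0.
  by rewrite -(trmxK a) a0 trmx0.
rewrite -Ec' -mulmxA -trmx_mul.
have := sX_mul hx hy (Sk j); rewrite -[strand _ j.+1]/(snext x hy (Sk j)) => ->.
by rewrite trmx0 mulmx0.
Qed.

(** The chain of injections ends at [M_0], the term of the strand of rank [p]. *)
Lemma strand_bound p q (C : 'M[k]_(e * p, q)) n :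
  ~~ row_full (sA (strand (LState C) n.+1)) -> (sm (Sk n) <= p)%N.
Proof.
case/strand_kill => a a0 ha.
have [||c] := @strand_dual_inj p q C n 0 a.
- apply: row_full_col => b /matrixP h; apply/colP => i; rewrite ord1 mxE.
  have [w hw] : exists w, a w 0 != 0.
    apply/existsP; rewrite -negb_forall; apply: contraNN a0 => /forallP hall.
    by apply/eqP/colP => w; rewrite mxE; apply/eqP.
  have := h w 0; rewrite !mxE big_ord1 => /eqP; rewrite mulf_eq0 (negbTE hw).
  by move/eqP.
- by rewrite ha mul0mx.
move=> /eqP hr; have := rank_leq_row c; rewrite hr.
by rewrite addn0.
Qed.

(** Each rank in the strand of [k] is at least [e] times the preceding one minus the
one before, and [e] is at least two. *)
Lemma Sk_growth n : (n < sm (Sk n))%N /\ (sm (Sk n) < sm (Sk n.+1))%N.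
Proof.
have E0 : sm (Sk 0) = 1%N by [].
have ES j : sm (Sk j.+1) = (e * sm (Sk j) - \rank (sA (Sk j)))%N.
  exact: sm_snext.
elim: n => [|n [h1 h2]].
  have hr : \rank (sA (Sk 0)) = 0%N by apply/eqP; rewrite -leqn0; apply: rank_leq_col.
  have := ES 0%N; rewrite hr subn0 => H; have := etrans H (muln1 e).
  by move=> ->.
split; first by lia.
have hr : (\rank (sA (Sk n.+1)) <= sm (Sk n))%N.
  by apply: leq_trans (rank_leq_col _) _; rewrite /= mul1n.
by have := ES n.+1; nia.
Qed.

Lemma strand_full_gt p q (C : 'M[k]_(e * p, q)) n :
  (p <= n)%N -> row_full (sA (strand (LState C) n.+1)).
Proof.
move=> hp; apply: contraT => /strand_bound h.
by have [] := Sk_growth n; lia.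
Qed.

(** [strand_full_gt] leaves the first two steps; at the second one a failure would
make the first differential vanish. *)
Lemma strand_full1 q (C : 'M[k]_(e * 1, q)) : row_full C ->
  (q < e)%N -> forall i, row_full (sA (strand (LState C) i)).
Proof.
move=> hC hq [|[|i]] //; last exact: strand_full_gt.
apply: contraT => /strand_kill[a a0 ha].
have X0 : sX (LState C) = 0.
  apply/matrixP => i j; move: a0; rewrite !ord1 => a0.
  have h : a 0 0 != 0.
    by apply: contraNneq a0 => a0; apply/eqP/colP => w; rewrite ord1 a0 mxE.
  have /matrixP/(_ i 0) := ha; rewrite !mxE big_ord1 !mxE /= mulr_algr.
  by move/eqP; rewrite scaler_eq0 (negbTE h) => /eqP.
have := sX_free hx (hy := hy) (s := LState C) (c := 1%:M).
rewrite X0 mulmx0 => /(_ erefl)/(congr1 mxrank); rewrite mxrank1 mxrank0.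
rewrite sm_snext /= => h.
by have := rank_leq_col C; have := muln1 e; lia.
Qed.

Definition pairing_linres : linres gr.
Proof.
have hf i : row_full (sA (Sk i)).
  apply: strand_full1; last by lia.
  by rewrite /row_full mxrank0.
apply: (@LinRes _ _ gr (fun j => sm (Sk j)) (fun j => sX (Sk j))) => //.
- by move=> j; apply: (@sX_deg _ _ _ _ _ hx).
- by move=> j; apply: (sX_mul hx).
- by move=> u hu; apply: (strand_aug hshort (hf 1%N) hu); rewrite mulmx0.
- by move=> j u; apply: (sX_exact hshort hx); apply: (hf j.+2).
Defined.

Theorem pairing_open p q : (0 < p)%N ->
  zariski_open (@linear_locus k R gr e x hx p q).
Proof.
move=> p0; apply: (@linear_locus_open _ _ _ pairing_linres _ _ hx p q p.+1) => C.
  by move=> hC i; apply: koszul_phi_surj.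
move=> hs; apply: (strand_koszul hshort hx (hy := hy)) => // -[|i].
  exact: phi_surj_full0 (hs 0%N _).
case: (leqP p i) => hi; first exact: strand_full_gt.
exact: (phi_surj_full hshort hy (hs i.+1 _)).
Qed.

Theorem pairing_nonempty p q : (0 < p)%N -> (q <= (e - 1) * p)%N ->
  exists C : 'M[k]_(e * p, q), linear_locus hx C.
Proof.
move=> p0 hq.
apply: (@linear_locus_nonempty _ _ _ hshort pairing_linres _ _ hx _ _ hy _ (pid_mx (e - 1) : 'M_(e, e - 1))) => //.
apply: (strand_koszul hshort hx (hy := hy)) => //; apply: strand_full1.
  apply/block_table_full/row_fullP; exists (pid_mx (e - 1)).
  by rewrite pid_mx_id ?pid_mx_1 //; lia.
by lia.
Qed.

End Pairing.

(** * Short Gorenstein algebras *)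

Lemma finspan_basis (k : fieldType) (V : lmodType k) N (g : 'I_N -> V) :
  exists n, has_rank (fun v => exists c : 'rV[k]_N, v = \sum_i c 0 i *: g i) n.
Proof.
elim: N g => [|N IH] g.
  exists 0%N, (fun _ => 0); split=> [[]//|c _|v [c ->]].
    by apply/rowP => -[].
  by exists c; rewrite !big_ord0.
have [n [b [bS bfree bspan]]] := IH (fun i => g (lift ord0 i)).
have ext i : exists c : 'rV[k]_N.+1, b i = \sum_j c 0 j *: g j.
  have [c ->] := bS i; exists (\row_i oapp (fun j => c 0 j) 0 (unlift ord0 i)).
  rewrite big_ord_recl mxE unlift_none scale0r add0r; apply: eq_bigr => j _.
  by rewrite mxE liftK.
case: (classic (exists c : 'rV[k]_n, g ord0 = \sum_i c 0 i *: b i)) => h.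
  exists n, b; split=> // v [c ->]; have [d Ed] := h.
  have [|d' Ed'] := bspan (\sum_i c 0 (lift ord0 i) *: g (lift ord0 i)).
    by exists (\row_i c 0 (lift ord0 i)); apply: eq_bigr => i _; rewrite mxE.
  exists (c 0 ord0 *: d + d'); rewrite big_ord_recl Ed Ed' scaler_sumr -big_split.
  by apply: eq_bigr => i _; rewrite !mxE scalerDl scalerA.
pose b' (i : 'I_n.+1) := oapp b (g ord0) (unlift ord0 i).
have b'S (c : 'rV[k]_n.+1) :
    \sum_i c 0 i *: b' i = c 0 ord0 *: g ord0 + \sum_i c 0 (lift ord0 i) *: b i.
  rewrite big_ord_recl /b' unlift_none; congr (_ + _).
  by apply: eq_bigr => i _; rewrite liftK.
exists n.+1, b'; split.
- move=> i; rewrite /b'; case: unliftP => [j|] _ /=; first exact: ext.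
  exists (delta_mx 0 ord0); rewrite (bigD1 ord0) //= mxE !eqxx scale1r.
  by rewrite big1 ?addr0 // => j hj; rewrite mxE (negbTE hj) andbF scale0r.
- move=> c; rewrite b'S => h0.
  have c0 : c 0 ord0 = 0.
    apply/eqP/negPn/negP => ne; apply: h.
    exists (\row_i (- (c 0 ord0)^-1 * c 0 (lift ord0 i))).
    under eq_bigr => i _ do rewrite mxE -scalerA.
    rewrite -scaler_sumr; apply: (@scalerI _ _ (c 0 ord0)) => //.
    rewrite scalerA mulrN divff // scaleN1r; apply/eqP.
    by rewrite -addr_eq0 h0.
  have := bfree (\row_i c 0 (lift ord0 i)).
  under eq_bigr => i _ do rewrite mxE.
  move: h0; rewrite c0 scale0r add0r => -> /(_ erefl)/rowP hc.
  apply/rowP => i; rewrite mxE; case: (unliftP ord0 i) => [j ->|->] //.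
  by have := hc j; rewrite !mxE.
move=> v [c ->].
have [|d' Ed'] := bspan (\sum_i c 0 (lift ord0 i) *: g (lift ord0 i)).
  by exists (\row_i c 0 (lift ord0 i)); apply: eq_bigr => i _; rewrite mxE.
exists (\row_i oapp (fun j => d' 0 j) (c 0 ord0) (unlift ord0 i)).
rewrite b'S big_ord_recl Ed' mxE unlift_none; congr (_ + _).
by apply: eq_bigr => i _; rewrite mxE liftK.
Qed.

Section Degree2.
Variables (k : fieldType) (R : comAlgType k) (gr : std_graded R).
Hypothesis hshort : short gr.
Variables (e : nat) (x : 'I_e -> R) (hx : kbasis (in_deg gr 1%N) x).

Lemma deg2_basis : exists r, has_rank (in_deg gr 2) r.
Proof.
pose g w := \sum_i \sum_j vec_mx (delta_mx 0 w : 'rV[k]_(e * e)) i j *: (x i * x j).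
have gE (v : 'rV[k]_(e * e)) :
    \sum_w v 0 w *: g w = \sum_i \sum_j vec_mx v i j *: (x i * x j).
  under eq_bigr => w _ do rewrite scaler_sumr.
  rewrite exchange_big; apply: eq_bigr => i _.
  under eq_bigr => w _ do rewrite scaler_sumr.
  rewrite exchange_big; apply: eq_bigr => j _.
  under eq_bigr => w _ do rewrite scalerA.
  rewrite -scaler_suml; congr (_ *: _).
  rewrite [in RHS](row_sum_delta v) linear_sum summxE; apply: eq_bigr => w _.
  by rewrite linearZ [RHS]mxE.
have [r [b [bS bfree bspan]]] := finspan_basis g.
exists r, b; split=> // [i|v hv].
  have [c ->] := bS i; rewrite gE; apply: in_deg_sum => l _.
  by apply: in_deg_sum => j _; apply/in_deg_scale/(@in_deg_mul _ _ _ 1 1); apply: (basis_deg1 hx).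
have [c Ec] := deg2_span hshort hx hv; apply: bspan; exists (mxvec c).
by rewrite gE mxvecK.
Qed.

End Degree2.

Definition aug_ker (k : fieldType) (R : comAlgType k) (gr : std_graded R) :=
  [pred a : R^o | aug gr a == 0].

Section AugIdeal.
Variables (k : fieldType) (R : comAlgType k) (gr : std_graded R).

Fact aug_ker_closed : submod_closed (aug_ker gr).
Proof.
split=> [|a u v]; rewrite !inE ?aug0 // => /eqP hu /eqP hv.
by rewrite augD augM hu hv mulr0 addr0.
Qed.

HB.instance Definition _ :=
  GRing.isSubmodClosed.Build R R^o (aug_ker gr) aug_ker_closed.

Record aug_ideal := AugIdeal { aug_val : R^o; _ : aug_val \in aug_ker gr }.
HB.instance Definition _ := [isSub for aug_val].
HB.instance Definition _ := [Choice of aug_ideal by <:].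
HB.instance Definition _ := [SubChoice_isSubLmodule of aug_ideal by <:].

Lemma aug_idealP (a : aug_ideal) : aug gr (aug_val a) = 0.
Proof. by case: a => a /= /eqP. Qed.

(** The inclusion of the maximal ideal in the algebra, along which [g] extends; [z] is
the value of the extension at [1]. *)
Lemma injective_extend (J : lmodType R) (g : R -> J) : injective_module J ->
  (forall c a b, aug gr a = 0 -> aug gr b = 0 -> g (c * a + b) = c *: g a + g b) ->
  exists z, forall a, aug gr a = 0 -> g a = a *: z.
Proof.
move=> hJ hg; pose f (a : aug_ideal) : J := g (aug_val a).
have flin : linear f.
  by move=> c a b; rewrite /f /= hg ?aug_idealP.
pose fl := GRing.isLinear.Build R aug_ideal J *:%R f flin.
pose F : {linear aug_ideal -> J} := HB.pack f fl.
pose V : {linear aug_ideal -> R^o} := (\val : aug_ideal -> R^o).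
have [h Eh] := hJ aug_ideal R^o V F val_inj.
exists (h 1) => a ha; have hin : (a : R^o) \in aug_ker gr by rewrite inE ha.
have := Eh (AugIdeal hin); rewrite /F /f /= => <-.
by rewrite -linearZ /= [_ *: 1]mulr1.
Qed.

End AugIdeal.

Section Socle.
Variables (k : fieldType) (R : comAlgType k) (gr : std_graded R).
Hypothesis hshort : short gr.

Definition in_socle (M : lmodType R) (t : M) := forall a, aug gr a = 0 -> a *: t = 0.

(** A submodule [Z] such that all maps from the maximal ideal to [Z] extend to
the algebra. *)
Definition aug_extends (J : lmodType R) (Z : J -> Prop) := forall g : R -> J,
  (forall a, aug gr a = 0 -> Z (g a)) ->
  (forall c a b, aug gr a = 0 -> aug gr b = 0 -> g (c * a + b) = c *: g a + g b) ->
  exists2 z, Z z & forall a, aug gr a = 0 -> g a = a *: z.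

(** If the socle element [s] has the property that extension from the maximal
ideal yields divisibility by [s], then finite injective dimension forces the
socle to be spanned by [s]. The induction goes down along the cosyzygies [Z] of
an injective resolution: divisibility of the socle of the next cosyzygy by [s]
lifts it to the socle of the injective module, which makes maps from the maximal
ideal to [Z] extend. *)
Lemma socle_of_finite_injdim (s : R) : in_socle (s : R^o) ->
  (forall (J : lmodType R) (Z : J -> Prop),
     Z 0 -> (forall (c : R) a b, Z a -> Z b -> Z (c *: a + b)) ->
     aug_extends Z -> forall t, Z t -> in_socle t -> exists2 z, Z z & t = s *: z) ->
  finite_injdim (R^o : lmodType R) ->
  forall t : R, in_socle (t : R^o) -> exists c : k, t = c *: s.
Proof.
move=> hs hdiv [n [J [eta [d [Jinj Jzero etainj ex0 exS]]]]].
have E i : forall t : J i, d i t = 0 -> in_socle t ->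
    exists2 z, d i z = 0 & t = s *: z.
  move: {-2}(n.+1 - i)%N (erefl (n.+1 - i)%N) => m.
  elim: m i => [|m IH] i hm t ht hsoc.
    have hi : (n < i)%N by lia.
    by exists 0; [rewrite raddf0|rewrite scaler0; apply: Jzero].
  have {}IH := IH i.+1 ltac:(lia).
  apply: (hdiv _ (fun z => d i z = 0)) => //.
  - by rewrite raddf0.
  - by move=> c a b ha hb; rewrite linearP ha hb scaler0 addr0.
  move=> g gZ glin; have [z Ez] := injective_extend (Jinj i) glin.
  have [||z1 hz1 Ez1] := IH (d i z).
  - by apply/exS; exists z.
  - by move=> a ha; rewrite -linearZ /= -Ez // gZ.
  have [w Ew] := (exS i z1).1 hz1.
  exists (z - s *: w); first by rewrite linearB linearZ /= -Ew Ez1 subrr.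
  move=> a ha; rewrite Ez // scalerBr scalerA.
  by have := hs a ha; rewrite /= => /= h; rewrite [a * s]h scale0r subr0.
move=> t ht; have [||z hz Ez] := E 0%N (eta t).
- by apply/ex0; exists t.
- by move=> a ha; rewrite -linearZ /= (ht a ha) raddf0.
have [w Ew] := (ex0 z).1 hz.
have Et : t = s * w.
  by apply: etainj; rewrite Ez Ew -linearZ.
exists (aug gr w); rewrite Et mulrC; apply/eqP; rewrite -subr_eq0.
rewrite -mulr_algl -mulrBl; apply/eqP/(hs (w - _)).
by rewrite augD augN aug_alg subrr.
Qed.

End Socle.

Section Gorenstein.
Variables (k : fieldType) (R : comAlgType k) (gr : std_graded R).
Hypothesis hshort : short gr.
Variables (e : nat) (x : 'I_e -> R) (hx : kbasis (in_deg gr 1%N) x).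

Lemma socle_scale (J : lmodType R) (t : J) (c : R) :
  in_socle gr t -> c *: t = (aug gr c)%:A *: t.
Proof.
move=> ht; apply/eqP; rewrite -subr_eq0 -scalerBl; apply/eqP/ht.
by rewrite augD augN aug_alg subrr.
Qed.

Lemma kscaleA (J : lmodType R) (t : J) (a b : k) :
  ((a * b)%:A : R) *: t = a%:A *: (b%:A *: t).
Proof. by rewrite scalerA mulr_algl scalerA. Qed.

Lemma kscaleC (J : lmodType R) (t : J) (a : k) (c : R) :
  c *: (a%:A *: t) = a%:A *: (c *: t).
Proof. by rewrite !scalerA mulrC. Qed.

Lemma deg2_socle s : in_deg gr 2 s -> in_socle gr (s : R^o).
Proof.
move=> hs a ha; change (a * s = 0).
by rewrite (deg2_mul hshort _ hs) ha scale0r.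
Qed.

(** Multiplication by [s] is reached from the maximal ideal by extending twice:
first each map [a |-> lam (a * x l) t], then the map that these extensions
define together with [lam] on all of the maximal ideal. *)
Lemma socle_div_deg2 (s : R) (lam : R -> k) : in_deg gr 2 s ->
  (forall a b, lam (a + b) = lam a + lam b) ->
  (forall c a, lam (c *: a) = c * lam a) ->
  (forall a, in_deg gr 1 a -> lam a = 0) -> lam s = 1 ->
  forall (J : lmodType R) (Z : J -> Prop),
     Z 0 -> (forall (c : R) a b, Z a -> Z b -> Z (c *: a + b)) ->
     aug_extends gr Z -> forall t, Z t -> in_socle gr t ->
     exists2 z, Z z & t = s *: z.
Proof.
move=> hs lamD lamZ lam1 lams J Z Z0 Zlin hext t Zt ht.
have lam0 : lam 0 = 0 by rewrite -(scale0r 0) lamZ mul0r.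
have lam_sum (F : 'I_e -> R) : lam (\sum_l F l) = \sum_l lam (F l).
  exact: (big_morph _ lamD lam0).
have ZZ c w : Z w -> Z (c *: w) by move=> hw; rewrite -[_ *: _]addr0; apply: Zlin.
have ax a l : aug gr a = 0 -> in_deg gr 2 (a * x l).
  move=> ha; rewrite (deg1_mul hshort _ (basis_deg1 hx l)) ha scale0r add0r.
  exact: (in_deg_mul (hcomp_in gr 1 a) (basis_deg1 hx l)).
have /fin_all_exists2[z Zz Ez] l : exists2 z, Z z &
    forall a, aug gr a = 0 -> (lam (a * x l))%:A *: t = a *: z.
  apply: hext => [a _|c a b ha hb]; first exact: ZZ.
  rewrite mulrDl lamD -mulrA (deg2_mul hshort _ (ax a l ha)) lamZ.
  rewrite scalerDl scalerDl; congr (_ + _).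
  by rewrite kscaleC (socle_scale c ht) -kscaleA mulrC.
pose g a := \sum_l (coord1 hx a 0 l)%:A *: z l + (lam a)%:A *: t.
have zc c l : c *: z l = (aug gr c)%:A *: z l + (lam (c * x l))%:A *: t.
  have hc : aug gr (c - (aug gr c)%:A) = 0 by rewrite augD augN aug_alg subrr.
  have := Ez l _ hc; rewrite mulrBl lamD mulr_algl -scaleN1r !lamZ.
  rewrite (lam1 _ (basis_deg1 hx l)) !mulr0 addr0 => ->.
  by rewrite -scalerDl addrC subrK.
have lamM c a : aug gr a = 0 ->
    lam (c * a) = aug gr c * lam a + \sum_l coord1 hx a 0 l * lam (c * x l).
  move=> ha; have Ea : a = gr 1 a + gr 2 a.
    by rewrite {1}(aug_decomp hshort a) ha scale0r add0r.
  have -> : lam a = lam (gr 2 a).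
    by rewrite Ea lamD lam1 ?add0r; [rewrite -Ea|apply: hcomp_in].
  rewrite {1}Ea mulrDr lamD addrC (deg2_mul hshort _ (hcomp_in gr 2 a)) lamZ.
  congr (_ + _); rewrite -(coord1E hx) mulr_sumr lam_sum.
  by apply: eq_bigr => l _; rewrite -scalerAr lamZ.
have Zg a : Z (g a).
  rewrite /g -[X in Z (X + _)]scale1r; apply: (Zlin) => //; last exact: ZZ.
  apply: (big_ind Z) => // [u v hu hv|l _]; last exact: ZZ.
  by rewrite -(scale1r u); apply: Zlin.
have [||w Zw Ew] := hext g.
- by move=> a _; apply: Zg.
- move=> c a b ha hb.
  have -> : g (c * a + b) = g (c * a) + g b.
    rewrite /g lamD coord1D !scalerDl addrACA -big_split; congr (_ + _).
    by apply: eq_bigr => l _; rewrite mxE !scalerDl.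
  congr (_ + _); rewrite /g lamM // coord1M ha scale0r addr0.
  rewrite scalerDr scaler_sumr kscaleC (socle_scale c ht) -kscaleA [lam a * _]mulrC.
  rewrite !scalerDl [X in _ + X]addrC addrA; congr (_ + _).
  rewrite !scaler_suml -big_split; apply: eq_bigr => l _.
  rewrite [c *: (_ *: z l)]kscaleC [c *: z l]zc mxE [in RHS]scalerDr -!kscaleA.
  by rewrite [in RHS](mulrC _ (aug gr c)).
exists w => //; have hs0 : aug gr s = 0 by exact: aug_deg hs.
rewrite -Ew // /g lams (coord1_deg2 hx hs) !scale1r big1 ?add0r // => l _.
by rewrite mxE !scale0r.
Qed.

Lemma socle_div_deg1 l0 : (forall a, in_deg gr 2 a -> a = 0) ->
  forall (J : lmodType R) (Z : J -> Prop),
     Z 0 -> (forall (c : R) a b, Z a -> Z b -> Z (c *: a + b)) ->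
     aug_extends gr Z -> forall t, Z t -> in_socle gr t ->
     exists2 z, Z z & t = x l0 *: z.
Proof.
move=> h2 J Z Z0 Zlin hext t Zt ht.
have [||w Zw Ew] := hext (fun a => (coord1 hx a 0 l0)%:A *: t).
- by move=> a _; rewrite -[_ *: _]addr0; apply: Zlin.
- move=> c a b ha hb; rewrite coord1D coord1M ha scale0r addr0 !mxE !scalerDl.
  by rewrite kscaleC (socle_scale c ht) -kscaleA mulrC.
exists w => //; rewrite -Ew ?(aug_deg (basis_deg1 hx l0)) //.
by rewrite coord1_x mxE !eqxx !scale1r.
Qed.

(** Any nonzero [s] of degree two satisfies the hypothesis of [socle_of_finite_injdim],
so the socle is the line [R_2]. If [R_2] were zero, any basis vector of degree one
would do, although the socle then contains all of them. *)
Theorem gorenstein_pairing : gorenstein R -> (2 <= e)%N ->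
  (exists y : 'I_1 -> R, kbasis (in_deg gr 2) y) /\
  (forall a, in_deg gr 1 a -> (forall b, in_deg gr 1 b -> a * b = 0) -> a = 0).
Proof.
move=> [_ hinj] he.
case: (classic (forall a, in_deg gr 2 a -> a = 0)) => h2.
  have soc1 a : in_deg gr 1 a -> in_socle gr (a : R^o).
    move=> ha b hb; change (b * a = 0).
    rewrite (deg1_mul hshort _ ha) hb scale0r add0r; apply: h2.
    exact: (in_deg_mul (hcomp_in gr 1 b) ha).
  pose l0 := Ordinal (ltnW he); pose l1 := Ordinal he.
  have [c Ec] := socle_of_finite_injdim (soc1 _ (basis_deg1 hx l0))
    (@socle_div_deg1 l0 h2) hinj (soc1 _ (basis_deg1 hx l1)).
  have := congr1 (fun v => coord1 hx v 0 l1) Ec.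
  rewrite coord1Z !coord1_x !mxE !eqxx /= mulr0 => /eqP.
  by rewrite oner_eq0.
have [s hs s0] : exists2 s, in_deg gr 2 s & s <> 0.
  apply: NNPP => h; apply: h2 => a ha; apply: NNPP => a0; apply: h.
  by exists a.
have [r [y hy]] := deg2_basis hshort hx.
have [i0 hi0] : exists i, gcoord hy s 0 i != 0.
  apply/existsP; rewrite -negb_forall; apply/negP => /forallP h; apply: s0.
  by apply: (gcoord_eq0 (hb := hy)) => //; apply/rowP => i; rewrite mxE; apply/eqP.
have hsoc (t : R) : in_socle gr (t : R^o) -> exists c : k, t = c *: s.
  apply: (@socle_of_finite_injdim _ _ gr s (deg2_socle hs)) => //.
  apply: (@socle_div_deg2 s (fun a => gcoord hy a 0 i0 / gcoord hy s 0 i0)) => //.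
  - by move=> a b; rewrite gcoordD mxE mulrDl.
  - by move=> c a; rewrite gcoordZ mxE mulrA.
  - by move=> a ha; rewrite (gcoord_other hy _ ha) // mxE mul0r.
  - by rewrite divff.
split.
  exists (fun _ => s); split=> // [c|v hv].
    rewrite big_ord1 => /eqP; rewrite scaler_eq0 => /orP[/eqP h|/eqP //].
    by apply/rowP => i; rewrite ord1 mxE.
  have [c ->] := hsoc v (deg2_socle hv).
  by exists (const_mx c); rewrite big_ord1 mxE.
move=> a ha h; have [|c Ec] := hsoc a.
  move=> b hb; change (b * a = 0); rewrite (deg1_mul hshort _ ha) hb scale0r add0r.
  by rewrite mulrC h //; apply: hcomp_in.
rewrite -ha Ec hcompZ (in_deg_orth _ hs) /=.
by rewrite scaler0.
Qed.

End Gorenstein.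

(** * Exact pairs of linear forms *)

(** [B] spans a complement of the line of [v], and [N] gives the coordinates on it. *)
Lemma line_complement (k : fieldType) e (v : 'rV[k]_e) : v != 0 ->
  exists B : 'M_(e - 1, e), exists N : 'M_(e, e - 1),
    [/\ v *m N = 0, B *m N = 1%:M &
        forall t (c : 'M_(t, e)), exists d, c = d *m v + c *m N *m B].
Proof.
move=> v0; have [B EB] : exists B : 'M_(e - 1, e), (B :=: v^C)%MS.
  have -> : (e - 1 = \rank (v^C)%MS)%N by rewrite mxrank_compl rank_rV v0.
  by exists (row_base v^C)%MS; apply: eq_row_base.
have Bfree : row_free B by rewrite /row_free EB mxrank_compl rank_rV v0.
have disj (a : 'M_(1, e)) : (a <= v)%MS -> (a <= B)%MS -> a = 0.
  move=> h1 h2; apply/eqP; rewrite -submx0 -(capmx_compl v) sub_capmx h1 /=.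
  by rewrite -EB.
have /sub_addsmxP[[d1 N] E] : (1%:M <= v + B)%MS.
  by rewrite (adds_eqmx (eqmx_refl v) EB) sub1mx addsmx_compl_full.
rewrite /= in E.
have dec t (c : 'M_(t, e)) : c = c *m d1 *m v + c *m N *m B.
  by rewrite -!mulmxA -mulmxDr -E mulmx1.
exists B, N; split.
- have Ev := dec _ v; apply: (row_free_inj Bfree); rewrite mul0mx.
  apply: disj; last exact: submxMl.
  have -> : v *m N *m B = v - v *m d1 *m v by rewrite {2}Ev addrC addKr.
  by rewrite addmx_sub // ?eqmx_opp submxMl.
- apply: (row_free_inj Bfree); rewrite mul1mx; apply/row_matrixP => i.
  apply/eqP; rewrite -subr_eq0; apply/eqP/disj; last first.
    by rewrite addmx_sub ?eqmx_opp ?row_sub // row_mul submxMl.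
  have -> : row i (B *m N *m B) - row i B = - (row i (B *m d1) *m v).
    have -> : row i B = row i (B *m d1) *m v + row i (B *m N *m B).
      by rewrite {1}(dec _ B) linearD /= row_mul.
    by rewrite opprD addrCA subrr addr0.
  by rewrite eqmx_opp submxMl.
by move=> t c; exists (c *m d1); apply: dec.
Qed.

Section ExactPair.
Variables (k : fieldType) (R : comAlgType k) (gr : std_graded R).
Hypothesis hshort : short gr.
Variables (e : nat) (x : 'I_e -> R) (hx : kbasis (in_deg gr 1%N) x).

Local Notation emb := (@emb k R _ _).
Local Notation mxdeg := (mxdeg gr).
Local Notation cv := (gcv hx).

(** Half of an exact pair: multiplication by [l] maps onto the forms of degree
two, with kernel spanned by [l']. *)
Definition half_exact (l l' : R) :=
  [/\ in_deg gr 1 l, in_deg gr 1 l', l' * l = 0,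
      forall z, in_deg gr 2 z -> exists2 a, in_deg gr 1 a & z = a * l
    & forall a, in_deg gr 1 a -> a * l = 0 -> exists c : k, a = c *: l'].

Lemma half_exact_ann l l' a : half_exact l l' -> half_exact l' l -> l != 0 ->
  a * l = 0 -> exists d, a = d * l'.
Proof.
case=> hl hl' _ _ hann [_ _ _ hdiv _] l0 ha.
have hd : aug gr a *: l + gr 1 a * l = 0 by rewrite -(deg1_mul hshort).
have h1 : aug gr a *: l = 0.
  have := congr1 (gr 1) hd; rewrite raddfD raddf0 /= hcompZ hl.
  by rewrite (in_deg_orth _ (in_deg_mul (hcomp_in gr 1 a) hl)) addr0.
have a0 : aug gr a = 0.
  by move/eqP: h1; rewrite scaler_eq0 (negbTE l0) orbF => /eqP.
have [|c Ec] := hann (gr 1 a) (hcomp_in gr 1 a).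
  by move: hd; rewrite h1 add0r.
have [b hb Eb] := hdiv _ (hcomp_in gr 2 a).
exists (c%:A + b); rewrite mulrDl mulr_algl -Ec -Eb.
by rewrite {1}(aug_decomp hshort a) a0 scale0r add0r.
Qed.

Variables (l l' : R).
Hypotheses (hl : half_exact l l') (hl' : half_exact l' l) (l0 : l != 0).

Lemma half_exact_neq0 : l' != 0.
Proof.
apply/eqP => l'0; case: hl => dl _ _ _ hann; case: hl' => _ _ _ hdiv _.
have [a _ E] := hdiv _ (in_deg_mul dl dl).
have [|c Ec] := hann l dl; first by rewrite E l'0 mulr0.
by move: l0; rewrite Ec l'0 scaler0 eqxx.
Qed.

Definition pair_elt (i : nat) : R := if odd i then l' else l.

Lemma pair_elt_half i : half_exact (pair_elt i) (pair_elt i.+1).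
Proof. by rewrite /pair_elt /=; case: (odd i). Qed.

Lemma pair_elt_deg i : in_deg gr 1 (pair_elt i).
Proof. by case: (pair_elt_half i). Qed.

Lemma pair_elt_mul i : pair_elt i.+1 * pair_elt i = 0.
Proof. by case: (pair_elt_half i). Qed.

Lemma pair_elt_ann i a : a * pair_elt i = 0 -> exists d, a = d * pair_elt i.+1.
Proof.
apply: half_exact_ann; try exact: pair_elt_half.
  by have := pair_elt_half i.+1; rewrite {2}/pair_elt /= negbK -/(pair_elt i).
by rewrite /pair_elt; case: (odd i) => //; apply: half_exact_neq0.
Qed.

Lemma scalar_mxdeg i : mxdeg 1 ((pair_elt i)%:M : 'M_1).
Proof. by move=> a b; rewrite !ord1 mxE eqxx; apply: pair_elt_deg. Qed.

Let f := (e - 1)%N.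

(** The cyclic module [R / (l)], whose resolution has all terms of rank one. *)
Lemma exact_pair_cyclic : exists N : 'M[k]_(e, f), linear_locus hx (block_table N 1).
Proof.
have v0 : coord1 hx l != 0.
  apply: contraNneq l0 => h; apply/eqP; apply: (coord1_eq0 (hx := hx)) => //.
  by case: hl.
have [B [N [vN BN hdec]]] := line_complement v0.
exists N.
have tableE (u : 'M[R]_(1, 1)) j : (cv u *m block_table N 1) 0 (mxvec_index j 0) =
    (coord1 hx (u 0 0) *m N) 0 j.
  by rewrite block_tableE mxE; apply: eq_bigr => i _; rewrite mulrC.
apply: (@koszul_of_linear _ _ _ hshort _ _ hx (fun _ => 1%N) _ _
  (fun i => (pair_elt i)%:M)) => //.
- by apply/block_table_full/row_fullP; exists B.
- by move=> i; apply: scalar_mxdeg.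
- apply: mx_indexP => i j w; rewrite !ord1 tableE.
  have -> : ((pair_elt 0)%:M : 'M[R]_1) 0 0 = l by rewrite mxE eqxx.
  by rewrite vN !mxE.
- move=> u u0 uN.
  have h1 : coord1 hx (u 0 0) *m N = 0.
    by apply/rowP => j; rewrite -tableE uN !mxE.
  have [d Ed] := hdec _ (coord1 hx (u 0 0)).
  rewrite h1 mul0mx addr0 in Ed.
  have hd : gr 1 (u 0 0) = d 0 0 *: l.
    rewrite -(coord1E hx) Ed [in RHS](coord1_deg1 hx (a := l)); last by case: hl.
    rewrite scaler_sumr; apply: eq_bigr => i _.
    by rewrite !mxE big_ord1 scalerA.
  have [a _ Ea] : exists2 a, in_deg gr 1 a & gr 2 (u 0 0) = a * l.
    by case: hl => _ _ _ hdiv _; apply/hdiv/hcomp_in.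
  exists ((d 0 0)%:A + a)%:M; rewrite -scalar_mxM mulrDl mulr_algl -hd -Ea.
  rewrite [LHS]mx11_scalar; congr (_%:M); rewrite {1}(aug_decomp hshort (u 0 0)).
  by have /matrixP/(_ 0 0) := u0; rewrite !mxE => ->; rewrite scale0r add0r.
- by move=> i; rewrite -scalar_mxM pair_elt_mul raddf0.
move=> i u hu; have [|d Ed] := @pair_elt_ann i (u 0 0).
  by move: hu; rewrite mul_mx_scalar => /matrixP/(_ 0 0); rewrite !mxE mulrC.
by exists d%:M; rewrite [LHS]mx11_scalar Ed scalar_mxM.
Qed.

(** ** The residue field as an iterated mapping cone *)

Variables (w : 'M[R]_(f * 1, 1)).
Hypotheses (wdeg : mxdeg 1 w)
  (lw_span : forall a, in_deg gr 1 a -> exists c : k, exists d : 'rV[k]_(f * 1),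
     a%:M = (c *: l)%:M + emb d *m w)
  (lw_free : forall (c : k) (d : 'rV[k]_(f * 1)),
     (c *: l)%:M + emb d *m w = 0 -> c = 0 /\ d = 0).

Fixpoint cone_rank j := if j is j'.+1 then (1 + f * cone_rank j')%N else 1%N.

Definition cone_quot n (l1 : R) (z : 'M[R]_(n, 1)) : 'M[R]_(n, 1) :=
  epsilon (inhabits 0) (fun a => mxdeg 1 a /\ z = a *m l1%:M).

Lemma cone_quotP n i (z : 'M[R]_(n, 1)) : mxdeg 2 z ->
  mxdeg 1 (cone_quot (pair_elt i) z) /\ z = cone_quot (pair_elt i) z *m (pair_elt i)%:M.
Proof.
move=> hz; apply: (epsilon_spec (inhabits 0) (fun a => mxdeg 1 a /\ z = a *m _)).
have [_ _ _ hdiv _] := pair_elt_half i.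
have /fin_all_exists2[a ha Ea] := fun s => hdiv _ (hz s 0).
exists (\col_s a s); split; first by move=> s t; rewrite mxE.
by apply/matrixP => s t; rewrite !mxE big_ord1 !mxE !ord1 eqxx Ea.
Qed.

(** The kernel of [R / (l) -> k] is a sum of [f] copies of [k], generated by [w], so
that the resolution of [k] is the cone of a lift of the inclusion of that kernel
to the resolutions; the second component is this lift. *)
Fixpoint cone j : 'M[R]_(cone_rank j.+1, cone_rank j) * 'M[R]_(f * cone_rank j, 1) :=
  match j with
  | 0%N => (col_mx l%:M w, w)
  | j'.+1 => let a := cone_quot (pair_elt j') (- (lin_mulmxr (cone j').1 *m (cone j').2)) in
      (block_mx (pair_elt j'.+1)%:M 0 a (lin_mulmxr (cone j').1), a)
  end.

Lemma lin_mulmxr_deg m n p (D : 'M[R]_(n, p)) :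
  mxdeg 1 D -> mxdeg 1 (lin_mulmxr D : 'M[R]_(m * n, m * p)).
Proof.
move=> hD i j; case/mxvec_indexP: j => a b.
have -> : (lin_mulmxr D : 'M[R]_(m * n, m * p)) i (mxvec_index a b) =
    (emb (vec_mx (delta_mx 0 i)) *m D) a b.
  have -> : (emb (vec_mx (delta_mx 0 i)) : 'M_(m, n)) = vec_mx (delta_mx 0 i).
    by apply/matrixP => s t; rewrite !mxE /= scaler_nat.
  transitivity ((row i (lin_mulmxr D : 'M[R]_(m * n, m * p))) 0 (mxvec_index a b)).
    by rewrite [RHS]mxE.
  by rewrite rowE -{1}(vec_mxK (delta_mx 0 i)) mul_vec_lin mxvecE.
exact: mxdeg_embl.
Qed.

Lemma cone_deg j : mxdeg 1 (cone j).1 /\ mxdeg 1 (cone j).2.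
Proof.
elim: j => [|j [IH1 IH2]] /=.
  split=> // a b; rewrite mxE; case: split => c //.
  exact: (scalar_mxdeg 0).
have hq : mxdeg 2 (- (lin_mulmxr (cone j).1 *m (cone j).2)).
  move=> a b; rewrite mxE; apply: in_deg_opp.
  by apply: (mxdeg_mul _ IH2); apply: lin_mulmxr_deg.
have [hd _] := cone_quotP j hq; split=> // a b.
rewrite mxE; case: split => c; rewrite mxE; case: split => d //.
- exact: (scalar_mxdeg j.+1).
- by rewrite mxE; apply: in_deg_zero.
exact: lin_mulmxr_deg.
Qed.

Lemma cone_rel j : lin_mulmxr (cone j).1 *m (cone j).2 =
  - ((cone j.+1).2 *m (pair_elt j)%:M).
Proof.
have hq : mxdeg 2 (- (lin_mulmxr (cone j).1 *m (cone j).2)).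
  move=> a b; rewrite mxE; apply: in_deg_opp.
  have [h1 h2] := cone_deg j.
  by apply: (mxdeg_mul _ h2); apply: lin_mulmxr_deg.
by have [_ E] := cone_quotP j hq; rewrite /= -E opprK.
Qed.

Lemma coneS j : (cone j.+1).1 =
  block_mx (pair_elt j.+1)%:M 0 (cone j.+1).2 (lin_mulmxr (cone j).1).
Proof. by []. Qed.

Lemma cone_mul j : (cone j.+1).1 *m (cone j).1 = 0.
Proof.
elim: j => [|j IH].
  rewrite coneS (mul_block_col (pair_elt 1)%:M 0 _ _ l%:M w).
  rewrite -scalar_mxM (pair_elt_mul 0) mul0mx addr0.
  rewrite [X in col_mx _ (_ + X)](cone_rel 0).
  by rewrite subrr raddf0 col_mx0.
rewrite (coneS j.+1) [X in _ *m X]coneS.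
rewrite (mulmx_block (pair_elt j.+2)%:M 0 _ _ (pair_elt j.+1)%:M 0 _ _).
rewrite -scalar_mxM pair_elt_mul !mul0mx !mulmx0 !addr0 add0r.
rewrite [X in block_mx _ _ (_ + X) _](cone_rel j.+1) subrr.
have -> : (lin_mulmxr (cone j.+1).1 : 'M_(f * _, _)) *m lin_mulmxr (cone j).1 = 0.
  apply/row_matrixP => i; rewrite row0 row_mul rowE.
  rewrite -(vec_mxK (delta_mx 0 i)) mul_vec_lin /= mul_vec_lin /=.
  by rewrite -mulmxA IH mulmx0 linear0.
by rewrite raddf0 block_mx0.
Qed.

Lemma cone_step j (c : 'M[R]_1) (V : 'M[R]_(f, cone_rank j.+1)) :
  c *m (pair_elt j)%:M + mxvec (V *m (cone j).1) *m (cone j).2 = 0 ->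
  exists v, row_mx c (mxvec (V *m (cone j).1)) = v *m (cone j.+1).1.
Proof.
rewrite -[mxvec (V *m _)]/(mxvec (mulmxr (cone j).1 V)) -mul_vec_lin -mulmxA.
rewrite cone_rel mulmxN mulmxA -mulmxBl => h.
have [|d Ed] := @pair_elt_ann j ((c - mxvec V *m (cone j.+1).2) 0 0).
  move: h; rewrite mul_mx_scalar => /matrixP/(_ 0 0).
  by rewrite [LHS]mxE [RHS]mxE mulrC.
exists (row_mx d%:M (mxvec V)).
rewrite coneS (mul_row_block d%:M _ (pair_elt j.+1)%:M 0).
rewrite mulmx0 add0r; congr row_mx.
rewrite -scalar_mxM -Ed -mx11_scalar.
by rewrite subrK.
Qed.

Lemma cone_aug (u : 'rV[R]_1) : map_mx (aug gr) u = 0 ->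
  exists v, u = v *m (cone 0).1.
Proof.
move=> u0; have [c [d E1]] := lw_span (hcomp_in gr 1 (u 0 0)).
have [a _ Ea] : exists2 a, in_deg gr 1 a & gr 2 (u 0 0) = a * l.
  by case: hl => _ _ _ hdiv _; apply/hdiv/hcomp_in.
exists (row_mx (c%:A + a)%:M (emb d)).
rewrite /= (mul_row_col (c%:A + a)%:M) -scalar_mxM mulrDl mulr_algl -Ea.
rewrite raddfD /= addrAC -E1 -raddfD /= [LHS]mx11_scalar; congr (_%:M).
rewrite {1}(aug_decomp hshort (u 0 0)).
by have /matrixP/(_ 0 0) := u0; rewrite !mxE => ->; rewrite scale0r add0r.
Qed.

Lemma cone_exact j (u : 'rV[R]_(cone_rank j.+1)) : u *m (cone j).1 = 0 ->
  exists v, u = v *m (cone j.+1).1.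
Proof.
elim: j u => [|j IH] u.
  rewrite -[u](@hsubmxK _ 1 1 (f * 1)).
  move: (lsubmx u : 'M_1) (rsubmx u) => c U.
  rewrite /= (mul_row_col c U l%:M w) => h.
  have hU : map_mx (aug gr) U = 0.
    have : (aug gr (c 0 0) *: l)%:M + emb (map_mx (aug gr) U) *m w = 0.
      have := congr1 (map_mx (gr 1)) h; rewrite map_mxD map_mx0 => <-.
      congr (_ + _).
        rewrite [c in RHS]mx11_scalar -scalar_mxM; apply/matrixP => s t.
        rewrite !ord1 !mxE !eqxx !mulr1n /=.
        have hd : in_deg gr 1 l by case: hl.
        rewrite (deg1_mul hshort _ hd) raddfD /= hcompZ hd.
        by rewrite (in_deg_orth _ (in_deg_mul (hcomp_in gr 1 (c 0 0)) hd)) addr0.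
      apply/matrixP => s t; rewrite !mxE raddf_sum; apply: eq_bigr => b _ /=.
      rewrite !mxE /= mulr_algl (deg1_mul hshort _ (wdeg b t)) raddfD /= hcompZ.
      rewrite (wdeg b t).
      by rewrite (in_deg_orth _ (in_deg_mul (hcomp_in gr 1 _) (wdeg b t))) addr0.
    by case/lw_free.
  have [V EV] : exists V, (vec_mx U : 'M_(f, 1)) = V *m (cone 0).1.
    apply: mul_rowwise => i; apply: cone_aug.
    apply/matrixP => s t; rewrite !mxE.
    by have /matrixP/(_ 0 (mxvec_index i t)) := hU; rewrite !mxE.
  have := @cone_step 0 c V; rewrite -EV vec_mxK; apply.
  exact: h.
rewrite -[u](@hsubmxK _ 1 1 (f * cone_rank j.+1)).
move: (lsubmx u : 'M_1) (rsubmx u) => c U.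
rewrite {1}coneS (mul_row_block c U (pair_elt j.+1)%:M 0).
rewrite mulmx0 add0r -row_mx0 => /eq_row_mx[h1 h2].
have [V EV] : exists V, vec_mx U = V *m (cone j.+1).1.
  apply: mul_rowwise => i; apply: IH; rewrite -row_mul.
  move: h2; rewrite -{1}[U]vec_mxK mul_vec_lin /= => /(congr1 vec_mx).
  by rewrite mxvecK linear0 => ->; rewrite row0.
have := @cone_step j.+1 c V; rewrite -EV vec_mxK; apply.
exact: h1.
Qed.

Definition cone_linres : linres gr :=
  @LinRes _ _ gr cone_rank (fun j => (cone j).1) isT
    (fun j => (cone_deg j).1) cone_mul cone_aug cone_exact.

End ExactPair.

Section ExactPairResolution.
Variables (k : fieldType) (R : comAlgType k) (gr : std_graded R).
Hypothesis hshort : short gr.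
Variables (e : nat) (x : 'I_e -> R) (hx : kbasis (in_deg gr 1%N) x).

Lemma exact_pair_linres (l l' : R) :
  half_exact gr l l' -> half_exact gr l' l -> l != 0 -> inhabited (linres gr).
Proof.
move=> hl hl' l0; have dl : in_deg gr 1 l by case: hl.
have v0 : coord1 hx l != 0.
  by apply: contraNneq l0 => h; apply/eqP; apply: (coord1_eq0 (hx := hx)).
have [B [N [vN BN hdec]]] := line_complement v0.
pose lin (c : 'rV[k]_e) := \sum_i c 0 i *: x i.
have linD c c' : lin (c + c') = lin c + lin c'.
  by rewrite -big_split; apply: eq_bigr => i _; rewrite mxE scalerDl.
have linZ a c : lin (a *: c) = a *: lin c.
  by rewrite scaler_sumr; apply: eq_bigr => i _; rewrite mxE scalerA.
have linl : lin (coord1 hx l) = l by rewrite /lin -(coord1_deg1 hx dl).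
pose w : 'M[R]_((e - 1) * 1, 1) := (mxvec (\matrix_(i < e - 1, j < 1) lin (row i B)))^T.
have wE (d : 'rV[k]_((e - 1) * 1)) :
    emb R d *m w = (lin (\row_i d 0 (mxvec_index i 0) *m B))%:M.
  rewrite [LHS]mx11_scalar; congr (_%:M); rewrite mxE sum_mxvec_index.
  rewrite mulmx_sum_row (big_morph lin linD (_ : lin 0 = 0)); last first.
    by rewrite -(scale0r 0) linZ scale0r.
  apply: eq_bigr => i _; rewrite big_ord1 linZ !mxE mxvecE !mxE /= mulr_algl.
  by [].
have wdeg : mxdeg gr 1 w.
  move=> i j; rewrite mxE ord1; case/mxvec_indexP: i => i i'.
  rewrite mxvecE mxE; apply: in_deg_sum => a _; apply: in_deg_scale.
  exact: basis_deg1.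
have span a : in_deg gr 1 a -> exists c : k, exists d : 'rV[k]_((e - 1) * 1),
    a%:M = (c *: l)%:M + emb R d *m w.
  move=> ha; have [c Ec] := hdec _ (coord1 hx a).
  exists (c 0 0), (mxvec (coord1 hx a *m N)^T); rewrite wE -raddfD; congr (_%:M).
  rewrite {1}(coord1_deg1 hx ha) -/(lin _) {1}Ec linD; congr (_ + lin (_ *m B)).
    by rewrite [c]mx11_scalar mul_scalar_mx linZ linl !mxE.
  by apply/rowP => i; rewrite [RHS]mxE mxvecE [in RHS]mxE.
have free (c : k) (d : 'rV[k]_((e - 1) * 1)) :
    (c *: l)%:M + emb R d *m w = 0 -> c = 0 /\ d = 0.
  rewrite wE -linl -linZ -raddfD -linD => /matrixP/(_ 0 0).
  rewrite [LHS]mxE eqxx mulr1n [RHS]mxE => h.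
  have E : c *: coord1 hx l + \row_i d 0 (mxvec_index i 0) *m B = 0.
    by rewrite -(coord1_basis hx (_ + _)) -/(lin _) h coord1_0.
  have d0 : \row_i d 0 (mxvec_index i 0) = 0.
    have := congr1 (mulmx^~ N) E; rewrite mulmxDl -scalemxAl vN scaler0 add0r.
    by rewrite -mulmxA BN mulmx1 mul0mx.
  move: E; rewrite d0 mul0mx addr0 => /eqP.
  rewrite scaler_eq0 (negbTE v0) orbF => /eqP c0; split=> //.
  apply: mx_indexP => i j s; have /rowP/(_ j) := d0.
  by rewrite !ord1 !mxE.
exact: (inhabits (cone_linres hshort hl hl' l0 wdeg span free)).
Qed.

(** Sums of copies of the module [R / (l)] have the required shape. *)
Theorem exact_pair_nonempty (l l' : R) p :
  half_exact gr l l' -> half_exact gr l' l -> l != 0 -> (0 < p)%N ->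
  (exists r, has_rank (in_deg gr 2) r) ->
  exists C : 'M[k]_(e * p, (e - 1) * p), linear_locus hx C.
Proof.
move=> hl hl' l0 p0 [r [y hy]].
have [P] := exact_pair_linres hl hl' l0.
have [N hN] := exact_pair_cyclic hshort hx hl hl' l0.
exact: (linear_locus_nonempty hshort P hy p0 (leqnn _) hN).
Qed.

End ExactPairResolution.

(** * Quadratic relations *)

Section Quadratic.
Variables (k : fieldType) (R : comAlgType k) (gr : std_graded R).
Hypothesis hshort : short gr.

Lemma mdeg2_mulU n (m : 'X_{1..n}) : mdeg m = 2 -> exists i j, m = (U_(i) + U_(j))%MM.
Proof.
move=> hm; have [i hi] : exists i, (0 < m i)%N.
  apply/existsP; rewrite -[[exists i, _]]negbK negb_exists; apply/negP => /forallP h.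
  move: hm; rewrite mdegE big1 // => i _.
  by apply/eqP; rewrite -leqn0 leqNgt; exact: h.
have le1 : (U_(i) <= m)%MM by rewrite lep1mP -lt0n.
have h1 : mdeg (m - U_(i))%MM = 1%N.
  by move: hm; rewrite -{1}(submK le1) mdegD mdeg1 addn1 => -[].
have /mdeg1P[j /eqP Ej] : mdeg (m - U_(i))%MM == 1%N by rewrite h1.
by exists j, i; rewrite -Ej submK.
Qed.

(** Since the relations of [R] are generated in degree two, a linear map [b] on
the forms of degree one that is compatible with the relations of degree two, up
to multiples of [m], extends to a homomorphism from [R] to polynomials modulo
[m]; as [R] has no forms of degree three, the cubes [b z ^+ 3] vanish there. *)
Lemma quadratic_test (b : R -> {poly k}) (h : R -> {poly k}) (m : {poly k}) :
  (forall u v, b (u + v) = b u + b v) -> (forall c u, b (c *: u) = c *: b u) ->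
  (forall u v, h (u + v) = h u + h v) -> (forall c u, h (c *: u) = c *: h u) ->
  (forall u v, in_deg gr 1 u -> in_deg gr 1 v -> exists q, h (u * v) = b u * b v + q * m) ->
  quadratic gr -> forall z, in_deg gr 1 z -> exists q, b z ^+ 3 = q * m.
Proof.
move=> bD bZ hD hZ hb [n [y [Q [ydeg ygen Qhom Qker]]]] z hz.
have h0 : h 0 = 0 by rewrite -(scale0r 0) hZ scale0r.
have b0 : b 0 = 0 by rewrite -(scale0r 0) bZ scale0r.
have hsum (I : Type) (s : seq I) (F : I -> R) : h (\sum_(i <- s) F i) = \sum_(i <- s) h (F i).
  exact: (big_morph h hD h0).
have bsum (I : Type) (s : seq I) (F : I -> R) : b (\sum_(i <- s) F i) = \sum_(i <- s) b (F i).
  exact: (big_morph b bD b0).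
pose ev := mmap (@polyC k) (fun i => b (y i)).
have hU (A : comNzRingType) (t : 'I_n -> A) i j :
    mmap1 t (U_(i) + U_(j))%MM = t i * t j.
  by rewrite commr_mmap1_M ?mmap1U // => a b'; apply: mulrC.
have evQ g : Q g -> exists q, ev g = q * m.
  move=> hg; have Eg : mmap (in_alg R) y g = 0.
    apply/Qker; exists 1%N, (fun _ => g), (fun _ => 1); split=> //.
    by rewrite big_ord1 mul1r.
  have S (F : 'X_{1..n} -> {poly k}) (F' : 'X_{1..n} -> R) :
      (forall u, mdeg u = 2 -> exists q, F u = h (F' u) + q * m) ->
      exists q, \sum_(u <- msupp g) g@_u *: F u =
        h (\sum_(u <- msupp g) g@_u *: F' u) + q * m.
    move=> hF; rewrite hsum.
    have : {in msupp g, forall u, mdeg u = 2} by move=> u; move/dhomogP: (Qhom _ hg); apply.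
    elim: (msupp g) => [|u s IH] hs.
      by exists 0; rewrite !big_nil mul0r addr0.
    have [|q Eq] := IH; first by move=> v hv; apply: hs; rewrite inE hv orbT.
    have [|q' Eq'] := hF u; first by apply: hs; rewrite inE eqxx.
    exists (g@_u *: q' + q); rewrite !big_cons Eq Eq' hZ scalerDr mulrDl scalerAl.
    by rewrite addrACA.
  have [u|q Eq] := S (mmap1 (fun i => b (y i))) (mmap1 y).
    case/mdeg2_mulU => i [j ->]; rewrite !hU.
    have [q ->] := hb _ _ (ydeg i) (ydeg j); exists (- q).
    by rewrite mulNr addrK.
  exists q; rewrite -[q * m]add0r -h0 -Eg /ev /mmap.
  transitivity (\sum_(u <- msupp g) g@_u *: mmap1 (fun i => b (y i)) u).
    by apply: eq_bigr => u _; rewrite mul_polyC.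
  rewrite Eq; congr (h _ + _); apply: eq_bigr => u _.
  by rewrite /= mulr_algl.
have evM : {morph ev : f g / f * g}.
  by move=> f g; rewrite /ev rmorphM.
have evD : {morph ev : f g / f + g} by move=> f g; rewrite /ev raddfD.
have evker f : mmap (in_alg R) y f = 0 -> exists q, ev f = q * m.
  move=> /Qker[N [g [a [hg ->]]]].
  have /fin_all_exists[q Eq] := fun i => evQ _ (hg i).
  exists (\sum_i ev (a i) * q i); rewrite (big_morph ev evD (_ : ev 0 = 0)); last first.
    by rewrite /ev raddf0.
  rewrite mulr_suml; apply: eq_bigr => i _.
  by rewrite evM Eq mulrA.
have [c Ez] : exists c : 'I_n -> k, z = \sum_i c i *: y i.
  pose S1 a := exists c : 'I_n -> k, gr 1 a = \sum_i c i *: y i.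
  suff : S1 z by rewrite /S1 hz.
  have SZ c a : S1 a -> S1 (c *: a).
    move=> [d Ed]; exists (fun i => c * d i); rewrite hcompZ Ed scaler_sumr.
    by apply: eq_bigr => i _; rewrite scalerA.
  have SD a a' : S1 a -> S1 a' -> S1 (a + a').
    move=> [d Ed] [d' Ed']; exists (fun i => d i + d' i); rewrite raddfD /= Ed Ed'.
    by rewrite -big_split; apply: eq_bigr => i _; rewrite scalerDl.
  have S_0 a : gr 1 a = 0 -> S1 a.
    by move=> E; exists (fun _ => 0); rewrite E big1 // => i _; rewrite scale0r.
  have SM a a' : S1 a -> S1 a' -> S1 (a * a').
    move=> ha ha'; have E : gr 1 (a * a') = gr 1 (aug gr a *: a' + aug gr a' *: a).
      rewrite hcomp_mul1 -!aug_algE mulr_algl mulr_algr raddfD /= !hcompZ.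
      by [].
    by rewrite /S1 E; apply: SD; apply: SZ.
  have [f ->] := ygen z; rewrite /mmap.
  apply: (big_ind S1) => [|a a'|u _]; [by apply: S_0; rewrite raddf0|exact: SD|].
  rewrite /= mulr_algl; apply: SZ; rewrite /mmap1.
  have S_1 : S1 1 by apply: S_0; rewrite (in_deg_orth _ (in_deg1 gr)).
  apply: (big_ind S1) => [//|a a'|i _]; first exact: SM.
  elim: (u i) => [|d IH]; first by rewrite expr0.
  rewrite exprS; apply: SM => //.
  exists (fun j => (i == j)%:R); rewrite (ydeg i) (bigD1 i) //= eqxx scale1r.
  by rewrite big1 ?addr0 // => j; rewrite eq_sym => /negbTE ->; rewrite scale0r.
pose f : {mpoly k[n]} := \sum_i c i *: 'X_i.
have Ef : mmap (in_alg R) y f = z.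
  rewrite raddf_sum Ez; apply: eq_bigr => i _ /=.
  by rewrite mmapZ mmapX mmap1U /= mulr_algl.
have Eev : ev f = b z.
  rewrite /ev raddf_sum Ez bsum; apply: eq_bigr => i _ /=.
  by rewrite mmapZ mmapX mmap1U bZ mul_polyC.
have [|q Eq] := evker (f ^+ 3).
  rewrite rmorphXn /= Ef; apply: (hshort (i := 3)) => //.
  by rewrite !exprS expr0 mulr1; apply: (in_deg_mul hz (in_deg_mul hz hz)).
by exists q; rewrite -Eq -Eev /ev rmorphXn.
Qed.

(** In particular no linear functional of degree two is the square of a linear
functional of degree one: [R] has no point over [k]. *)
Lemma quadratic_no_point (b h : R -> k) :
  (forall u v, b (u + v) = b u + b v) -> (forall c u, b (c *: u) = c * b u) ->
  (forall u v, h (u + v) = h u + h v) -> (forall c u, h (c *: u) = c * h u) ->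
  (forall u v, in_deg gr 1 u -> in_deg gr 1 v -> h (u * v) = b u * b v) ->
  quadratic gr -> forall z, in_deg gr 1 z -> b z = 0.
Proof.
move=> bD bZ hD hZ hb hq z hz.
have [||||u v hu hv|q] := @quadratic_test (fun a => (b a)%:P) (fun a => (h a)%:P) 0 _ _ _ _ _ hq z hz.
- by move=> u v; rewrite bD polyCD.
- by move=> c u; rewrite bZ polyCM mul_polyC.
- by move=> u v; rewrite hD polyCD.
- by move=> c u; rewrite hZ polyCM mul_polyC.
- by exists 0; rewrite mulr0 addr0 hb // polyCM.
by rewrite mulr0 => /eqP; rewrite expf_eq0 polyC_eq0 => /eqP.
Qed.

End Quadratic.

(** * Pencils of ternary quadratic forms *)

Section Avoid.
Variable k : fieldType.

Lemma poly_roots_finite (p : {poly k}) : p != 0 ->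
  exists s : seq k, forall c, root p c -> c \in s.
Proof.
move: {2}(size p) (leqnn (size p)) => n; elim: n p => [|n IH] p hp p0.
  by move: p0; rewrite -size_poly_gt0; case: (size p) hp.
case: (classic (exists c, root p c)) => [[c hc]|h]; last first.
  by exists [::] => c hc; case: h; exists c.
have /factor_theorem[q Eq] := hc.
have q0 : q != 0 by apply: contraNneq p0 => q0; rewrite Eq q0 mul0r.
have [|//|s hs] := IH q.
  by move: hp; rewrite Eq size_Mmonic ?monicXsubC // size_XsubC addn2.
exists (c :: s) => d; rewrite Eq rootM root_XsubC inE orbC => /orP[->//|/hs ->].
by rewrite orbT.
Qed.

(** A point of the moment curve [(1, c, c ^+ 2, ...)] works. *)
Lemma avoid_hyperplanes n (s : seq 'cV[k]_n) : infinite_field k ->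
  (forall a, a \in s -> a != 0) ->
  exists v : 'rV[k]_n, forall a, a \in s -> (v *m a) 0 0 != 0.
Proof.
move=> hinf hs; pose P (a : 'cV[k]_n) : {poly k} := \sum_i a i 0 *: 'X^i.
have P0 a : a \in s -> P a != 0.
  move=> /hs; apply: contraNneq => h; apply/eqP.
  apply/colP => i; have := congr1 (fun p : {poly k} => p`_i) h.
  rewrite coef0 mxE coef_sum (bigD1 i) //= coefZ coefXn eqxx mulr1.
  rewrite big1 ?addr0 // => j ne.
  by rewrite coefZ coefXn (inj_eq val_inj) eq_sym (negbTE ne) mulr0.
have [|t ht] := @poly_roots_finite (\prod_(a <- s) P a).
  rewrite prodf_seq_neq0; apply/allP => a ha /=; exact: P0.
have [c hc] := hinf t; exists (\row_i c ^+ i) => a ha.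
apply: contra hc => h; apply: ht; rewrite /root horner_prod prodf_seq_eq0; apply/hasP; exists a => //=.
move: h; rewrite mxE horner_sum => /eqP h; apply/eqP; rewrite -[RHS]h.
by apply: eq_bigr => i _; rewrite mxE hornerZ hornerXn mulrC.
Qed.

End Avoid.

Section Pencil.
Variable k : fieldType.
Hypothesis hinf : infinite_field k.
Variable G : 'I_2 -> 'M[k]_3.
Hypothesis Gsym : forall h, (G h)^T = G h.
Hypothesis nosocle : forall v : 'rV_3, (forall h, v *m G h = 0) -> v = 0.

(** The member of the pencil with coordinates [g]. *)
Definition pencil (g : 'cV[k]_2) : 'M[k]_3 := \sum_h g h 0 *: G h.

Hypothesis norank1 : forall g c (b : 'rV_3), pencil g = c *: (b^T *m b) -> g = 0.

Lemma pencilD g g' : pencil (g + g') = pencil g + pencil g'.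
Proof. by rewrite -big_split; apply: eq_bigr => h _; rewrite mxE scalerDl. Qed.

Lemma pencilZ c g : pencil (c *: g) = c *: pencil g.
Proof. by rewrite scaler_sumr; apply: eq_bigr => h _; rewrite mxE scalerA. Qed.

Lemma pencil_sym g : (pencil g)^T = pencil g.
Proof.
by rewrite linear_sum; apply: eq_bigr => h _; rewrite linearZ /= Gsym.
Qed.

Lemma pencil_delta h : pencil (delta_mx h 0) = G h.
Proof.
rewrite /pencil (bigD1 h) //= mxE !eqxx scale1r big1 ?addr0 // => h' ne.
by rewrite mxE (negbTE ne) scale0r.
Qed.

Lemma sym_rank1 n (S : 'M[k]_n) : S^T = S -> (\rank S <= 1)%N ->
  exists c (b : 'rV_n), S = c *: (b^T *m b).
Proof.
move=> hS hr; case: (eqVneq S 0) => [->|S0].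
  by exists 0, 0; rewrite scale0r.
have [i hi] : exists i, row i S != 0.
  apply/existsP; rewrite -negb_forall; apply: contraNN S0 => /forallP h.
  by apply/eqP/row_matrixP => i; rewrite row0; apply/eqP.
set b := row i S in hi; have [j hj] : exists j, b 0 j != 0.
  apply/existsP; rewrite -negb_forall; apply: contraNN hi => /forallP h.
  by apply/eqP/rowP => j; rewrite [RHS]mxE; apply/eqP.
have hb : (b <= S)%MS by apply: row_sub.
have /submxP[u Eu] : (S <= b)%MS.
  by rewrite -(geq_leqif (mxrank_leqif_sup hb)) rank_rV hi.
have Su s t : S s t = u s 0 * b 0 t by rewrite {1}Eu mxE big_ord1.
exists (u j 0 / b 0 j), b; apply/matrixP => s t.
rewrite Su [RHS]mxE [X in _ = _ * X]mxE big_ord1 [b^T _ _]mxE mulrA.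
congr (_ * _); apply: (mulIf hj).
have h : S j s = S s j by have := congr1 (fun M : 'M_n => M s j) hS; rewrite mxE.
by rewrite -Su -h Su mulrAC divfK.
Qed.

(** Otherwise the member would have rank one, and be a multiple of a square. *)
Lemma pencil_kernel g (v v' : 'rV_3) : g != 0 -> v != 0 ->
  v *m pencil g = 0 -> v' *m pencil g = 0 -> exists c, v' = c *: v.
Proof.
move=> g0 v0 hv hv'; case: (boolP (v' <= v)%MS) => [/sub_rVP[c ->]|hn].
  by exists c.
have hr : (1 < \rank (col_mx v v'))%N.
  rewrite ltnNge; apply: contra hn => hr.
  have h1 : (v <= col_mx v v')%MS by rewrite -addsmxE addsmxSl.
  have : (col_mx v v' <= v)%MS.
    by rewrite -(geq_leqif (mxrank_leqif_sup h1)) rank_rV v0.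
  by apply: submx_trans; rewrite -addsmxE addsmxSr.
have hz : col_mx v v' *m pencil g = 0 by rewrite mul_col_mx hv hv' col_mx0.
have [||c [b E]] := @sym_rank1 _ (pencil g); first exact: pencil_sym.
  by have := mulmx0_rank_max hz; lia.
by move: g0; rewrite (norank1 E) eqxx.
Qed.

Lemma ord2_cases (h : 'I_2) : h = 0 \/ h = 1.
Proof. by case: h => [[|[|//]] hh]; [left|right]; apply/val_inj. Qed.

Definition good (l : 'rV[k]_3) := forall g, l *m pencil g = 0 -> g = 0.

Lemma form_sym h (u v : 'rV[k]_3) :
  (u *m G h *m v^T) 0 0 = (v *m G h *m u^T) 0 0.
Proof.
have -> : u *m G h *m v^T = (v *m G h *m u^T)^T.
  by rewrite !trmx_mul trmxK Gsym mulmxA.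
by rewrite mxE.
Qed.

(** These are two linear conditions on a vector with three entries. *)
Lemma pencil_col (l : 'rV[k]_3) : exists2 v : 'rV[k]_3, v != 0 &
  forall h, l *m G h *m v^T = 0.
Proof.
pose A := row_mx (l *m G 0)^T (l *m G 1)^T.
have [v hv v0] : exists2 v : 'rV_3, v *m A = 0 & v != 0.
  have : kermx A != 0.
    rewrite -mxrank_eq0 mxrank_ker -lt0n subn_gt0.
    by apply: leq_ltn_trans (rank_leq_col A) _.
  case/rowV0Pn => v /sub_kermxP hv v0; by exists v.
exists v => // h; apply: trmx_inj; rewrite trmx0 trmx_mul trmxK.
move: hv; rewrite mul_mx_row -row_mx0 => /eq_row_mx[h0 h1].
by case: (ord2_cases h) => ->.
Qed.

Lemma pencilE g : pencil g = g 0 0 *: G 0 + g 1 0 *: G 1.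
Proof.
rewrite /pencil big_ord_recl big_ord1; congr (_ + g _ 0 *: G _); exact/val_inj.
Qed.

Lemma good_of_pairing (l u v : 'rV[k]_3) :
  (l *m G 0 *m u^T) 0 0 = 0 -> (l *m G 1 *m u^T) 0 0 != 0 ->
  (l *m G 0 *m v^T) 0 0 != 0 -> (l *m G 1 *m v^T) 0 0 = 0 -> good l.
Proof.
move=> h1 h2 h3 h4 g; rewrite pencilE mulmxDr -!scalemxAr => h.
have E (w : 'rV[k]_3) : g 0 0 * (l *m G 0 *m w^T) 0 0 + g 1 0 * (l *m G 1 *m w^T) 0 0 = 0.
  have := congr1 (fun M => (M *m w^T) 0 0) h.
  by rewrite mulmxDl -!scalemxAl mul0mx !mxE.
have := E u; rewrite h1 mulr0 add0r => /eqP; rewrite mulf_eq0 (negbTE h2) orbF => /eqP g1.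
have := E v; rewrite h4 mulr0 addr0 => /eqP; rewrite mulf_eq0 (negbTE h3) orbF => /eqP g0.
by apply/colP => i; rewrite mxE; case: (ord2_cases i) => ->.
Qed.

(** If all members are singular, the kernels [u] and [v] of two of them are
isotropic for the whole pencil, and every vector outside their span is good. *)
Lemma good_pair_singular : (forall g, exists2 v : 'rV_3, v != 0 & v *m pencil g = 0) ->
  exists l l', [/\ good l, good l' & forall h, l *m G h *m l'^T = 0].
Proof.
move=> sing.
have [u u0 hu] := sing (delta_mx 0 0); rewrite pencil_delta in hu.
have [v v0 hv] := sing (delta_mx 1 0); rewrite pencil_delta in hv.
have d0 : (delta_mx 0 0 : 'cV[k]_2) != 0.
  by apply/eqP => /matrixP/(_ 0 0); rewrite !mxE !eqxx => /eqP; rewrite oner_eq0.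
have d1 : (delta_mx 1 0 : 'cV[k]_2) != 0.
  by apply/eqP => /matrixP/(_ 1 0); rewrite !mxE !eqxx => /eqP; rewrite oner_eq0.
have kerG0 w : w *m G 0 = 0 -> exists c, w = c *: u.
  by move=> hw; apply: (@pencil_kernel (delta_mx 0 0)); rewrite ?pencil_delta.
have kerG1 w : w *m G 1 = 0 -> exists c, w = c *: v.
  by move=> hw; apply: (@pencil_kernel (delta_mx 1 0)); rewrite ?pencil_delta.
have uv a b : a *: u + b *: v = 0 -> a = 0 /\ b = 0.
  move=> h; have ker2 : (a *: u) *m G 1 = 0.
    move/eqP: h; rewrite addr_eq0 => /eqP ->.
    by rewrite mulNmx -scalemxAl hv scaler0 oppr0.
  have au : a *: u = 0.
    apply: nosocle => i; case: (ord2_cases i) => -> //.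
    by rewrite -scalemxAl hu scaler0.
  have a0 : a = 0 by move/eqP: au; rewrite scaler_eq0 (negbTE u0) orbF => /eqP.
  split=> //; move: h; rewrite au add0r => /eqP.
  by rewrite scaler_eq0 (negbTE v0) orbF => /eqP.
have [z hz] : exists z : 'rV[k]_3, forall w, exists a b c, w = a *: u + b *: v + c *: z.
  pose A := col_mx u v : 'M_(1 + 1, 3).
  have rA : \rank A = 2%N.
    apply/eqP; rewrite -/(row_free A) -kermx_eq0; apply/rowV0P => w /sub_kermxP.
    rewrite -[w]hsubmxK mul_row_col [lsubmx w]mx11_scalar [rsubmx w]mx11_scalar.
    rewrite !mul_scalar_mx => /uv[-> ->].
    by rewrite raddf0 row_mx0.
  have rC : \rank (A^C)%MS = 1%N by rewrite mxrank_compl rA.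
  have [z Ez] : exists z : 'rV_3, (z :=: A^C)%MS.
    by move: (row_base A^C)%MS (eq_row_base A^C)%MS; rewrite rC => z Ez; exists z.
  exists z => w; have : (w <= A + z)%MS.
    apply: submx_full; rewrite -sub1mx (adds_eqmx (eqmx_refl A) Ez) sub1mx.
    exact: addsmx_compl_full.
  case/sub_addsmxP => -[w1 w2] /= ->; exists (lsubmx w1 0 0), (rsubmx w1 0 0), (w2 0 0).
  rewrite -{1}[w1]hsubmxK /A mul_row_col [w2 in LHS]mx11_scalar.
  rewrite [lsubmx w1 in LHS]mx11_scalar [rsubmx w1 in LHS]mx11_scalar.
  by rewrite !mul_scalar_mx.
pose B h (s t : 'rV[k]_3) := (s *m G h *m t^T) 0 0.
have BDl h s s' t : B h (s + s') t = B h s t + B h s' t.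
  by rewrite /B !mulmxDl mxE.
have BZl h c s t : B h (c *: s) t = c * B h s t.
  by rewrite /B -!scalemxAl mxE.
have BC h s t : B h s t = B h t s by exact: form_sym.
have BDr h s t t' : B h s (t + t') = B h s t + B h s t'.
  by rewrite BC BDl !(BC h s).
have BZr h c s t : B h s (c *: t) = c * B h s t by rewrite BC BZl BC.
have B0u t : B 0 u t = 0 by rewrite /B hu mul0mx mxE.
have B1v t : B 1 v t = 0 by rewrite /B hv mul0mx mxE.
have B0u' t : B 0 t u = 0 by rewrite BC.
have B1v' t : B 1 t v = 0 by rewrite BC.
have Bker h w : B h w u = 0 -> B h w v = 0 -> B h w z = 0 -> w *m G h = 0.
  move=> h1 h2 h3; apply/rowP => i; rewrite [RHS]mxE.
  have [a [b [c E]]] := hz (delta_mx 0 i).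
  have -> : (w *m G h) 0 i = B h w (delta_mx 0 i).
    by rewrite /B trmx_delta -colE [RHS]mxE.
  by rewrite E !BDr !BZr h1 h2 h3 !mulr0 !addr0.
pose a := B 0 v v; pose b := B 0 v z; pose c := B 0 z z.
pose d := B 1 u u; pose f := B 1 u z; pose g := B 1 z z.
have uvz0 s t w : s *: u + t *: v + w *: z = 0 -> w = 0 -> s = 0 /\ t = 0.
  by move=> h w0; apply: uv; move: h; rewrite w0 scale0r addr0.
have zspan s t : z = s *: u + t *: v -> False.
  move=> Ez; suff : (3 <= \rank (col_mx u v))%N by have := rank_leq_row (col_mx u v); lia.
  have : row_full (col_mx u v).
    rewrite -sub1mx; apply/row_subP => i; have [a1 [b1 [c1 ->]]] := hz (row i 1%:M).
    rewrite Ez; have hu' : (u <= col_mx u v)%MS by rewrite -addsmxE addsmxSl.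
    have hv' : (v <= col_mx u v)%MS by rewrite -addsmxE addsmxSr.
    by rewrite !addmx_sub ?scalemx_sub // addmx_sub ?scalemx_sub.
  by move=> /eqP ->.
have uvz s t w : s *: u + t *: v + w *: z = 0 -> [/\ s = 0, t = 0 & w = 0].
  move=> h; case: (eqVneq w 0) => [w0|w0].
    by have [-> ->] := uvz0 _ _ _ h w0.
  exfalso; apply: (zspan (- (w^-1 * s)) (- (w^-1 * t))).
  move/eqP: h; rewrite addrC addr_eq0 => /eqP h.
  apply: (@scalerI _ _ w) => //; rewrite h scalerDr !scalerA !mulrN !mulrA.
  by rewrite divff // !mul1r opprD !scaleNr.
(* The restriction of the first form to the span of [v] and [z], and of the
second one to the span of [u] and [z], is non-degenerate. *)
have nd0 s t : s * a + t * b = 0 -> s * b + t * c = 0 -> s = 0 /\ t = 0.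
  move=> h1 h2; have [|w Ew] := kerG0 (s *: v + t *: z).
    by apply: Bker; rewrite !BDl !BZl ?B0u' ?mulr0 ?addr0 // (BC 0 z v).
  have [|_ -> ->] // := uvz (- w) s t.
  by rewrite -addrA Ew -scalerDl addNr scale0r.
have nd1 s t : s * d + t * f = 0 -> s * f + t * g = 0 -> s = 0 /\ t = 0.
  move=> h1 h2; have [|w Ew] := kerG1 (s *: u + t *: z).
    by apply: Bker; rewrite !BDl !BZl ?B1v' ?mulr0 ?addr0 // (BC 1 z u).
  have [|-> _ ->] // := uvz s (- w) t.
  by rewrite addrAC Ew -scalerDl subrr scale0r.
have D0 : a * c - b ^+ 2 != 0.
  apply/eqP => h; have e2 : b * b + - a * c = 0.
    by transitivity (- (a * c - b ^+ 2)); [ring|rewrite h oppr0].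
  have [|//|hb ha] := nd0 b (- a); first by ring.
  move/eqP: ha; rewrite oppr_eq0 => /eqP ha.
  have [||h1 _] := nd0 1 0; rewrite ?ha ?hb; [by ring|by ring|].
  by move/eqP: h1; rewrite oner_eq0.
have D1 : d * g - f ^+ 2 != 0.
  apply/eqP => h; have e2 : f * f + - d * g = 0.
    by transitivity (- (d * g - f ^+ 2)); [ring|rewrite h oppr0].
  have [|//|hf hd] := nd1 f (- d); first by ring.
  move/eqP: hd; rewrite oppr_eq0 => /eqP hd.
  have [||h1 _] := nd1 1 0; rewrite ?hd ?hf; [by ring|by ring|].
  by move/eqP: h1; rewrite oner_eq0.
(* The vanishing of the determinant of [G 0 + t *: G 1]. *)
have key t : t != 0 -> a * (d * (a * c - b ^+ 2) + t * (a * (d * g - f ^+ 2))) * d = 0 /\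
    (a = 0 -> d = 0) /\ (d = 0 -> a = 0).
  move=> t0; have [w w0 hw] := sing (delta_mx 0 0 + t *: delta_mx 1 0).
  rewrite pencilD pencilZ !pencil_delta mulmxDr -scalemxAr in hw.
  have E (s : 'rV[k]_3) : B 0 w s + t * B 1 w s = 0.
    transitivity (((w *m G 0 + t *: (w *m G 1)) *m s^T) 0 0).
      by rewrite mulmxDl -scalemxAl [RHS]mxE [X in _ = _ + X]mxE.
    by rewrite hw mul0mx mxE.
  have [x1 [x2 [x3 Ew]]] := hz w.
  have e1 : x1 * d + x3 * f = 0.
    have := E u; rewrite Ew !BDl !BZl !B0u' B1v (BC 1 z u) !mulr0 !addr0 !add0r.
    by move/eqP; rewrite mulf_eq0 (negbTE t0) => /eqP.
  have e2 : x2 * a + x3 * b = 0.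
    have := E v; rewrite Ew !BDl !BZl !B1v' B0u (BC 0 z v).
    by rewrite !mulr0 !addr0 add0r mulr0 addr0.
  have e3 : t * x1 * f + x2 * b + x3 * (c + t * g) = 0.
    have := E z; rewrite Ew !BDl !BZl B0u B1v -/b -/c -/f -/g => <-.
    by ring.
  have nz : ~ [/\ x1 = 0, x2 = 0 & x3 = 0].
    case=> h1 h2 h3; move: w0; rewrite Ew h1 h2 h3 !scale0r !addr0 eqxx.
    by [].
  split; last split.
  - pose K := d * (a * c - b ^+ 2) + t * (a * (d * g - f ^+ 2)).
    have h3 : K * x3 = 0.
      have -> : K * x3 = a * d * (t * x1 * f + x2 * b + x3 * (c + t * g))
          - t * f * a * (x1 * d + x3 * f) - d * b * (x2 * a + x3 * b) by rewrite /K; ring.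
      by rewrite e1 e2 e3 !mulr0 !subr0.
    rewrite -/K; case: (eqVneq K 0) => [->|K0]; first by rewrite mulr0 mul0r.
    move/eqP: h3; rewrite mulf_eq0 (negbTE K0) /= => /eqP x30.
    case: (eqVneq a 0) => [->|a0]; first by rewrite !mul0r.
    case: (eqVneq d 0) => [->|dn0]; first by rewrite mulr0.
    case: nz; split=> //.
      by move/eqP: e1; rewrite x30 mul0r addr0 mulf_eq0 (negbTE dn0) orbF => /eqP.
    by move/eqP: e2; rewrite x30 mul0r addr0 mulf_eq0 (negbTE a0) orbF => /eqP.
  - move=> a0; apply/eqP/negPn/negP => dn0; apply: nz.
    have b0 : b != 0 by move: D0; rewrite a0 mul0r sub0r oppr_eq0 expf_eq0.
    have x30 : x3 = 0.
      by move/eqP: e2; rewrite a0 mulr0 add0r mulf_eq0 (negbTE b0) orbF => /eqP.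
    have x10 : x1 = 0.
      by move/eqP: e1; rewrite x30 mul0r addr0 mulf_eq0 (negbTE dn0) orbF => /eqP.
    split=> //; move/eqP: e3; rewrite x30 x10 mulr0 !mul0r add0r addr0.
    by rewrite mulf_eq0 (negbTE b0) orbF => /eqP.
  move=> dd0; apply/eqP/negPn/negP => a0; apply: nz.
  have f0 : f != 0 by move: D1; rewrite dd0 mul0r sub0r oppr_eq0 expf_eq0.
  have x30 : x3 = 0.
    by move/eqP: e1; rewrite dd0 mulr0 add0r mulf_eq0 (negbTE f0) orbF => /eqP.
  have x20 : x2 = 0.
    by move/eqP: e2; rewrite x30 mul0r addr0 mulf_eq0 (negbTE a0) orbF => /eqP.
  split=> //; move/eqP: e3; rewrite x30 x20 !mul0r !addr0.
  by rewrite !mulf_eq0 (negbTE t0) (negbTE f0) orbF => /eqP.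
have [t1 ht1] := hinf [:: 0]; have [t2 ht2] := hinf [:: 0; t1].
rewrite inE in ht1; move: ht2; rewrite !inE negb_or => /andP[t20 t21].
have [k1 [ad da]] := key t1 ht1; have [k2 _] := key t2 t20.
have a0 : a = 0.
  apply/eqP/negPn/negP => a0; have dn0 : d != 0.
    by apply: contraNneq a0 => /da ->.
  have S t : a * (d * (a * c - b ^+ 2) + t * (a * (d * g - f ^+ 2))) * d = 0 ->
      d * (a * c - b ^+ 2) + t * (a * (d * g - f ^+ 2)) = 0.
    by move/eqP; rewrite !mulf_eq0 (negbTE a0) (negbTE dn0) orbF => /eqP.
  have : (t2 - t1) * (a * (d * g - f ^+ 2)) = 0.
    by rewrite mulrBl -(subrr 0) -{1}(S _ k2) -(S _ k1); ring.
  move/eqP; rewrite !mulf_eq0 subr_eq0 (negbTE t21) (negbTE a0) /=.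
  by rewrite (negbTE D1).
have dz := ad a0.
have b0 : b != 0 by move: D0; rewrite a0 mul0r sub0r oppr_eq0 expf_eq0.
have f0 : f != 0 by move: D1; rewrite dz mul0r sub0r oppr_eq0 expf_eq0.
pose l' := z - (g / f) *: u - (c / b) *: v.
have El' h s : B h s l' = B h s z - (g / f) * B h s u - (c / b) * B h s v.
  by rewrite /l' -!scaleNr !BDr !BZr !mulNr.
exists z, l'; split.
- apply: (@good_of_pairing z u v); rewrite -/(B _ _ _).
  + exact: B0u'.
  + by rewrite (BC 1 z u).
  + by rewrite (BC 0 z v).
  + exact: B1v'.
- apply: (@good_of_pairing l' u v); rewrite -/(B _ _ _) BC El'.
  + by rewrite !B0u !mulr0 !subr0.
  + by rewrite -/d dz B1v' -/f !mulr0 !subr0.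
  + by rewrite -/a a0 B0u' -/b !mulr0 !subr0.
  + by rewrite !B1v !mulr0 !subr0.
move=> h; apply/matrixP => i j; rewrite !ord1 [RHS]mxE -/(B h z l') El'.
case: (ord2_cases h) => ->.
  by rewrite B0u' (BC 0 z v) -/c -/b mulr0 subr0 divfK // subrr.
by rewrite B1v' (BC 1 z u) -/g -/f mulr0 subr0 divfK // subrr.
Qed.

Lemma orth_line (v : 'rV[k]_3) : exists2 a : 'cV[k]_3, a != 0 & v *m a = 0.
Proof.
have : kermx v^T != 0.
  rewrite -mxrank_eq0 mxrank_ker -lt0n subn_gt0.
  by apply: leq_ltn_trans (rank_leq_col v^T) _.
case/rowV0Pn => w /sub_kermxP hw w0; exists w^T.
  by rewrite -(inj_eq trmx_inj) trmxK trmx0.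
by apply: trmx_inj; rewrite trmx_mul trmxK hw trmx0.
Qed.

(** If some member is non-singular, only finitely many others are singular, and
a generic [l] is good together with the form [l'] that it kills: [l'] would
otherwise lie on one of finitely many lines, and then [l] on one of finitely
many planes. *)
Lemma good_pair_regular g0 : (forall v : 'rV_3, v *m pencil g0 = 0 -> v = 0) ->
  exists l l', [/\ good l, good l' & forall h, l *m G h *m l'^T = 0].
Proof.
move=> inj; pose U := pencil g0.
have Uu : U \in unitmx.
  rewrite -row_free_unit -kermx_eq0; apply/rowV0P => v /sub_kermxP; exact: inj.
have [g1 hspan g1n] : exists2 g1, forall g, exists a b, g = a *: g0 + b *: g1 &
    forall t, g1 + t *: g0 != 0.
  case: (eqVneq (g0 0 0) 0) => e0.
    have e1 : g0 1 0 != 0.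
      apply/eqP => e1; have : pencil g0 = 0.
        by rewrite pencilE e0 e1 !scale0r addr0.
      move=> p0; have := inj (delta_mx 0 0); rewrite p0 mulmx0 => /(_ erefl).
      by move=> /matrixP/(_ 0 0); rewrite !mxE => /eqP; rewrite oner_eq0.
    exists (delta_mx 0 0).
      move=> g; exists (g 1 0 / g0 1 0), (g 0 0); apply/colP => i.
      case: (ord2_cases i) => ->; rewrite !mxE /=.
        by rewrite e0 mulr0 add0r mulr1.
      by rewrite mulr0 addr0 divfK.
    move=> t; apply/eqP => /colP/(_ 0); rewrite !mxE e0 mulr0 addr0 /= => /eqP.
    by rewrite oner_eq0.
  exists (delta_mx 1 0).
    move=> g; exists (g 0 0 / g0 0 0), (g 1 0 - g 0 0 / g0 0 0 * g0 1 0).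
    apply/colP => i; case: (ord2_cases i) => ->; rewrite !mxE /=.
      by rewrite mulr0 addr0 divfK.
    by rewrite mulr1 addrC subrK.
  move=> t; apply/eqP => /colP h.
  have /eqP := h 0; rewrite !mxE add0r mulf_eq0 (negbTE e0) orbF => /eqP t0.
  by have /eqP := h 1; rewrite !mxE t0 mul0r addr0 oner_eq0.
have [rs hrs] := poly_roots_finite (monic_neq0 (char_poly_monic (pencil g1 *m invmx U))).
have sing t (v : 'rV[k]_3) : v != 0 -> v *m pencil (g1 + t *: g0) = 0 -> - t \in rs.
  move=> v0 hv; apply: hrs; rewrite -eigenvalue_root_char; apply/eigenvalueP.
  exists v => //; move: hv; rewrite pencilD pencilZ mulmxDr -scalemxAr => /eqP.
  rewrite addr_eq0 => /eqP hv; rewrite mulmxA hv mulNmx -scalemxAl.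
  by rewrite mulmxK // scaleNr.
have planes t : exists ab : 'cV[k]_3 * 'cV[k]_3, [/\ ab.1 != 0, ab.2 != 0 &
    forall v : 'rV_3, v != 0 -> v *m pencil (g1 + t *: g0) = 0 ->
    v *m ab.2 = 0 /\ exists2 c, c != 0 & U *m v^T = c *: ab.1].
  case: (classic (exists2 v : 'rV_3, v != 0 & v *m pencil (g1 + t *: g0) = 0)).
    move=> [v v0 hv]; have [a a0 va] := orth_line v.
    exists (U *m v^T, a); split=> //=.
      apply: contraNneq v0 => h; apply/eqP/inj; apply: trmx_inj.
      by rewrite trmx_mul pencil_sym h trmx0.
    move=> w w0 hw; have [c Ec] := pencil_kernel (g1n t) v0 hv hw.
    rewrite Ec -scalemxAl va scaler0; split=> //; exists c.
      by apply: contraNneq w0 => c0; rewrite Ec c0 scale0r.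
    by rewrite linearZ /= -scalemxAr.
  move=> hn; have d0 : (delta_mx 0 0 : 'cV[k]_3) != 0.
    by apply/eqP => /matrixP/(_ 0 0); rewrite !mxE => /eqP; rewrite oner_eq0.
  exists (delta_mx 0 0, delta_mx 0 0); split=> // v v0 hv.
  by case: hn; exists v.
pose ab t := sval (constructive_indefinite_description _ (planes t)).
have habP t : [/\ (ab t).1 != 0, (ab t).2 != 0 &
    forall v : 'rV_3, v != 0 -> v *m pencil (g1 + t *: g0) = 0 ->
    v *m (ab t).2 = 0 /\ exists2 c, c != 0 & U *m v^T = c *: (ab t).1].
  by rewrite /ab; case: constructive_indefinite_description.
pose s := delta_mx 0 0 :: [seq (ab (- t)).1 | t <- rs] ++ [seq (ab (- t)).2 | t <- rs].
have [|l hl] := @avoid_hyperplanes _ _ s hinf.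
  move=> a; rewrite inE mem_cat => /or3P[/eqP ->|/mapP[t _ ->]|/mapP[t _ ->]].
  - by apply/eqP => /matrixP/(_ 0 0); rewrite !mxE => /eqP; rewrite oner_eq0.
  - by have [] := habP (- t).
  - by have [] := habP (- t).
have l0 : l != 0.
  have := hl (delta_mx 0 0); rewrite inE eqxx => /(_ isT).
  by apply: contraNneq => ->; rewrite mul0mx mxE.
have hl1 t : - t \in rs -> (l *m (ab t).1) 0 0 != 0.
  move=> ht; apply: hl; rewrite inE mem_cat; apply/or3P; apply: Or32.
  by apply/mapP; exists (- t); rewrite ?opprK.
have hl2 t : - t \in rs -> (l *m (ab t).2) 0 0 != 0.
  move=> ht; apply: hl; rewrite inE mem_cat; apply/or3P; apply: Or33.
  by apply/mapP; exists (- t); rewrite ?opprK.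
have [l' l'0 hll'] := pencil_col l.
have bad (v : 'rV[k]_3) : v != 0 ->
    (forall t, v *m pencil (g1 + t *: g0) <> 0) -> good v.
  move=> v0 hv g hg; have [a [b Eg]] := hspan g.
  move: hg; rewrite Eg pencilD !pencilZ mulmxDr -!scalemxAr => hg.
  case: (eqVneq b 0) => b0.
    move: hg; rewrite b0 !scale0r !addr0 => /eqP; rewrite scaler_eq0 => /orP[/eqP ->|].
      by rewrite scale0r.
    by move/eqP/inj => vz; rewrite vz eqxx in v0.
  case: (hv (b^-1 * a)); rewrite pencilD pencilZ mulmxDr -scalemxAr.
  apply: (@scalerI _ _ b) => //; rewrite scaler0 scalerDr scalerA mulrA divff //.
  by rewrite mul1r addrC.
exists l, l'; split=> //.
  apply: bad => // t ht; have /negP := hl2 t (sing t l l0 ht); apply.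
  have [_ _ /(_ l l0 ht)[-> _]] := habP t.
  by rewrite mxE.
apply: bad => // t ht; have /negP := hl1 t (sing t l' l'0 ht); apply.
have [_ _ /(_ l' l'0 ht)[_ [c c0 Ec]]] := habP t.
have : l *m U *m l'^T = 0.
  rewrite /U pencilE mulmxDr mulmxDl -!scalemxAr -!scalemxAl !hll'.
  by rewrite !scaler0 addr0.
rewrite -mulmxA Ec -scalemxAr => /eqP; rewrite scaler_eq0 (negbTE c0) /= => /eqP ->.
by rewrite mxE.
Qed.

(** A pair of good forms that kill each other is the algebraic content of an exact
pair: being good means that the products with all forms span degree two. *)
Theorem pencil_good_pair :
  exists l l', [/\ good l, good l' & forall h, l *m G h *m l'^T = 0].
Proof.
case: (classic (exists g0, forall v : 'rV_3, v *m pencil g0 = 0 -> v = 0)).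
  by case=> g0; apply: good_pair_regular.
move=> /not_ex_all_not h; apply: good_pair_singular => g.
have /not_all_ex_not[v hv] := h g; exists v.
  by apply/eqP => v0; apply: hv.
by apply: NNPP => hn; apply: hv.
Qed.

End Pencil.

(** * Short quadratic algebras *)

Section Socle.
Variables (k : fieldType) (R : comAlgType k) (gr : std_graded R).
Hypothesis hshort : short gr.
Hypothesis hquad : quadratic gr.

Lemma gcoord_deg2 r (y : 'I_r -> R) (hy : kbasis (in_deg gr 2) y) (g : 'cV[k]_r) :
  (forall u v, in_deg gr 1 u -> in_deg gr 1 v -> gcoord hy (u * v) *m g = 0) ->
  forall e (x : 'I_e -> R), kbasis (in_deg gr 1) x -> g = 0.
Proof.
move=> h e x hx; apply/colP => i; rewrite [RHS]mxE.
have yi : in_deg gr 2 (y i) by case: (hy).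
have [c Ec] := deg2_span hshort hx yi.
have E : gcoord hy (y i) = delta_mx 0 i.
  rewrite -[RHS](gcoord_basis hy); congr gcoord; rewrite (bigD1 i) //= mxE !eqxx scale1r.
  by rewrite big1 ?addr0 // => j ne; rewrite mxE (negbTE ne) andbF scale0r.
have : gcoord hy (y i) *m g = 0.
  rewrite Ec gcoord_sum mulmx_suml big1 // => a _.
  rewrite gcoord_sum mulmx_suml big1 // => b _.
  rewrite gcoordZ -scalemxAl h ?scaler0 //; exact: (basis_deg1 hx).
by rewrite E -rowE => /rowP/(_ 0); rewrite !mxE.
Qed.

Section Complement.
Variables (e : nat) (x : 'I_e -> R) (hx : kbasis (in_deg gr 1%N) x).

(** Coordinates on the quotient of the forms of degree one by a line [v] that
they kill: products only depend on them. *)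
Lemma socle_coords (v : R) : in_deg gr 1 v -> v != 0 ->
  (forall b, in_deg gr 1 b -> v * b = 0) ->
  exists tau : R -> 'rV[k]_(e - 1), exists b : 'I_(e - 1) -> R,
    [/\ forall u w, tau (u + w) = tau u + tau w,
        forall c u, tau (c *: u) = c *: tau u,
        forall i, in_deg gr 1 (b i),
        forall i, tau (b i) = delta_mx 0 i &
        forall u w, in_deg gr 1 u -> in_deg gr 1 w ->
          u * w = \sum_i \sum_j (tau u 0 i * tau w 0 j) *: (b i * b j)].
Proof.
move=> hv v0 hsoc; have c0 : coord1 hx v != 0.
  by apply: contraNneq v0 => h; apply/eqP; apply: (coord1_eq0 (hx := hx)).
have [B [N [vN BN hdec]]] := line_complement c0.
pose lin (c : 'rV[k]_e) := \sum_i c 0 i *: x i.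
have linD c c' : lin (c + c') = lin c + lin c'.
  by rewrite -big_split; apply: eq_bigr => i _; rewrite mxE scalerDl.
have linZ a c : lin (a *: c) = a *: lin c.
  by rewrite scaler_sumr; apply: eq_bigr => i _; rewrite mxE scalerA.
have lin0 : lin 0 = 0 by rewrite -(scale0r 0) linZ scale0r.
have lindeg c : in_deg gr 1 (lin c).
  by apply: in_deg_sum => i _; apply/in_deg_scale/(basis_deg1 hx).
pose tau u := coord1 hx u *m N; pose b i := lin (row i B).
have dec u : in_deg gr 1 u -> exists d, u = d *: v + \sum_i tau u 0 i *: b i.
  move=> hu; have [d Ed] := hdec _ (coord1 hx u); exists (d 0 0).
  rewrite {1}(coord1_deg1 hx hu) -/(lin _) {1}Ed linD; congr (_ + _).
    by rewrite [d]mx11_scalar mul_scalar_mx linZ /lin -(coord1_deg1 hx hv) mxE eqxx.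
  rewrite mulmx_sum_row (big_morph lin linD lin0).
  by apply: eq_bigr => i _; rewrite linZ.
exists tau, b; split=> [u w|c u|i|i|u w hu hw].
- by rewrite /tau coord1D mulmxDl.
- by rewrite /tau coord1Z scalemxAl.
- exact: lindeg.
- by rewrite /tau /b coord1_basis -row_mul BN row1.
have [d Eu] := dec u hu; have [d' Ew] := dec w hw.
have hb i : in_deg gr 1 (b i) by exact: lindeg.
rewrite {1}Eu mulrDl -scalerAl hsoc // scaler0 add0r mulr_suml.
apply: eq_bigr => i _; rewrite {1}Ew mulrDr -scalerAl -scalerAr.
rewrite [b i * v]mulrC hsoc // !scaler0 add0r mulr_sumr.
by apply: eq_bigr => j _; rewrite -scalerAl -scalerAr scalerA.
Qed.

End Complement.

(** If all forms of degree one killed [v], then, modulo [v], the algebra would have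
one generator, whose square spans degree two: no quadratic relation would be
left to kill its cube. *)
Lemma quadratic_nosocle2 (x : 'I_2 -> R) (hx : kbasis (in_deg gr 1%N) x)
    (y : 'I_1 -> R) (hy : kbasis (in_deg gr 2) y) v : in_deg gr 1 v ->
  (forall b, in_deg gr 1 b -> v * b = 0) -> v = 0.
Proof.
move=> hv hsoc; apply/eqP/negPn/negP => v0.
have [tau [b [tauD tauZ bdeg taub tauM]]] := socle_coords hx hv v0 hsoc.
pose p := gcoord hy (b 0 * b 0) 0 0.
have p0 : p != 0.
  apply/eqP => p0; have : (1%:M : 'cV[k]_1) = 0.
    apply: (@gcoord_deg2 _ _ hy _ _ _ _ hx) => u w hu hw.
    rewrite tauM // !big_ord1 gcoordZ -scalemxAl mulmx1.
    have -> : gcoord hy (b ord0 * b ord0) = 0.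
      by apply/rowP => i; rewrite !ord1 mxE.
    by rewrite scaler0.
  by move/matrixP/(_ 0 0); rewrite !mxE => /eqP; rewrite oner_eq0.
have := @quadratic_no_point _ _ _ hshort (fun u => tau u 0 0)
  (fun u => gcoord hy u 0 0 / p) _ _ _ _ _ hquad (b 0) (bdeg 0).
rewrite taub mxE !eqxx => h; have /eqP : 1 = 0 :> k; last by rewrite oner_eq0.
apply: h => [u w|c u|u w|c u|u w hu hw].
- by rewrite tauD mxE.
- by rewrite tauZ mxE.
- by rewrite gcoordD mxE mulrDl.
- by rewrite gcoordZ mxE mulrA.
rewrite tauM // !big_ord1 gcoordZ mxE -/p -mulrA.
by rewrite divff // mulr1.
Qed.

(** If all forms killed [v], the algebra modulo [v] would have two generators [b 0],
[b 1], whose three products span a space of dimension two. Either a functional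
kills the two that involve [b 1], and the algebra has a point, or [b 0 * b 0] is a
combination of these two, and [b 0 |-> 'X], [b 1 |-> 1] defines a homomorphism
modulo a quadratic polynomial [m], where the cube of [1] does not vanish. *)
Lemma quadratic_nosocle3 (x : 'I_3 -> R) (hx : kbasis (in_deg gr 1%N) x)
    (y : 'I_2 -> R) (hy : kbasis (in_deg gr 2) y) v : in_deg gr 1 v ->
  (forall b, in_deg gr 1 b -> v * b = 0) -> v = 0.
Proof.
move=> hv hsoc; apply/eqP/negPn/negP => v0.
have [tau [b [tauD tauZ bdeg taub tauM]]] := socle_coords hx hv v0 hsoc.
pose i0 : 'I_2 := 0; pose i1 : 'I_2 := 1.
pose t0 u := tau u 0 i0; pose t1 u := tau u 0 i1.
pose P := gcoord hy (b i0 * b i0); pose Q := gcoord hy (b i0 * b i1).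
pose S := gcoord hy (b i1 * b i1).
have prodE u w : in_deg gr 1 u -> in_deg gr 1 w -> gcoord hy (u * w) =
    (t0 u * t0 w) *: P + (t0 u * t1 w + t1 u * t0 w) *: Q + (t1 u * t1 w) *: S.
  move=> hu hw; rewrite tauM // !big_ord_recl !big_ord0 !addr0.
  have -> : lift ord0 ord0 = i1 by apply/val_inj.
  have -> : ord0 = i0 by apply/val_inj.
  rewrite !gcoordD !gcoordZ [b i1 * b i0]mulrC -/P -/Q -/S scalerDl.
  by rewrite !addrA.
have t0D u w : t0 (u + w) = t0 u + t0 w by rewrite /t0 tauD mxE.
have t1D u w : t1 (u + w) = t1 u + t1 w by rewrite /t1 tauD mxE.
have t0Z c u : t0 (c *: u) = c * t0 u by rewrite /t0 tauZ mxE.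
have t1Z c u : t1 (c *: u) = c * t1 u by rewrite /t1 tauZ mxE.
case: (boolP (row_full (col_mx Q S))) => hfull; last first.
  have [g g0 hg] : exists2 g : 'cV[k]_2, g != 0 & col_mx Q S *m g = 0.
    apply: NNPP => hn; case/negP: hfull; apply: row_full_col => g hg.
    by apply/eqP/negPn/negP => g0; apply: hn; exists g.
  have [hQ hS] : Q *m g = 0 /\ S *m g = 0.
    by move: hg; rewrite mul_col_mx -col_mx0 => /eq_col_mx.
  pose p := (P *m g) 0 0; have p0 : p != 0.
    apply: contraNneq g0 => p0; apply/eqP.
    apply: (@gcoord_deg2 _ _ hy _ _ _ _ hx) => u w hu hw.
    rewrite prodE // !mulmxDl -!scalemxAl hQ hS !scaler0 !addr0.
    by rewrite [P *m g]mx11_scalar -/p p0 raddf0 scaler0.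
  have := @quadratic_no_point _ _ _ hshort t0
    (fun u => (gcoord hy u *m g) 0 0 / p) _ _ _ _ _ hquad (b i0) (bdeg i0).
  have -> : t0 (b i0) = 1 by rewrite /t0 taub mxE !eqxx.
  move=> h; have /eqP : 1 = 0 :> k; last by rewrite oner_eq0.
  apply: h => [||u w|c u|u w hu hw] //.
  - by rewrite gcoordD mulmxDl mxE mulrDl.
  - by rewrite gcoordZ -scalemxAl mxE mulrA.
  rewrite prodE // !mulmxDl -!scalemxAl hQ hS !scaler0 !addr0 mxE -/p.
  by rewrite mulfK.
have [D hD] := row_fullP hfull.
pose co u := gcoord hy u *m D.
have coD u w : co (u + w) = co u + co w by rewrite /co gcoordD mulmxDl.
have coZ c u : co (c *: u) = c *: co u by rewrite /co gcoordZ scalemxAl.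
have MD : col_mx Q S *m D = 1%:M by exact: mulmx1C.
have QD : Q *m D = delta_mx 0 i0.
  have := congr1 (row (lshift 1 (0 : 'I_1))) MD; rewrite row_mul rowKu row_id => ->.
  by rewrite row1; congr delta_mx; apply/val_inj.
have SD : S *m D = delta_mx 0 i1.
  have := congr1 (row (rshift 1 (0 : 'I_1))) MD; rewrite row_mul rowKd row_id => ->.
  by rewrite row1; congr delta_mx; apply/val_inj.
pose al := (P *m D) 0 i0; pose be := (P *m D) 0 i1.
pose m : {poly k} := 'X^2 - (al%:P * 'X + be%:P).
have [||||u w hu hw|q] := @quadratic_test _ _ _ hshort
  (fun u => (t0 u)%:P * 'X + (t1 u)%:P)
  (fun u => ((co u) 0 i0)%:P * 'X + ((co u) 0 i1)%:P) m _ _ _ _ _ hquad (b i1) (bdeg i1).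
- by move=> u w; rewrite t0D t1D !polyCD; ring.
- by move=> c u; rewrite t0Z t1Z !polyCM -mul_polyC; ring.
- by move=> u w; rewrite coD !mxE !polyCD; ring.
- by move=> c u; rewrite coZ !mxE !polyCM -mul_polyC; ring.
- exists (- (t0 u * t0 w)%:P); rewrite /co prodE // !mulmxDl -!scalemxAl QD SD.
  have E i : (t0 u * t0 w *: (P *m D) +
      (t0 u * t1 w + t1 u * t0 w) *: delta_mx 0 i0 +
      t1 u * t1 w *: delta_mx 0 i1) 0 i = t0 u * t0 w * (P *m D) 0 i +
      (t0 u * t1 w + t1 u * t0 w) * (i == i0)%:R + t1 u * t1 w * (i == i1)%:R.
    by rewrite !mxE !eqxx.
  rewrite !E -/al -/be /= !mulr0 !mulr1 !addr0 /m !polyCD !polyCM.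
  by ring.
have -> : t0 (b i1) = 0 by rewrite /t0 taub mxE.
have -> : t1 (b i1) = 1 by rewrite /t1 taub mxE.
rewrite mul0r add0r expr1n => h1.
have sm : size m = 3%N.
  rewrite /m size_polyDl ?size_polyXn // size_polyN.
  apply: leq_ltn_trans (size_polyD _ _) _; rewrite gtn_max.
  apply/andP; split; last by apply: leq_ltn_trans (size_polyC_leq1 _) _.
  by rewrite mul_polyC; apply: leq_ltn_trans (size_scale_leq _ _) _; rewrite size_polyX.
have q0 : q != 0.
  by apply/eqP => q0; move/eqP: h1; rewrite q0 mul0r oner_eq0.
have m0 : m != 0 by rewrite -size_poly_gt0 sm.
have := congr1 (fun p : {poly k} => size p) h1; rewrite size_mul // sm size_poly1.
by move: q0; rewrite -size_poly_gt0; lia.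
Qed.

(** The pencil of products of forms of degree one satisfies the hypotheses of
[pencil_good_pair]. *)
Theorem quadratic_exact_pair (x : 'I_3 -> R) (hx : kbasis (in_deg gr 1%N) x)
    (y : 'I_2 -> R) (hy : kbasis (in_deg gr 2) y) : infinite_field k ->
  exists l l', [/\ half_exact gr l l', half_exact gr l' l & l != 0].
Proof.
move=> hinf; pose G h : 'M[k]_3 := \matrix_(i, j) gcoord hy (x i * x j) 0 h.
pose lin (c : 'rV[k]_3) := \sum_i c 0 i *: x i.
have xd := basis_deg1 hx.
have lindeg c : in_deg gr 1 (lin c).
  by apply: in_deg_sum => i _; apply/in_deg_scale/xd.
have coK a : in_deg gr 1 a -> lin (coord1 hx a) = a.
  by move=> ha; rewrite /lin -(coord1_deg1 hx ha).
have GE u w h : (coord1 hx u *m G h *m (coord1 hx w)^T) 0 0 =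
    gcoord hy (lin (coord1 hx u) * lin (coord1 hx w)) 0 h.
  rewrite mulr_suml gcoord_sum summxE mxE.
  under eq_bigr => j _ do rewrite mxE mulr_suml.
  rewrite exchange_big; apply: eq_bigr => i _ /=.
  rewrite mulr_sumr gcoord_sum summxE; apply: eq_bigr => j _.
  by rewrite !mxE -scalerAl -scalerAr !gcoordZ !mxE; ring.
have Gsym h : (G h)^T = G h.
  by apply/matrixP => i j; rewrite !mxE mulrC.
have pE g u w : in_deg gr 1 u -> in_deg gr 1 w ->
    (coord1 hx u *m pencil G g *m (coord1 hx w)^T) 0 0 = (gcoord hy (u * w) *m g) 0 0.
  move=> hu hw; rewrite /pencil mulmx_sumr mulmx_suml summxE mxE.
  apply: eq_bigr => h _; rewrite -scalemxAr -scalemxAl mxE GE !coK //.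
  by rewrite mulrC.
have nosoc (v : 'rV_3) : (forall h, v *m G h = 0) -> v = 0.
  move=> hv; rewrite -(coord1_basis hx v) -/(lin v).
  rewrite (quadratic_nosocle3 hx hy (lindeg v)) ?coord1_0 // => b hb.
  apply: (gcoord_eq0 (hb := hy)); first exact: (in_deg_mul (lindeg v) hb).
  apply/rowP => h; rewrite [RHS]mxE; have := GE (lin v) b h.
  by rewrite coord1_basis hv mul0mx mxE (coK b hb).
have norank g c (b : 'rV_3) : pencil G g = c *: (b^T *m b) -> g = 0.
  move=> E; pose be u := (coord1 hx u *m b^T) 0 0.
  have prod u w : in_deg gr 1 u -> in_deg gr 1 w ->
      (gcoord hy (u * w) *m g) 0 0 = c * (be u * be w).
    move=> hu hw; rewrite -pE // E -scalemxAr -scalemxAl mxE mulmxA; congr (_ * _).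
    rewrite [coord1 hx u *m b^T]mx11_scalar mul_scalar_mx -scalemxAl mxE -/(be u).
    by congr (_ * _); rewrite /be -[b in LHS]trmxK -trmx_mul mxE.
  have g0 : (forall u w, in_deg gr 1 u -> in_deg gr 1 w -> c * (be u * be w) = 0) -> g = 0.
    move=> h0; apply: (@gcoord_deg2 _ _ hy _ _ _ _ hx) => u w hu hw.
    by rewrite [LHS]mx11_scalar prod // h0 // raddf0.
  case: (eqVneq c 0) => [c0|c0]; first by apply: g0 => u w _ _; rewrite c0 mul0r.
  have be0 : forall u, in_deg gr 1 u -> be u = 0.
    apply: (@quadratic_no_point _ _ _ hshort be (fun z => (gcoord hy z *m g) 0 0 / c)) => //.
    - by move=> u w; rewrite /be coord1D mulmxDl mxE.
    - by move=> d u; rewrite /be coord1Z -scalemxAl mxE.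
    - by move=> u w; rewrite gcoordD mulmxDl mxE mulrDl.
    - by move=> d u; rewrite gcoordZ -scalemxAl mxE mulrA.
    by move=> u w hu hw; rewrite prod // mulrC mulKf.
  by apply: g0 => u w hu hw; rewrite be0 // mul0r mulr0.
have [l [l' [gl gl' hll']]] := pencil_good_pair hinf Gsym nosoc norank.
have gn0 (a : 'rV[k]_3) : good G a -> a != 0.
  move=> ga; apply/eqP => a0; have := ga (delta_mx 0 0); rewrite a0 mul0mx.
  move=> /(_ erefl)/matrixP/(_ 0 0); rewrite !mxE => /eqP.
  by rewrite oner_eq0.
have half (a a' : 'rV[k]_3) : good G a -> good G a' ->
    (forall h, a *m G h *m a'^T = 0) -> half_exact gr (lin a) (lin a').
  move=> ga ga' haa'; pose A : 'M[k]_(3, 2) := \matrix_(i, h) gcoord hy (x i * lin a) 0 h.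
  have AE (c : 'rV[k]_3) : gcoord hy (lin c * lin a) = c *m A.
    rewrite /lin mulr_suml gcoord_sum; apply/rowP => h; rewrite summxE mxE.
    by apply: eq_bigr => i _; rewrite -scalerAl gcoordZ !mxE.
  have Afull : row_full A.
    apply: row_full_col => g hg; apply: ga; apply/rowP => j; rewrite [RHS]mxE.
    have : (gcoord hy (x j * lin a) *m g) 0 0 = 0.
      have -> : x j = lin (delta_mx 0 j).
        by rewrite -(coord1_x hx j) coK //; apply: xd.
      by rewrite AE -mulmxA hg mulmx0 mxE.
    rewrite mulrC -pE ?xd // coord1_x coord1_basis trmx_delta -colE.
    by rewrite mxE.
  have prod0 : lin a' * lin a = 0.
    apply: (gcoord_eq0 (hb := hy)); first exact: (in_deg_mul (lindeg a') (lindeg a)).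
    apply/rowP => h; rewrite [RHS]mxE mulrC; have := GE (lin a) (lin a') h.
    by rewrite !coord1_basis haa' mxE.
  split=> // [z hz|u hu h0].
    have /submxP[c Ec] := submx_full (gcoord hy z) Afull.
    exists (lin c) => //; apply/eqP; rewrite -subr_eq0; apply/eqP.
    apply: (gcoord_eq0 (hb := hy)); last by rewrite gcoordD gcoordN AE Ec subrr.
    by apply: in_deg_add => //; apply/in_deg_opp/(in_deg_mul (lindeg c) (lindeg a)).
  have ker0 c : lin c * lin a = 0 -> (c <= kermx A)%MS.
    by move=> E; apply/sub_kermxP; rewrite -AE E gcoord0.
  have : (coord1 hx u <= a')%MS.
    apply: (submx_trans (ker0 _ _)); first by rewrite coK.
    rewrite -(geq_leqif (mxrank_leqif_sup (ker0 _ prod0))).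
    by rewrite mxrank_ker rank_rV (gn0 _ ga') (eqP Afull).
  case/sub_rVP => c Ec; exists c; rewrite -{1}(coK u hu) Ec /lin scaler_sumr.
  by apply: eq_bigr => i _; rewrite mxE scalerA.
exists (lin l), (lin l'); split.
- exact: half.
- apply: half => // h; apply: trmx_inj; rewrite trmx0 -[RHS](hll' h).
  by rewrite !trmx_mul trmxK Gsym mulmxA.
apply: contraNneq (gn0 l gl) => h; apply/eqP.
by rewrite -(coord1_basis hx l) -/(lin l) h coord1_0.
Qed.

End Socle.

(** * Cubic algebras *)

(** Structure constants of a commutative algebra with basis [1, y, z]:
[y ^+ 2 = a0 + a1 y + a2 z], [y z = b0 + b1 y + b2 z] and
[z ^+ 2 = c0 + c1 y + c2 z]. The equations express associativity. *)
Record cubic (k : fieldType) := Cubic {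
  ca0 : k; ca1 : k; ca2 : k; cb0 : k; cb1 : k; cb2 : k; cc0 : k; cc1 : k; cc2 : k;
  cubic1 : ca1 * cb0 + ca2 * cc0 = cb1 * ca0 + cb2 * cb0;
  cubic2 : ca1 * cb1 + ca2 * cc1 = cb0 + cb1 * ca1 + cb2 * cb1;
  cubic3 : ca0 + ca1 * cb2 + ca2 * cc2 = cb1 * ca2 + cb2 * cb2;
  cubic4 : cb1 * cb0 + cb2 * cc0 = cc1 * ca0 + cc2 * cb0;
  cubic5 : cb1 * cb1 + cb2 * cc1 = cc0 + cc1 * ca1 + cc2 * cb1;
  cubic6 : cb0 + cb1 * cb2 + cb2 * cc2 = cc1 * ca2 + cc2 * cb2
}.

Definition cubic_alg (k : fieldType) (t : cubic k) : Type := (k * k * k)%type.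

Section CubicRing.
Variables (k : fieldType) (t : cubic k).
Local Notation T := (cubic_alg t).
HB.instance Definition _ := GRing.Zmodule.on T.

Definition cubic_one : T := (1, 0, 0).
Definition cubic_mul (u v : T) : T :=
  let: (u0, u1, u2) := u in let: (v0, v1, v2) := v in
  let yy := u1 * v1 in let yz := u1 * v2 + u2 * v1 in let zz := u2 * v2 in
  (u0 * v0 + yy * ca0 t + yz * cb0 t + zz * cc0 t,
   u0 * v1 + u1 * v0 + yy * ca1 t + yz * cb1 t + zz * cc1 t,
   u0 * v2 + u2 * v0 + yy * ca2 t + yz * cb2 t + zz * cc2 t).

Fact cubic_mulC : commutative cubic_mul.
Proof. by move=> [[u0 u1] u2] [[v0 v1] v2]; rewrite /cubic_mul; congr (_, _, _); ring. Qed.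

(* The associator is alternating, hence determined by those of [y, y, z] and
   [y, z, z]. *)
Fact cubic_mulA : associative cubic_mul.
Proof.
move=> [[u0 u1] u2] [[v0 v1] v2] [[w0 w1] w2]; rewrite /cubic_mul.
pose p := u1 * v1 * w2 - w1 * v1 * u2; pose q := u1 * v2 * w2 - w1 * v2 * u2.
have E (a b L1 R1 L2 R2 : k) : L1 = R1 -> L2 = R2 ->
    b - a = p * (L1 - R1) + q * (L2 - R2) -> a = b.
  by move=> -> ->; rewrite !subrr !mulr0 addr0 => /eqP; rewrite subr_eq0 => /eqP.
congr (_, _, _).
- by apply: (E _ _ _ _ _ _ (cubic1 t) (cubic4 t)); rewrite /p /q; ring.
- by apply: (E _ _ _ _ _ _ (cubic2 t) (cubic5 t)); rewrite /p /q; ring.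
by apply: (E _ _ _ _ _ _ (cubic3 t) (cubic6 t)); rewrite /p /q; ring.
Qed.

Fact cubic_mul1 : left_id cubic_one cubic_mul.
Proof. by move=> [[u0 u1] u2]; rewrite /cubic_mul /cubic_one; congr (_, _, _); ring. Qed.

Lemma cubic_addE (u v : T) :
  u + v = (u.1.1 + v.1.1, u.1.2 + v.1.2, u.2 + v.2).
Proof. by case: u => [[u0 u1] u2]; case: v => [[v0 v1] v2]. Qed.

Fact cubic_mulDl : left_distributive cubic_mul +%R.
Proof.
move=> [[u0 u1] u2] [[v0 v1] v2] [[w0 w1] w2].
rewrite !cubic_addE /cubic_mul /=.
by congr (_, _, _); ring.
Qed.

Fact cubic_one_neq0 : cubic_one != 0.
Proof. by apply/eqP => -[/eqP]; rewrite oner_eq0. Qed.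

HB.instance Definition _ := GRing.Zmodule_isComNzRing.Build T
  cubic_mulA cubic_mulC cubic_mul1 cubic_mulDl cubic_one_neq0.

Lemma cubic_mulE (u v : T) : u * v = cubic_mul u v.
Proof. by []. Qed.

Definition cscal (c : k) : T := (c, 0, 0).

Fact cscal_additive : zmod_morphism cscal.
Proof. by move=> c d; rewrite /cscal; congr (_, _, _); rewrite /= subr0. Qed.
Fact cscal_mult : monoid_morphism cscal.
Proof.
split=> [//|c d]; rewrite cubic_mulE /cscal /cubic_mul.
by congr (_, _, _); ring.
Qed.
HB.instance Definition _ := GRing.isZmodMorphism.Build k T cscal cscal_additive.
HB.instance Definition _ := GRing.isMonoidMorphism.Build k T cscal cscal_mult.

Lemma cscalM c (u : T) : cscal c * u = (c * u.1.1, c * u.1.2, c * u.2).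
Proof.
case: u => [[u0 u1] u2]; rewrite cubic_mulE /cscal /cubic_mul /=.
by congr (_, _, _); ring.
Qed.

End CubicRing.

Section CubicModel.
Variables (k : fieldType) (R : comAlgType k) (gr : std_graded R).
Variables (t : cubic k) (l y z : R).
Local Notation T := (cubic_alg t).

Definition tri (i : 'I_3) : R := nth 0 [:: l; y; z] i.

Hypothesis hx : kbasis (in_deg gr 1) tri.
Hypothesis hyy : y * y = l * (ca0 t *: l + ca1 t *: y + ca2 t *: z).
Hypothesis hyz : y * z = l * (cb0 t *: l + cb1 t *: y + cb2 t *: z).
Hypothesis hzz : z * z = l * (cc0 t *: l + cc1 t *: y + cc2 t *: z).

Local Notation emb := (@emb k R _ _).
Local Notation mxdeg := (mxdeg gr).
Local Notation sc := (map_mx (cscal t)).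

(** The forms of degree one as a copy of the cubic algebra: products in [R] are
the products of [T] multiplied by the form [l] that corresponds to [1]. *)
Definition cform (u : T) : R := u.1.1 *: l + u.1.2 *: y + u.2 *: z.

Definition i0 : 'I_3 := ord0.
Definition i1 : 'I_3 := Ordinal (isT : 1 < 3)%N.
Definition i2 : 'I_3 := Ordinal (isT : 2 < 3)%N.

Definition cubic_of (a : R) : T :=
  (gcoord hx a 0 i0, gcoord hx a 0 i1, gcoord hx a 0 i2).

Lemma sum3 (V : nmodType) (F : 'I_3 -> V) : \sum_i F i = F i0 + F i1 + F i2.
Proof.
rewrite !big_ord_recr big_ord0 /= add0r.
by congr (F _ + F _ + F _); apply/val_inj.
Qed.

Lemma cform_deg u : in_deg gr 1 (cform u).
Proof.
have h : forall i, in_deg gr 1 (tri i) by case: hx.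
by rewrite /cform; apply/in_deg_add/in_deg_scale/(h i2);
   apply: in_deg_add; apply: in_deg_scale; [apply: (h i0)|apply: (h i1)].
Qed.

Lemma cubic_ofK a : in_deg gr 1 a -> cform (cubic_of a) = a.
Proof. by move=> ha; rewrite -[RHS](gcoordK hx ha) sum3. Qed.

Lemma cformK : cancel cform cubic_of.
Proof.
move=> [[u0 u1] u2]; pose c : 'rV[k]_3 := \row_i nth 0 [:: u0; u1; u2] i.
have -> : cform (u0, u1, u2) = \sum_i c 0 i *: tri i by rewrite sum3 !mxE.
by rewrite /cubic_of gcoord_basis !mxE.
Qed.

Lemma cformD u v : cform (u + v) = cform u + cform v.
Proof.
rewrite cubic_addE /cform /= !scalerDl.
by rewrite [in RHS]addrACA; congr (_ + _); rewrite [in RHS]addrACA.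
Qed.

Lemma cformZ c u : cform (cscal t c * u) = c *: cform u.
Proof. by rewrite cscalM /cform /= !scalerDr !scalerA. Qed.

Lemma cform0 : cform 0 = 0.
Proof. by rewrite -[0](mul0r 0) -(rmorph0 (cscal t)) cformZ scale0r. Qed.

Lemma cform_sum (I : Type) (s : seq I) (P : pred I) (F : I -> T) :
  cform (\sum_(i <- s | P i) F i) = \sum_(i <- s | P i) cform (F i).
Proof. exact: (big_morph _ cformD cform0). Qed.

Lemma cformM u v : cform u * cform v = l * cform (u * v).
Proof.
have [A SA [AD AM]] : exists2 A : k -> R, forall c a, c *: a = A c * a &
    (forall c d, A (c + d) = A c + A d) /\ (forall c d, A (c * d) = A c * A d).
  exists (in_alg R); first by move=> c a; rewrite /= mulr_algl.
  by split=> c d; [exact: rmorphD|exact: rmorphM].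
have E w : cform w = A w.1.1 * l + A w.1.2 * y + A w.2 * z by rewrite /cform !SA.
move: hyy hyz hzz; rewrite !SA => h1 h2 h3.
case: u v => [[u0 u1] u2] [[v0 v1] v2]; rewrite !E cubic_mulE /cubic_mul /=.
have -> : (A u0 * l + A u1 * y + A u2 * z) * (A v0 * l + A v1 * y + A v2 * z) =
  A u0 * A v0 * (l * l) + (A u0 * A v1 + A u1 * A v0) * (l * y) +
  (A u0 * A v2 + A u2 * A v0) * (l * z) + A u1 * A v1 * (y * y) +
  (A u1 * A v2 + A u2 * A v1) * (y * z) + A u2 * A v2 * (z * z) by ring.
by rewrite h1 h2 h3 !(AD, AM); ring.
Qed.

Lemma cform_embM m n p (c : 'M[k]_(m, n)) (V : 'M[T]_(n, p)) :
  map_mx cform (sc c *m V) = emb c *m map_mx cform V.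
Proof.
apply/matrixP => i j; rewrite !mxE cform_sum; apply: eq_bigr => h _.
by rewrite !mxE cformZ /= mulr_algl.
Qed.

Lemma cform_mulmx m n p (A : 'M[T]_(m, n)) (B : 'M[T]_(n, p)) :
  map_mx cform A *m map_mx cform B = l *: map_mx cform (A *m B).
Proof.
apply/matrixP => i j; rewrite !mxE cform_sum mulr_sumr; apply: eq_bigr => h _.
by rewrite !mxE cformM.
Qed.

Lemma cform_mxdeg m n (A : 'M[T]_(m, n)) : mxdeg 1 (map_mx cform A).
Proof. by move=> i j; rewrite mxE; apply: cform_deg. Qed.

Lemma cform_mx_inj m n : injective (map_mx cform : 'M[T]_(m, n) -> 'M[R]_(m, n)).
Proof.
move=> A B /matrixP E; apply/matrixP => i j; apply: (can_inj cformK).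
by have := E i j; rewrite !mxE.
Qed.

Lemma cubic_of_mxK m n (X : 'M[R]_(m, n)) :
  mxdeg 1 X -> map_mx cform (map_mx cubic_of X) = X.
Proof. by move=> hX; apply/matrixP => i j; rewrite !mxE cubic_ofK. Qed.

Lemma cform_mx0 m n : map_mx cform (0 : 'M[T]_(m, n)) = 0.
Proof. by apply/matrixP => i j; rewrite !mxE cform0. Qed.

Definition tv m n (V : 'M[T]_(m, n)) : 'M[k]_(m, 3 * n) := gcv hx (map_mx cform V).
Definition vt m n (c : 'M[k]_(m, 3 * n)) : 'M[T]_(m, n) := map_mx cubic_of (gvc tri c).

Lemma tvK m n (V : 'M[T]_(m, n)) : vt (tv V) = V.
Proof.
apply: cform_mx_inj; rewrite cubic_of_mxK; last exact: (gvc_deg hx).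
by rewrite gcvK //; apply: cform_mxdeg.
Qed.

Lemma vtK m n (c : 'M[k]_(m, 3 * n)) : tv (vt c) = c.
Proof. by rewrite /tv cubic_of_mxK ?gvcK //; apply: (gvc_deg hx). Qed.

Lemma tv0 m n : tv (0 : 'M[T]_(m, n)) = 0.
Proof. by rewrite /tv cform_mx0 gcv0. Qed.

Lemma tv_scM m n p (c : 'M[k]_(m, n)) (V : 'M[T]_(n, p)) : tv (sc c *m V) = c *m tv V.
Proof. by rewrite /tv cform_embM gcv_embM. Qed.

Lemma vt_scM m n p (c : 'M[k]_(m, n)) (V : 'M[k]_(n, 3 * p)) :
  vt (c *m V) = sc c *m vt V.
Proof. by apply: (can_inj (@tvK _ _)); rewrite tv_scM !vtK. Qed.

Definition tmx m n (X : 'M[T]_(m, n)) : 'M[k]_(3 * m, 3 * n) := tv (vt 1%:M *m X).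

Lemma tmxE s m n (V : 'M[T]_(s, m)) (X : 'M[T]_(m, n)) : tv (V *m X) = tv V *m tmx X.
Proof. by rewrite /tmx -tv_scM mulmxA -vt_scM mulmx1 tvK. Qed.

Definition tfree m n (B : 'M[T]_(m, n)) := forall s (c : 'M[k]_(s, m)), sc c *m B = 0 -> c = 0.

(** The algebra [T] need not be a domain, so kernels are measured over [k]. *)
Lemma tker_basis m n (X : 'M[T]_(m, n)) : exists r (B : 'M[T]_(r, m)),
  [/\ B *m X = 0, tfree B & forall s (V : 'M[T]_(s, m)), V *m X = 0 -> exists c, V = sc c *m B].
Proof.
exists (\rank (kermx (tmx X))), (vt (row_base (kermx (tmx X)))); split.
- apply: (can_inj (@tvK _ _)); rewrite tmxE vtK tv0.
  by apply/sub_kermxP; rewrite eq_row_base.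
- move=> s c h; apply: (row_free_inj (row_base_free (kermx (tmx X)))).
  by rewrite mul0mx -(tv0 s m) -h tv_scM vtK.
move=> s V h; have : (tv V <= kermx (tmx X))%MS.
  by apply/sub_kermxP; rewrite -tmxE h tv0.
rewrite -(eq_row_base (kermx (tmx X))) => /submxP[c Ec].
by exists c; rewrite -vt_scM -Ec tvK.
Qed.

Lemma tfree_row_free s m n (c : 'M[k]_(s, m)) (B : 'M[T]_(m, n)) :
  tfree (sc c *m B) -> row_free c.
Proof.
move=> h; rewrite -kermx_eq0; apply/eqP; apply: h.
by rewrite mulmxA -map_mxM mulmx_ker map_mx0 mul0mx.
Qed.

Lemma tinj_inverse m n (X : 'M[T]_(m, n)) : m = n ->
  (forall V : 'rV[T]_m, V *m X = 0 -> V = 0) -> exists Z, Z *m X = 1%:M /\ X *m Z = 1%:M.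
Proof.
move=> emn h; have hfree : row_free (tmx X).
  rewrite -kermx_eq0; apply/rowV0P => w /sub_kermxP hw.
  rewrite -(vtK w) (h (vt w)) ?tv0 //.
  by apply: (can_inj (@tvK _ _)); rewrite tmxE vtK hw tv0.
have hfull : row_full (tmx X) by move: hfree; rewrite /row_free => /eqP hr; rewrite /row_full hr emn.
have /submxP[c Ec] := submx_full (tv 1%:M) hfull.
have E : vt c *m X = 1%:M.
  by apply: (can_inj (@tvK _ _)); rewrite tmxE vtK Ec.
exists (vt c); split=> //; apply/eqP; rewrite -subr_eq0; apply/eqP.
apply/row_matrixP => i; rewrite row0; apply: h.
by rewrite -row_mul mulmxBl -mulmxA E mulmx1 mul1mx subrr row0.
Qed.

End CubicModel.

(** * Strands over a cubic algebra *)

Section CubicStrand.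
Variables (k : fieldType) (R : comAlgType k) (gr : std_graded R).
Variables (t : cubic k) (l y z : R).
Local Notation T := (cubic_alg t).
Hypothesis ht : kbasis (in_deg gr 1) (tri l y z).
Hypothesis hyy : y * y = l * (ca0 t *: l + ca1 t *: y + ca2 t *: z).
Hypothesis hyz : y * z = l * (cb0 t *: l + cb1 t *: y + cb2 t *: z).
Hypothesis hzz : z * z = l * (cc0 t *: l + cc1 t *: y + cc2 t *: z).
Variable l' : R.
Hypotheses (hl : half_exact gr l l') (hl' : half_exact gr l' l) (l0 : l != 0).

Variables (x : 'I_3 -> R) (hx : kbasis (in_deg gr 1%N) x).
Variables (b2 : 'I_2 -> R) (hy : kbasis (in_deg gr 2%N) b2).

Local Notation mxdeg := (mxdeg gr).
Local Notation sc := (map_mx (cscal t)).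
Local Notation cform := (@cform k R t l y z).
Local Notation cubic_of := (@cubic_of k R gr t l y z ht).
Local Notation snext := (snext x hy).
Local Notation sX := (sX x hy).
Local Notation strand := (strand x hy).

Let w : T := cubic_of l'.

Lemma cform_w : cform w = l'.
Proof. by apply: cubic_ofK; case: hl. Qed.

Lemma l_cform_eq0 u : l * cform u = 0 -> exists c, u = cscal t c * w.
Proof.
move=> h; case: hl => _ _ _ _ hann.
have [|c Ec] := hann (cform u) (cform_deg ht u); first by rewrite mulrC.
exists c; rewrite -[u](cformK ht) Ec -[RHS](cformK ht); congr cubic_of.
by rewrite cformZ cform_w.
Qed.

Lemma l_cform_w c : l * cform (cscal t c * w) = 0.
Proof.
rewrite cformZ cform_w -scalerAr mulrC.
by case: hl => _ _ -> _ _; rewrite scaler0.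
Qed.

Lemma l_cform_mx_eq0 m n (A : 'M[T]_(m, n)) :
  l *: map_mx cform A = 0 -> exists G, A = w *: sc G.
Proof.
move=> /matrixP h.
have hc i j : exists c, A i j = cscal t c * w.
  by apply: l_cform_eq0; have := h i j; rewrite !mxE.
have /fin_all_exists[f hf] : forall i, exists f : 'I_n -> k, forall j, A i j = cscal t (f j) * w.
  by move=> i; exact: (fin_all_exists (hc i)).
exists (\matrix_(i, j) f i j); apply/matrixP => i j.
by rewrite !mxE hf mulrC.
Qed.

Lemma l_cform_mx_w m n (G : 'M[k]_(m, n)) : l *: map_mx cform (w *: sc G) = 0.
Proof. by apply/matrixP => i j; rewrite !mxE (mulrC w) l_cform_w. Qed.

Lemma w_regular u : w * u = 0 -> u = 0.
Proof.
move=> h; have h1 : cform u * l' = 0.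
  by rewrite -cform_w mulrC (cformM hyy hyz hzz) h cform0 mulr0.
case: hl' => _ _ _ _ hann; have [c Ec] := hann _ (cform_deg ht u) h1.
have Eu : u = cscal t c.
  rewrite -[u](cformK ht) Ec -[RHS](cformK ht); congr cubic_of.
  by rewrite /(cform _) /= !scale0r !addr0.
have : cform (cscal t c * w) = 0 by rewrite -Eu mulrC h cform0.
rewrite cformZ cform_w => /eqP; rewrite scaler_eq0 => /orP[/eqP c0|].
  by rewrite Eu c0 rmorph0.
by rewrite (negbTE (half_exact_neq0 hl hl' l0)).
Qed.

Lemma w_unit : exists v, v * w = 1.
Proof.
have [||Z [hZ _]] := @tinj_inverse k R gr t l y z ht 1 1 w%:M => //.
  move=> V; rewrite mul_mx_scalar => /matrixP/(_ 0 0); rewrite !mxE => /w_regular h.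
  by apply/rowP => i; rewrite !ord1 mxE.
exists (Z 0 0); have := congr1 (fun M : 'M[T]_1 => M 0 0) hZ.
by rewrite mul_mx_scalar !mxE mulrC.
Qed.

Lemma scale_w_inj m n (A B : 'M[T]_(m, n)) : w *: A = w *: B -> A = B.
Proof.
move=> /eqP; rewrite -subr_eq0 -scalerBr => /eqP/matrixP h.
apply/eqP; rewrite -subr_eq0; apply/eqP/matrixP => i j.
by rewrite [RHS]mxE; apply: w_regular; have := h i j; rewrite mxE [RHS]mxE.
Qed.

Lemma sc_inj m n : injective (map_mx (cscal t) : 'M[k]_(m, n) -> 'M[T]_(m, n)).
Proof. by move=> A B /matrixP E; apply/matrixP => i j; have := E i j; rewrite !mxE => -[]. Qed.

(** The differentials of the strand as matrices over the cubic algebra: the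
composite of two of them is [w] times a matrix of scalars. *)
Definition tX s : 'M[T]_(sm (snext s), sm s) := map_mx cubic_of (sX s).

Lemma tXE s : map_mx cform (tX s) = sX s.
Proof. by apply: cubic_of_mxK; apply: (@sX_deg _ _ _ _ _ hx). Qed.

Lemma tX_free s : tfree (tX s).
Proof.
move=> n c h; apply: (sX_free hx (hy := hy) (s := s)).
by rewrite -tXE -cform_embM h cform_mx0.
Qed.

Lemma tX_mul s : exists G, tX (snext s) *m tX s = w *: sc G.
Proof.
by apply: l_cform_mx_eq0; rewrite -(cform_mulmx hyy hyz hzz) !tXE (sX_mul hx).
Qed.

Lemma tX_complete s n (V : 'M[T]_(n, sm (snext s))) G :
  V *m tX s = w *: sc G -> exists c, V = sc c *m tX (snext s).
Proof.
move=> h; have [||c Ec] := @sX_complete _ _ _ _ _ hx _ _ hy s n (map_mx cform V).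
- exact: (cform_mxdeg ht).
- by rewrite -tXE (cform_mulmx hyy hyz hzz) h l_cform_mx_w.
exists c; apply: (cform_mx_inj ht).
by rewrite cform_embM tXE.
Qed.

Definition tinv s := exists Z, Z *m tX s = 1%:M /\ tX s *m Z = 1%:M.

(** Up to a change of basis over [k] the next differential is [w] times the inverse. *)
Lemma tinv_next s : tinv s -> tinv (snext s).
Proof.
case=> Z [ZY YZ]; have [G hG] := tX_mul s.
have hwZ : (w *: Z) *m tX s = w *: sc 1%:M by rewrite -scalemxAl ZY map_mx1.
have [c hc] := tX_complete hwZ.
have E1 : tX (snext s) = sc G *m (w *: Z).
  by rewrite -scalemxAr scalemxAl -hG -mulmxA YZ mulmx1.
have Gc : G *m c = 1%:M.
  apply/eqP; rewrite -subr_eq0; apply/eqP/(@tX_free (snext s)).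
  by rewrite map_mxB map_mxM map_mx1 mulmxBl mul1mx -mulmxA -hc -E1 subrr.
have cG : c *m G = 1%:M.
  apply: sc_inj; apply: scale_w_inj.
  by rewrite map_mxM scalemxAr -hG mulmxA -hc hwZ.
have [v vw] := w_unit; exists (v *: (tX s *m sc c)); split.
  rewrite -scalemxAl -mulmxA -hc -scalemxAr YZ scalerA vw scale1r.
  by [].
rewrite -scalemxAr mulmxA hG -scalemxAl scalerA vw scale1r -map_mxM Gc.
by rewrite map_mx1.
Qed.

Lemma tinv_full s : tinv s -> row_full (sA (snext s)).
Proof.
case=> Z [ZY YZ]; apply: row_fullP_row => q.
pose v : 'rV[R]_(sm s) := gvc b2 (q : 'rV_(2 * sm s)).
have hv : mxdeg 2 v by apply: (gvc_deg hy).
have [a ha Ea] : exists2 a : 'rV[R]_(sm s), mxdeg 1 a & v = l *: a.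
  case: hl => _ _ _ hdiv _.
  have /fin_all_exists2[f fd Ef] := fun j => hdiv _ (hv 0 j).
  exists (\row_j f j); first by move=> i j; rewrite mxE.
  by apply/rowP => j; rewrite Ef !mxE mulrC.
pose V := map_mx cubic_of a *m Z; exists (gcv hx (map_mx cform V)).
rewrite /= -(rmulmxE hx) ?(cform_mxdeg ht) //; last exact: (cform_mxdeg ht).
rewrite -[X in gcv hy (_ *m X)]/(sX s) -tXE (cform_mulmx hyy hyz hzz) /V.
by rewrite -mulmxA ZY mulmx1 cubic_of_mxK // -Ea gvcK.
Qed.

Definition tker_dim s n := exists B : 'M[T]_(n, sm (snext s)), B *m tX s = 0 /\ tfree B.

Lemma tker_dim_le s n : tker_dim s n -> (n <= sm (snext (snext s)))%N.
Proof.
case=> B [BY Bfree]; have [|c Ec] := @tX_complete s n B 0.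
  by rewrite BY map_mx0 scaler0.
by rewrite Ec in Bfree; have /eqP <- := tfree_row_free Bfree; apply: rank_leq_col.
Qed.

(** The left kernel is a module over the cubic algebra, so multiplication by the
two generators of the algebra yields relations between the vectors of a basis of
it: the dimension at least doubles at the next step. *)
Lemma tker_dim_double s n : tker_dim s n ->
  exists2 n', (2 * n <= n')%N & tker_dim (snext s) n'.
Proof.
case=> B0 [B0Y B0free]; have [m [B [BY Bfree Bcomp]]] := tker_basis ht (tX s).
have hnm : (n <= m)%N.
  have [c Ec] := Bcomp _ _ B0Y; rewrite Ec in B0free.
  by have /eqP <- := tfree_row_free B0free; apply: rank_leq_col.
exists (m + m)%N; first by lia.
have [|c Ec] := @tX_complete s m B 0; first by rewrite BY map_mx0 scaler0.
have cfree : row_free c by rewrite Ec in Bfree; apply: tfree_row_free Bfree.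
have [c' hc'] := row_freeP cfree.
pose gy : T := (0, 1, 0); pose gz : T := (0, 0, 1).
have [Cy hy'] : exists Cy, gy *: B = sc Cy *m B.
  by apply: Bcomp; rewrite -scalemxAl BY scaler0.
have [Cz hz'] : exists Cz, gz *: B = sc Cz *m B.
  by apply: Bcomp; rewrite -scalemxAl BY scaler0.
pose E := col_mx (gy%:M - sc Cy) (gz%:M - sc Cz).
have EB : E *m B = 0.
  by rewrite mul_col_mx !mulmxBl !mul_scalar_mx hy' hz' !subrr col_mx0.
exists (E *m sc c); split; first by rewrite -mulmxA -Ec.
move=> r d hd; have hdE : sc d *m E = 0.
  have := congr1 (mulmx^~ (sc c')) hd.
  by rewrite mul0mx -!mulmxA -map_mxM hc' map_mx1 mulmx1.
move: hdE; rewrite -[d]hsubmxK map_row_mx mul_row_col.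
set d1 := lsubmx d; set d2 := rsubmx d => hE.
have [e1 e2] : d1 = 0 /\ d2 = 0.
  have hij i j : gy * cscal t (d1 i j) - cscal t ((d1 *m Cy) i j) +
      (gz * cscal t (d2 i j) - cscal t ((d2 *m Cz) i j)) = 0.
    have /matrixP/(_ i j) := hE; rewrite !mulmxBr !mul_mx_scalar -!map_mxM.
    by rewrite !mxE.
  split; apply/matrixP => i j; rewrite [RHS]mxE; have := hij i j.
    rewrite ![_ * cscal _ _]mulrC !cscalM => /(congr1 (fun u : T => u.1.2)).
    by rewrite /= !mulr1 !mulr0 !subr0 !addr0.
  rewrite ![_ * cscal _ _]mulrC !cscalM => /(congr1 (fun u : T => u.2)).
  by rewrite /= !mulr1 !mulr0 !subr0 !add0r.
by rewrite e1 e2 row_mx0.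
Qed.

Variables (p : nat) (C : 'M[k]_(3 * p, 2 * p)).
Local Notation S i := (strand (LState C) i).

Lemma cubic_strand_rank N : (forall i, (i < N)%N -> row_full (sA (S i))) ->
  forall i, (i <= N)%N -> sm (S i) = p.
Proof.
move=> full; have hS i : sm (S i.+1) = (3 * sm (S i) - \rank (sA (S i)))%N.
  exact: sm_snext.
have key i : (i < N)%N -> sm (S i) = p /\ sm (S i.+1) = p.
  elim: i => [|i IH] hi.
    split=> //; rewrite hS (eqP (full 0%N hi)) [sm _]/= [sN _]/=.
    by lia.
  have [h1 h2] := IH (ltnW hi); split=> //.
  have hN : sN (S i.+1) = (2 * sm (S i))%N by [].
  by rewrite (hS i.+1) (eqP (full i.+1 hi)) hN h1 h2; lia.
move=> [|i] hi //; by have [] := key i hi.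
Qed.

(** Hence finitely many steps decide: a non-invertible first differential would
have kernels whose dimensions outgrow the constant rank [p]. *)
Theorem cubic_strand_full : (forall i, (i < p.+2)%N -> row_full (sA (S i))) ->
  forall i, row_full (sA (S i)).
Proof.
move=> full; have rk := cubic_strand_rank full.
have inv0 : tinv (S 0).
  apply: (tinj_inverse ht); first by rewrite (rk 1%N) ?(rk 0%N).
  move=> V hV; apply/eqP/negPn/negP => V0.
  have dim i : exists2 n, (i < n)%N & tker_dim (S i) n.
    elim: i => [|i [n hn hd]].
      exists 1%N => //; exists V; split=> // s c hc.
      apply/matrixP => a b; rewrite (ord1 b) [RHS]mxE.
      have [j hj] : exists j, V 0 j != 0.
        apply/existsP; rewrite -negb_forall; apply: contraNN V0 => /forallP h.
        by apply/eqP/rowP => j; rewrite [RHS]mxE; apply/eqP.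
      have /matrixP/(_ a j) := hc; rewrite [LHS]mxE big_ord1 [RHS]mxE [sc c _ _]mxE => h.
      apply/eqP/negPn/negP => c0; move/eqP: hj; apply.
      rewrite -[V 0 j]mul1r -(rmorph1 (cscal t)) -(mulVf c0) rmorphM -mulrA h.
      by rewrite mulr0.
    have [n' hn' hd'] := tker_dim_double hd; exists n' => //; lia.
  have [n hn /tker_dim_le hd] := dim p.
  have e2 : sm (S p.+2) = p by apply: rk.
  by move: hd; rewrite -[snext (snext _)]/(S p.+2) e2; lia.
have inv i : tinv (S i) by elim: i => [//|i IH]; apply: tinv_next.
by move=> [|i]; [apply: full|apply: tinv_full].
Qed.

End CubicStrand.

(** * The cubic algebra of an exact pair *)

Section CubicModelExists.
Variables (k : fieldType) (R : comAlgType k) (gr : std_graded R).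

Lemma kbasis_of_free n (x : 'I_n -> R) (hx : kbasis (in_deg gr 1) x) (z : 'I_n -> R) :
  (forall i, in_deg gr 1 (z i)) ->
  (forall c : 'rV[k]_n, \sum_i c 0 i *: z i = 0 -> c = 0) -> kbasis (in_deg gr 1) z.
Proof.
move=> zdeg zfree; split=> // v hv; pose M := \matrix_i coord1 hx (z i).
have cM (c : 'rV[k]_n) : c *m M = coord1 hx (\sum_i c 0 i *: z i).
  rewrite mulmx_sum_row coord1_sum; apply: eq_bigr => i _.
  by rewrite rowK coord1Z.
have Mfull : row_full M.
  have : row_free M.
    rewrite -kermx_eq0; apply/rowV0P => c /sub_kermxP; rewrite cM => h.
    apply: zfree; apply: (coord1_eq0 (hx := hx)) => //.
    by apply: in_deg_sum => i _; apply: in_deg_scale.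
  by rewrite /row_free /row_full.
have /submxP[c Ec] := submx_full (coord1 hx v) Mfull; exists c.
apply/eqP; rewrite -subr_eq0; apply/eqP/(coord1_eq0 (hx := hx)).
  apply: in_deg_add => //; apply: in_deg_opp; apply: in_deg_sum => i _.
  exact: in_deg_scale.
by rewrite coord1D -scaleN1r coord1Z -cM -Ec scaleN1r subrr.
Qed.

Variables (x : 'I_3 -> R) (hx : kbasis (in_deg gr 1) x).

Lemma outside_span u u' : in_deg gr 1 u -> in_deg gr 1 u' ->
  exists2 v, in_deg gr 1 v & forall c d : k, v <> c *: u + d *: u'.
Proof.
move=> hu hu'; apply: NNPP => hn.
have h i : exists c d : k, x i = c *: u + d *: u'.
  apply: NNPP => hni; apply: hn; exists (x i); first exact: (basis_deg1 hx).
  by move=> c d E; apply: hni; exists c, d.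
pose K := col_mx (coord1 hx u) (coord1 hx u').
have : row_full K.
  rewrite -sub1mx; apply/row_subP => i; have [c [d E]] := h i.
  have -> : row i 1%:M = c *: coord1 hx u + d *: coord1 hx u'.
    by rewrite row1 -(coord1_x hx i) E coord1D !coord1Z.
  by rewrite addmx_sub // scalemx_sub // /K -addsmxE ?addsmxSl ?addsmxSr.
by move=> /eqP hr; have := rank_leq_row K; rewrite hr.
Qed.

Lemma tri_basis l y z : in_deg gr 1 l -> in_deg gr 1 y -> in_deg gr 1 z -> l != 0 ->
  (forall c, y <> c *: l) -> (forall c d, z <> c *: l + d *: y) ->
  kbasis (in_deg gr 1) (tri l y z).
Proof.
move=> dl dy dz l0 hy hz; apply: (kbasis_of_free hx).
  by move=> [[|[|[|i]]] hi].
move=> c; rewrite sum3 [tri _ _ _ _]/= [tri _ _ _ i1]/= [tri _ _ _ i2]/= => h.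
have c2 : c 0 i2 = 0.
  apply/eqP/negPn/negP => c2; apply: (hz (- ((c 0 i2)^-1 * c 0 i0)) (- ((c 0 i2)^-1 * c 0 i1))).
  move/eqP: h; rewrite addrC addr_eq0 => /eqP h.
  apply: (scalerI c2); rewrite h scalerDr !scalerA !mulrN !mulrA divff // !mul1r.
  by rewrite opprD !scaleNr.
have c1 : c 0 i1 = 0.
  apply/eqP/negPn/negP => c1; apply: (hy (- ((c 0 i1)^-1 * c 0 i0))).
  move/eqP: h; rewrite c2 scale0r addr0 addrC addr_eq0 => /eqP h.
  by apply: (scalerI c1); rewrite h scalerA mulrN mulrA divff // mul1r scaleNr.
have c0 : c 0 i0 = 0.
  move/eqP: h; rewrite c1 c2 !scale0r !addr0 scaler_eq0 (negbTE l0) orbF.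
  by move/eqP.
apply/rowP => i; rewrite mxE; case: i => [[|[|[|i]]] hi] //.
- by rewrite -[RHS]c0; congr (c _ _); apply/val_inj.
- by rewrite -[RHS]c1; congr (c _ _); apply/val_inj.
by rewrite -[RHS]c2; congr (c _ _); apply/val_inj.
Qed.

Variables (l l' : R).
Hypotheses (hl : half_exact gr l l') (hl' : half_exact gr l' l) (l0 : l != 0).

Lemma deg2_lift y z u : kbasis (in_deg gr 1) (tri l y z) -> in_deg gr 2 u ->
  exists a0 a1 a2, u = l * (a0 *: l + a1 *: y + a2 *: z).
Proof.
move=> ht hu; case: hl => _ _ _ hdiv _; have [a ha ->] := hdiv u hu.
case: ht => _ _ /(_ a ha)[c Ec]; exists (c 0 i0), (c 0 i1), (c 0 i2).
by rewrite mulrC Ec sum3.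
Qed.

(** The multiplication of forms of degree one, divided by [l], is a cubic algebra.
The coefficients of the lifts are determined up to multiples of [l'] only, and
associativity fixes that choice. When [l'] is a multiple of [l] the basis can be
normalised so that [y z = 0], as in the parametrisation of cubic rings by binary
cubic forms; otherwise [l'] is taken as the second basis vector. *)
Theorem cubic_model : exists (t : cubic k) (y z : R),
  [/\ kbasis (in_deg gr 1) (tri l y z),
      y * y = l * (ca0 t *: l + ca1 t *: y + ca2 t *: z),
      y * z = l * (cb0 t *: l + cb1 t *: y + cb2 t *: z)
    & z * z = l * (cc0 t *: l + cc1 t *: y + cc2 t *: z)].
Proof.
have [dl dl' ll' _ hann] := hl; have [_ _ _ _ hann'] := hl'.
have [A SA [AD AM]] : exists2 A : k -> R, forall c a, c *: a = A c * a &
    (forall c d, A (c + d) = A c + A d) /\ (forall c d, A (c * d) = A c * A d).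
  exists (in_alg R); first by move=> c a; rewrite /= mulr_algl.
  by split=> c d; [exact: rmorphD|exact: rmorphM].
case: (classic (exists c : k, l' = c *: l)) => [[c Ec]|hn].
  have ll : l * l = 0.
    have c0 : c != 0.
      by apply: contraNneq (half_exact_neq0 hl hl' l0) => c0; rewrite Ec c0 scale0r.
    move/eqP: ll'; rewrite Ec -scalerAl scaler_eq0 (negbTE c0) /=.
    by move/eqP.
  have [u du hu] := outside_span dl dl.
  have [v dv hv] := outside_span dl du.
  have hu1 (d : k) : u <> d *: l.
    by move=> E; apply: (hu d 0); rewrite scale0r addr0.
  have hb := tri_basis dl du dv l0 hu1 hv.
  have [s0 [s1 [s2 Es]]] := deg2_lift hb (in_deg_mul du dv).
  pose y := u - s2 *: l; pose z := v - s1 *: l.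
  have dy : in_deg gr 1 y by apply/in_deg_add/in_deg_opp/in_deg_scale.
  have dz : in_deg gr 1 z by apply/in_deg_add/in_deg_opp/in_deg_scale.
  have yz : y * z = 0.
    rewrite /y /z mulrBl !mulrBr Es !SA.
    have -> : l * (A s0 * l + A s1 * u + A s2 * v) - u * (A s1 * l) -
      (A s2 * l * v - A s2 * l * (A s1 * l)) = (A s0 + A s1 * A s2) * (l * l) by ring.
    by rewrite ll mulr0.
  have ht : kbasis (in_deg gr 1) (tri l y z).
    apply: tri_basis => // [d Ed|d d' Ed].
      by apply: (hu1 (d + s2)); rewrite scalerDl -Ed subrK.
    apply: (hv (d + s1 - d' * s2) d'); apply/eqP; rewrite -subr_eq0; apply/eqP.
    have : z - (d *: l + d' *: y) = 0 by rewrite Ed subrr.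
    by rewrite /z /y => <-; rewrite scalerBl scalerDl scalerBr scalerA; ring.
  have [a0 [a1 [a2 Ea]]] := deg2_lift ht (in_deg_mul dy dy).
  have [c0 [c1 [c2 Ecc]]] := deg2_lift ht (in_deg_mul dz dz).
  have drop a b b' w w' : l * (a *: l + b *: w + b' *: w') = l * (b *: w + b' *: w').
    by rewrite -addrA mulrDr -scalerAr ll scaler0 add0r.
  have H1 : a1 * (a2 * c1) + a2 * (- (a1 * c1)) = 0 * (- (a2 * c2)) + 0 * (a2 * c1) by ring.
  have H2 : a1 * 0 + a2 * c1 = a2 * c1 + 0 * a1 + 0 * 0 by ring.
  have H3 : - (a2 * c2) + a1 * 0 + a2 * c2 = 0 * a2 + 0 * 0 by ring.
  have H4 : 0 * (a2 * c1) + 0 * (- (a1 * c1)) = c1 * (- (a2 * c2)) + c2 * (a2 * c1) by ring.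
  have H5 : 0 * 0 + 0 * c1 = - (a1 * c1) + c1 * a1 + c2 * 0 by ring.
  have H6 : a2 * c1 + 0 * 0 + 0 * c2 = c1 * a2 + c2 * 0 by ring.
  exists (Cubic H1 H2 H3 H4 H5 H6), y, z; split=> //=.
  - by rewrite drop Ea drop.
  - by rewrite yz !scale0r !addr0 -scalerAr ll scaler0.
  by rewrite drop Ecc drop.
have [v dv hv] := outside_span dl dl'.
have hn1 (c : k) : l' <> c *: l by move=> E; apply: hn; exists c.
have ht := tri_basis dl dl' dv l0 hn1 hv.
have [al [r0 [be Eww]]] := deg2_lift ht (in_deg_mul dl' dl').
have [ga [s0 [de Ewv]]] := deg2_lift ht (in_deg_mul dl' dv).
have [ep [t0 [ze Evv]]] := deg2_lift ht (in_deg_mul dv dv).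
have drop a b b' b'' : l * (a *: l + b *: l' + b' *: v) = l * (a *: l + b'' *: l' + b' *: v).
  rewrite !mulrDr; congr (_ + _ + _).
  by rewrite -!scalerAr mulrC ll' !scaler0.
pose D := al * de - be * ga.
have D0 : D != 0.
  apply/eqP => hD.
  have lin a b : a * al + b * ga = 0 -> a * be + b * de = 0 -> a = 0 /\ b = 0.
    move=> e1 e2; have h : (a *: l' + b *: v) * l' = 0.
      have -> : (a *: l' + b *: v) * l' = a *: (l' * l') + b *: (l' * v).
        by rewrite mulrDl -!scalerAl [v * l']mulrC.
      rewrite Eww Ewv (drop _ _ _ 0) (drop ga _ _ 0) !scale0r !addr0.
      rewrite !scalerAr -mulrDr !scalerDr !scalerA addrACA -!scalerDl e1 e2.
      by rewrite !scale0r addr0 mulr0.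
    have [|c Ec] := hann' (a *: l' + b *: v) _ h.
      by apply: in_deg_add; apply: in_deg_scale.
    have b0 : b = 0.
      apply/eqP/negPn/negP => b0; apply: (hv (b^-1 * c) (- (b^-1 * a))).
      apply: (scalerI b0); rewrite scalerDr !scalerA mulrN !mulrA divff // !mul1r.
      by rewrite -Ec scaleNr addrAC subrr add0r.
    split=> //; apply/eqP/negPn/negP => a0; apply: (hn1 (a^-1 * c)).
    apply: (scalerI a0); rewrite scalerA mulrA divff // mul1r -Ec b0.
    by rewrite scale0r addr0.
  have [||_ al0] := lin (- ga) al.
  - by ring.
  - by rewrite -hD /D; ring.
  have [||_ be0] := lin (- de) be.
  - by transitivity (- D); [rewrite /D; ring|rewrite hD oppr0].
  - by ring.
  have [||/eqP] := lin 1 0; rewrite ?al0 ?be0; [by ring|by ring|].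
  by rewrite oner_eq0.
(* Associativity of [l' l' v] and [l' v v] determines the coefficients [r], [s], [u]
   of [l'] in the lifts of the three products. *)
pose s := (be * de * ep - be * ga * ze - al * ga) / D.
pose r := (al * de ^+ 2 + be ^+ 2 * ep - be * de * ga - al ^+ 2 - al * be * ze) / D.
pose u := (de ^+ 2 * ep - de * ze * ga - ga ^+ 2) / D.
have H1 : r * ga + be * ep = s * al + de * ga by rewrite /r /s /D; field.
have H2 : r * s + be * u = ga + s * r + de * s by rewrite /r /s /u /D; field.
have H3 : al + r * de + be * ze = s * be + de * de by rewrite /r /s /D; field.
have H4 : s * ga + de * ep = u * al + ze * ga by rewrite /u /s /D; field.
have H5 : s * s + de * u = ep + u * r + ze * s by rewrite /r /s /u /D; field.
have H6 : ga + s * de + de * ze = u * be + ze * de by rewrite /u /s /D; field.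
exists (Cubic H1 H2 H3 H4 H5 H6), l', v; split=> //=.
- by rewrite Eww; apply: drop.
- by rewrite Ewv; apply: drop.
by rewrite Evv; apply: drop.
Qed.

End CubicModelExists.

(** * The linear loci of short algebras *)

Section LinearLoci.
Variables (k : fieldType) (R : comAlgType k) (gr : std_graded R).
Hypothesis hshort : short gr.

(** On the line joining two forms the square, a multiple of a single form of
degree two, is a quadratic polynomial in the parameter. *)
Lemma closed_field_square_zero (y : 'I_1 -> R) (a b : R) :
  kbasis (in_deg gr 2) y -> in_deg gr 1 a -> in_deg gr 1 b ->
  (forall c d : k, c *: a + d *: b = 0 -> c = 0 /\ d = 0) ->
  GRing.closed_field_axiom k ->
  exists v : R, [/\ in_deg gr 1 v, v != 0 & v ^+ 2 = 0].
Proof.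
move=> [_ _ hspan] da db hfree hk.
have sq u v : in_deg gr 1 u -> in_deg gr 1 v -> exists c : k, u * v = c *: y 0.
  move=> hu hv; have [c Ec] := hspan _ (in_deg_mul hu hv).
  by exists (c 0 0); rewrite Ec big_ord1.
have [A EA] := sq _ _ da da; have [B EB] := sq _ _ da db.
have [C EC] := sq _ _ db db.
have [A0|A0] := eqVneq A 0.
  exists a; split=> //; last by rewrite expr2 EA A0 scale0r.
  apply/eqP => a0; have [|/eqP] := hfree 1 0; first by rewrite a0 scaler0 scale0r addr0.
  by rewrite oner_eq0.
have [c hc] := hk 2 (fun i => if i == 0%N then - (C / A) else - (2 * B / A)) isT.
have {}hc : A * c ^+ 2 + 2 * B * c + C = 0.
  by rewrite hc !big_ord_recl big_ord0 /=; field.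
exists (c *: a + b); split.
- by apply: in_deg_add => //; apply: in_deg_scale.
- apply/eqP => h; have [|_ /eqP] := hfree c 1; first by rewrite scale1r.
  by rewrite oner_eq0.
have -> : (c *: a + b) ^+ 2 = c *: (c *: (a * a)) + (c *: (a * b) + c *: (a * b)) + b * b.
  rewrite expr2 mulrDl !mulrDr -!scalerAl -!scalerAr [b * a]mulrC.
  by rewrite !addrA.
rewrite EA EB EC !scalerA -!scalerDl -[RHS](scale0r (y 0)) -hc.
by congr (_ *: _); ring.
Qed.

(** There is a single matrix without columns. *)
Lemma zariski_open_no_columns m n (U : 'M[k]_(m, n) -> Prop) : n = 0%N ->
  zariski_open U.
Proof.
move=> n0; have hM (C C' : 'M[k]_(m, n)) : C = C'.
  by subst n; apply/matrixP => i [].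
case: (classic (exists C, U C)) => [[C hC]|hn].
  apply: zariski_closed_iff (zariski_closed_empty k m n) => C'.
  by rewrite (hM C' C); split=> // /(_ hC).
exists (fun _ => False) => C; split=> // _ hC; apply: hn; exists C.
exact: hC.
Qed.

Section TernaryQuadrics.
Variables (x : 'I_3 -> R) (hx : kbasis (in_deg gr 1%N) x).
Variables (y : 'I_2 -> R) (hy : kbasis (in_deg gr 2) y).
Variables (l l' : R).
Hypotheses (hl : half_exact gr l l') (hl' : half_exact gr l' l) (l0 : l != 0).

(** The strand is controlled over the cubic algebra by its first [p + 2] steps. *)
Theorem exact_pair_open3 p : (0 < p)%N ->
  zariski_open (@linear_locus k R gr 3 x hx p (2 * p)).
Proof.
move=> p0; have [P] := exact_pair_linres hshort hx hl hl' l0.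
have [t [u [v [ht huu huv hvv]]]] := cubic_model hx hl hl' l0.
apply: (@linear_locus_open _ _ _ P _ _ hx p (2 * p) p.+2) => C.
  by move=> hC i; apply: koszul_phi_surj.
move=> hs; apply: (strand_koszul hshort hx (hy := hy)) => //.
apply: (cubic_strand_full ht huu huv hvv hl hl' l0 hx) => -[|i] hi.
  exact: phi_surj_full0 (hs 0%N _).
exact: (phi_surj_full hshort hy (hs i.+1 _)).
Qed.

End TernaryQuadrics.

Theorem quadratic_open (e : nat) (x : 'I_e -> R) (hx : kbasis (in_deg gr 1%N) x) p :
  quadratic gr -> has_rank (in_deg gr 2) (e - 1) -> (e <= 3)%N -> (0 < p)%N ->
  zariski_open (@linear_locus k R gr e x hx p ((e - 1) * p)).
Proof.
move=> hquad [y hy] he p0; case: (classic (infinite_field k)) => hinf; last first.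
  exact: zariski_closed_finite.
case: e x hx y hy he => [|[|[|[|e]]]] x hx y hy he //.
- exact: zariski_open_no_columns.
- exact: zariski_open_no_columns.
- by apply: (pairing_open hshort hx hy) => // a; apply: (quadratic_nosocle2 hshort hquad hx hy).
have [l [l' [hl hl' l0]]] := quadratic_exact_pair hshort hquad hx hy hinf.
exact: (exact_pair_open3 hx hy hl hl' l0).
Qed.

Theorem quadratic_nonempty (e : nat) (x : 'I_e -> R) (hx : kbasis (in_deg gr 1%N) x) p :
  quadratic gr -> has_rank (in_deg gr 2) (e - 1) -> (0 < e <= 3)%N -> (0 < p)%N ->
  infinite_field k ->
  exists C : 'M[k]_(e * p, (e - 1) * p), linear_locus hx C.
Proof.
move=> hquad hr /andP[e0 he] p0 hinf; have [y hy] := hr.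
case: e x hx hr y hy e0 he => [|[|[|[|e]]]] x hx hr y hy e0 he //.
- have h2 a : in_deg gr 2 a -> a = 0.
    by case: hy => _ _ hsp /hsp[c ->]; apply: big1 => -[].
  have hl : half_exact gr (x 0) (x 0).
    have d0 := basis_deg1 hx 0; split=> //.
    - exact/h2/(in_deg_mul d0 d0).
    - by move=> z /h2 ->; exists 0; [exact: in_deg_zero|rewrite mul0r].
    by move=> a; case: hx => _ _ hsp /hsp[c ->] _; exists (c 0 0); rewrite big_ord1.
  apply: (exact_pair_nonempty hshort hx hl hl) => //; last by exists 0%N.
  case: hx => _ hfree _; apply/eqP => h.
  have := hfree (const_mx 1); rewrite big_ord1 h scaler0 => /(_ erefl).
  by move=> /matrixP/(_ 0 0); rewrite !mxE => /eqP; rewrite oner_eq0.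
- by apply: (pairing_nonempty hshort hx hy) => // a; apply: (quadratic_nosocle2 hshort hquad hx hy).
have [l [l' [hl hl' l0]]] := quadratic_exact_pair hshort hquad hx hy hinf.
by apply: (exact_pair_nonempty hshort hx hl hl' l0) => //; exists 2%N.
Qed.

End LinearLoci.

Theorem theorem3 (k : fieldType) (R : comAlgType k) (gr : std_graded R)
    (e : nat) (x : 'I_e -> R) (hx : kbasis (in_deg gr 1%N) x)
    (hshort : short gr) :
  (gorenstein R -> (2 <= e)%N ->
     (forall p q : nat, (1 <= p)%N ->
        zariski_open (@linear_locus k R gr e x hx p q) /\
        ((q <= (e - 1) * p)%N ->
         (exists y : R, [/\ in_deg gr 1%N y, y != 0 & y ^+ 2 = 0]) ->
         exists C : 'M[k]_(e * p, q), linear_locus hx C)) /\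
     (GRing.closed_field_axiom k ->
        exists y : R, [/\ in_deg gr 1%N y, y != 0 & y ^+ 2 = 0])) /\
  (quadratic gr ->
     has_hilbert_series gr (1 + e%:Z *: 'X + (e%:Z - 1) *: 'X^2) ->
     (e <= 3)%N ->
     forall p : nat, (1 <= p)%N ->
       zariski_open (@linear_locus k R gr e x hx p ((e - 1) * p)%N) /\
       (infinite_field k ->
        exists C : 'M[k]_(e * p, (e - 1) * p), linear_locus hx C)).
Proof.
split=> [hG he|hquad hH he p p0].
  have [[y hy] nondeg] := gorenstein_pairing hshort hx hG he.
  split=> [p q p0|hk].
    split=> [|hq _]; first exact: (pairing_open hshort hx hy).
    exact: (pairing_nonempty hshort hx hy nondeg).
  pose i0 := Ordinal (ltnW he); pose i1 := Ordinal he.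
  apply: (closed_field_square_zero hy (basis_deg1 hx i0) (basis_deg1 hx i1)) => //.
  move=> c d E; have {}E : c *: coord1 hx (x i0) + d *: coord1 hx (x i1) = 0.
    by rewrite -!coord1Z -coord1D E coord1_0.
  split; [have := congr1 (fun v : 'rV_e => v 0 i0) E|
          have := congr1 (fun v : 'rV_e => v 0 i1) E];
    by rewrite !coord1_x !mxE !eqxx /= ?mulr0 ?mulr1 ?addr0 ?add0r.
have [d hd Ed] := hH 2%N.
have {}Ed : e%:Z - 1 = d%:Z.
  by rewrite -Ed !coefD !coefZ coef1 coefX coefXn /= mulr0 mulr1 !add0r.
have Ee : e = d.+1 by lia.
have hr : has_rank (in_deg gr 2) (e - 1) by rewrite Ee subn1.
split; first exact: quadratic_open.
by apply: quadratic_nonempty => //; rewrite he Ee.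
Qed.
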